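(* Let $N>2$, $s\in(0,1)$, and let $\Omega\subset\mathbb{R}^N$ be a bounded strictly convex domain. Let $u_0\in\mathcal{C}(\mathbb{R}^N)$ and $g$ satisfy $\Lambda_1^s u_0\in L^\infty(\Omega)$, $g\in\mathcal{C}(\mathbb{R}^N\setminus\Omega)\cap L^\infty(\mathbb{R}^N\setminus\Omega)$ and $u_0=g$ in $\mathbb{R}^N\setminus\Omega$. Then there exists a unique viscosity solution to $$\begin{cases} u_t(x,t)=\Lambda_1^s u(x,t) &\text{in }\Omega\times(0,\infty),\\ u(x,t)=g(x) &\text{in }(\mathbb{R}^N\setminus\Omega)\times(0,\infty),\\ u(x,0)=u_0(x)&\text{in }\mathbb{R}^N.\end{cases}\qquad(\mathrm{P})$$ Moreover, a comparison principle holds: if $\overline{u}$ is a viscosity supersolution and $\underline{u}$ is a viscosity subsolution to (P), then $\overline{u}(x,t)\ge\underline{u}(x,t)$ for every $(x,t)\in\Omega\times(0,\infty)$.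
   Context: The operator is $\Lambda_1^s u(x)=\inf_{\theta\in\mathbb{S}^{N-1}}\int_{\mathbb{R}}\frac{u(x+\tau\theta)-u(x)}{|\tau|^{1+2s}}\,d\tau$, acting in the space variable; integrals are in the principal value sense. ''Bounded strictly convex domain'' means a bounded domain with $\mathcal{C}^2$ boundary such that all principal curvatures of $\partial\Omega$ are positive everywhere. Viscosity solutions of the evolution problem. Let $T>0$. A bounded upper (resp. lower) semicontinuous function $u:\mathbb{R}^N\times[0,T]\to\mathbb{R}$ is a viscosity subsolution (resp. supersolution) of the problem on $(0,T)$ if: $u\le g$ (resp. $\ge$) in $(\mathbb{R}^N\setminus\Omega)\times[0,T)$; $u(x,0)\le u_0(x)$ (resp. $\ge$) in $\Omega$; and for every smooth $\varphi:\mathbb{R}^N\times[0,\infty)\to\mathbb{R}$ and every maximum (resp. minimum) point $(x_0,t_0)\in\Omega\times(0,T)$ of $u-\varphi$ in $B_\delta(x_0)\times(t_0-\delta,t_0+\delta)\subseteq\Omega\times(0,T)$, for some $\delta>0$, one has $$\varphi_t(x_0,t_0)-\inf_{\theta\in\mathbb{S}^{N-1}}\left\{\int_{-\delta}^{\delta}\frac{\varphi(x_0+\tau\theta,t_0)-\varphi(x_0,t_0)}{|\tau|^{1+2s}}d\tau+\int_{\mathbb{R}\setminus(-\delta,\delta)}\frac{u(x_0+\tau\theta,t_0)-u(x_0,t_0)}{|\tau|^{1+2s}}d\tau\right\}\le0\quad(\text{resp. }\ge0).$$ A bounded upper (resp. lower) semicontinuous function on $\mathbb{R}^N\times[0,\infty)$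 is a viscosity subsolution (resp. supersolution) of (P) if it is one on $(0,T)$ for every $T>0$. A viscosity solution of (P) is a continuous function on $\mathbb{R}^N\times[0,\infty)$ that is both a subsolution and a supersolution. *)

(* Defs.v *)
From HB Require Import structures.
From mathcomp Require Import all_boot all_order all_algebra.
From mathcomp Require Import all_classical all_reals all_analysis.
Import Order.TTheory GRing.Theory Num.Theory.
Import numFieldNormedType.Exports.

Set Implicit Arguments.
Unset Strict Implicit.
Unset Printing Implicit Defensive.

Local Open Scope classical_set_scope.
Local Open Scope ring_scope.

Section EuclideanSpace.
Context {R : realType}.

(* The library norm on 'rV[R]_N is the sup norm; it has the Euclidean topology
   and bounded sets, but not the Euclidean sphere and balls. *)
Definition enorm {N : nat} (x : 'rV[R]_N) : R :=
  Num.sqrt (\sum_i x 0 i ^+ 2).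

Definition usphere {N : nat} : set 'rV[R]_N := [set x | enorm x = 1].

Definition eball {N : nat} (x : 'rV[R]_N) (r : R) : set 'rV[R]_N :=
  [set y | enorm (y - x) < r].

Fixpoint Ck {V : normedModType R} (k : nat) (f : V -> R) : Prop :=
  match k with
  | 0%N => continuous f
  | k'.+1 => [/\ continuous f, forall v x, derivable f x v
               & forall v, Ck k' ('D_v f)]
  end.

Definition smooth {V : normedModType R} (f : V -> R) : Prop :=
  forall k, Ck k f.

End EuclideanSpace.

Section LebesgueEssentiallyBounded.
Context {R : realType} {N : nat}.
Local Open Scope ereal_scope.

Definition box (a b : 'rV[R]_N) : set 'rV[R]_N :=
  [set x | forall i, (a 0%R i <= x 0%R i <= b 0%R i)%R].

Definition lebesgue_outer (A : set 'rV[R]_N) : \bar R :=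
  ereal_inf [set e | exists a b : nat -> 'rV[R]_N,
    [/\ forall k i, (a k 0%R i <= b k 0%R i)%R,
        A `<=` \bigcup_k box (a k) (b k)
      & e = \sum_(0 <= k <oo) (\prod_i (b k 0%R i - a k 0%R i))%R%:E]].

Definition ae_on (A : set 'rV[R]_N) (P : 'rV[R]_N -> Prop) : Prop :=
  lebesgue_outer (A `&` [set x | ~ P x]) = 0.

Definition Linfty (A : set 'rV[R]_N) (f : 'rV[R]_N -> \bar R) : Prop :=
  (forall a : \bar R,
     lebesgue_outer.-caratheodory (A `&` [set x | a < f x])) /\
  (exists M : R, ae_on A (fun x => `|f x| <= M%:E)).

End LebesgueEssentiallyBounded.

Section StrictlyConvexDomain.
Context {R : realType} {N : nat}.
Implicit Types (Omega : set 'rV[R]_N) (z nu : 'rV[R]_N).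

Definition boundary Omega : set 'rV[R]_N := closure Omega `\` Omega°.

(* The rows of E followed by nu form an orthonormal basis of R^N.  In the
   coordinates (y, h) that it gives around the boundary point z, Omega is
   locally the epigraph of gamma; gamma is flat at the origin, so nu is the
   inward unit normal at z and the rows of E span the tangent space. *)
Definition normal_chart Omega z (E : 'M[R]_(N.-1, N)) nu
    (gamma : 'rV[R]_N.-1 -> R) (r : R) : Prop :=
  [/\ [/\ E *m E^T = 1%:M, E *m nu^T = 0 & nu *m nu^T = 1%:M],
      0 < r,
      Ck 2 gamma,
      forall v, 'D_v gamma 0 = 0
    & forall (y : 'rV[R]_N.-1) (h : R), enorm (y *m E + h *: nu) < r ->
        (Omega (z + (y *m E + h *: nu)) <-> gamma y < h)].

Definition C2_boundary Omega : Prop :=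
  forall z, boundary Omega z ->
    exists E nu gamma r, normal_chart Omega z E nu gamma r.

Definition hessian {n : nat} (f : 'rV[R]_n -> R) (x : 'rV[R]_n) : 'M[R]_n :=
  \matrix_(i, j) 'D_(delta_mx 0 i) ('D_(delta_mx 0 j) f) x.

(* With respect to the inward normal, so that a ball of radius r has all its
   principal curvatures equal to r^-1. *)
Definition principal_curvature Omega z (kappa : R) : Prop :=
  exists E nu gamma r, normal_chart Omega z E nu gamma r /\
    eigenvalue (hessian gamma 0) kappa.

Definition bounded_strictly_convex_domain Omega : Prop :=
  [/\ [/\ open Omega, connected Omega & Omega !=set0],
      bounded_set Omega,
      C2_boundary Omega
    & forall z kappa, boundary Omega z -> principal_curvature Omega z kappa ->
        0 < kappa].

End StrictlyConvexDomain.

Section Operator.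
Context {R : realType} {N : nat}.
Variable s : R.
Implicit Types (u v : 'rV[R]_N -> R) (x theta : 'rV[R]_N) (A : set R).

Definition line_integral v x theta A : \bar R :=
  (\int[lebesgue_measure]_(tau in A)
     ((v (x + tau *: theta) - v x) / `|tau| `^ (1 + 2 * s))%:E)%E.

Definition truncated_integral v x theta A (eps : R) : \bar R :=
  line_integral v x theta (A `&` [set tau | eps <= `|tau|]).

Definition pv_exists v x theta A : Prop :=
  cvg (truncated_integral v x theta A eps @[eps --> 0^'+]).

(* Principal value at tau = 0; meaningful under [pv_exists]. *)
Definition pv_integral v x theta A : \bar R :=
  lim (truncated_integral v x theta A eps @[eps --> 0^'+]).

Definition Lambda1_defined u x : Prop :=
  forall theta, usphere theta -> pv_exists u x theta setT.

Definition Lambda1 u x : \bar R :=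
  ereal_inf [set pv_integral u x theta setT | theta in usphere].

(* [phi] is used on (-delta, delta) and [u] outside. *)
Definition Lambda1_test (delta : R) (phi u : 'rV[R]_N -> R) x : \bar R :=
  ereal_inf [set (pv_integral phi x theta `](- delta)%R, delta[ +
                  line_integral u x theta (~` `](- delta)%R, delta[))%E
            | theta in usphere].

End Operator.

Section Viscosity.
Context {R : realType} {N : nat}.
Variables (s : R) (Omega : set 'rV[R]_N) (g u0 : 'rV[R]_N -> R).
Implicit Types (u : 'rV[R]_N * R -> R) (A : set ('rV[R]_N * R)).

(* Functions of (x, t) are total; only their values for t >= 0 matter. *)
Definition halfspace : set ('rV[R]_N * R) := [set z | 0 <= z.2].
Definition strip (T : R) : set ('rV[R]_N * R) := [set z | 0 <= z.2 <= T].

Definition lsc_on A u : Prop :=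
  lower_semicontinuous ((fun z => (u z)%:E) : subspace A -> \bar R).
Definition usc_on A u : Prop :=
  lower_semicontinuous ((fun z => (- u z)%:E) : subspace A -> \bar R).

Definition slice u (t : R) : 'rV[R]_N -> R := fun x => u (x, t).

Definition cylinder (x0 : 'rV[R]_N) (t0 delta : R) : set ('rV[R]_N * R) :=
  eball x0 delta `*` `](t0 - delta), (t0 + delta)[.

Definition viscosity_residual (delta : R) (phi u : 'rV[R]_N * R -> R)
    (x0 : 'rV[R]_N) (t0 : R) : \bar R :=
  ((derive1 (fun t => phi (x0, t)) t0)%:E
   - Lambda1_test s delta (slice phi t0) (slice u t0) x0)%E.

Definition viscosity_subsolution_upto (T : R) u : Prop :=
  [/\ [bounded u z | z in strip T] /\ usc_on (strip T) u,
      forall x t, ~ Omega x -> 0 <= t < T -> u (x, t) <= g x,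
      forall x, Omega x -> u (x, 0) <= u0 x
    & forall phi : 'rV[R]_N * R -> R, smooth phi ->
      forall x0 t0 delta, Omega x0 -> 0 < t0 < T -> 0 < delta ->
        cylinder x0 t0 delta `<=` Omega `*` `]0, T[ ->
        (forall z, cylinder x0 t0 delta z ->
           u z - phi z <= u (x0, t0) - phi (x0, t0)) ->
        (viscosity_residual delta phi u x0 t0 <= 0)%E].

Definition viscosity_supersolution_upto (T : R) u : Prop :=
  [/\ [bounded u z | z in strip T] /\ lsc_on (strip T) u,
      forall x t, ~ Omega x -> 0 <= t < T -> g x <= u (x, t),
      forall x, Omega x -> u0 x <= u (x, 0)
    & forall phi : 'rV[R]_N * R -> R, smooth phi ->
      forall x0 t0 delta, Omega x0 -> 0 < t0 < T -> 0 < delta ->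
        cylinder x0 t0 delta `<=` Omega `*` `]0, T[ ->
        (forall z, cylinder x0 t0 delta z ->
           u (x0, t0) - phi (x0, t0) <= u z - phi z) ->
        (0 <= viscosity_residual delta phi u x0 t0)%E].

Definition viscosity_subsolution u : Prop :=
  [/\ [bounded u z | z in halfspace], usc_on halfspace u
    & forall T, 0 < T -> viscosity_subsolution_upto T u].

Definition viscosity_supersolution u : Prop :=
  [/\ [bounded u z | z in halfspace], lsc_on halfspace u
    & forall T, 0 < T -> viscosity_supersolution_upto T u].

Definition viscosity_solution u : Prop :=
  [/\ {within halfspace, continuous u},
      viscosity_subsolution u & viscosity_supersolution u].

End Viscosity.

(* Main.v *)
Require Import Defs.
From mathcomp Require Import all_boot all_order all_algebra.
From mathcomp Require Import all_classical all_reals all_analysis.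
From mathcomp Require Import measurable_realfun ring lra.
Import Order.TTheory GRing.Theory Num.Theory.
Import numFieldNormedType.Exports.

(** The equation is degenerate and nonlocal, and the proof follows the viscosity pattern: a comparison
    principle, and the construction of a subsolution and a supersolution that comparison
    identifies.

    _The operator._ Folding [tau] and [- tau] together turns each directional integral into the
    integral over ]0, +oo[ of the second difference [sd w x (t *: theta)] against
    [t `^ (- (1 + 2 s))]. With a smooth function up to [d] and a bounded one beyond, the second
    difference is at most a multiple of [min 1 (t ^+ 2)]; the principal value is thus an absolutely
    convergent integral, [testJ], and the viscosity inequalities are inequalities between real
    numbers: for all directions in the case of a subsolution, for a nearly optimal one in the case
    of a supersolution ([residual_le0P], [residual_ge0P]).

    _Comparison_ ([comparison_principle]). The variables are doubled with a quadratic penalty, which is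
    invariant under simultaneous translations. At a maximum point the second differences of the
    subsolution are therefore below those of the supersolution in every direction and over any
    prescribed length; a nearly optimal direction for the latter is used for both, and a small
    slope in time absorbs the far field. Uniqueness follows.

    _Existence_ ([viscosity_existence]). For a mesh [rho] the integrals are sampled at multiples of
    [rho], which makes them meaningful for every bounded function, and an explicit time step
    [cfl] is chosen for which the scheme [w + cfl * inf_theta (stepI w theta)] is monotone. The
    relaxed upper limit [U] of the iterates as [rho] tends to 0 is a subsolution and the relaxed
    lower limit [V] a supersolution ([upper_limit_test]): at a near maximizer of an iterate minus
    a test function, monotonicity lets the test function replace the iterate in the scheme,
    the mean value theorem provides the time derivative, and Fatou's lemma together with the
    compactness of the sphere provides the limit. Barriers show that [U <= u0 <= V] at time 0 and
    outside the domain; comparison gives [U <= V], whence [U = V] is a continuous solution.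

    _Barriers._ The initial values are controlled by truncated paraboloids. At a boundary point [z]
    the strict convexity enters: the domain lies inside a ball whose boundary contains [z]. The
    defining function of the ball is, along each line, the product of the distances to the two
    ends of a chord, and its power [s / 8] is a strict supersolution in every direction with a
    margin that does not degenerate near the boundary ([profile_supersolution]): up to the nearest
    end of the chord the power is concave, and past it the value lost is not compensated by the
    slow growth on the other side.

    _Geometry._ Positive principal curvatures make the Hessian of the boundary chart positive definite,
    which gives a tangent ball that contains the domain near [z]; a connected domain with this property
    at all boundary points is convex, and contracting it towards [z] makes the ball global
    ([global_tangent_ball]).

    Finally the datum is bounded ([datum_bounded]): the essential bound of [g] holds at every point
    of an open set on which [g] is continuous, because a set containing a box has positive outer measure
    ([box_cover_volume]), and [u0] is continuous on the remaining compact set. *)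

Set Implicit Arguments.
Unset Strict Implicit.
Unset Printing Implicit Defensive.

Local Open Scope classical_set_scope.
Local Open Scope ring_scope.

(** * Differential calculus along lines *)

Section LineCalculus.
Context {R : realType} {V : normedModType R}.
Implicit Types (f : V -> R) (x u v : V) (t c : R).

Lemma is_derive_line f x v t : derivable f (x + t *: v) v ->
  is_derive t 1 (fun r : R => f (x + r *: v)) ('D_v f (x + t *: v)).
Proof.
move=> df.
have E : (fun h : R => h^-1 *: (((fun r : R => f (x + r *: v)) \o shift t) (h *: (1 : R)) -
    f (x + t *: v))) = (fun h => h^-1 *: ((f \o shift (x + t *: v)) (h *: v) - f (x + t *: v))).
  apply/funext => h /=; congr (_ *: (f _ - _)).
  by rewrite [h *: 1]mulr1 scalerDl addrCA.
split; first by rewrite /derivable E.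
by rewrite /derive E.
Qed.

Lemma Ck_cont k f : Ck k f -> continuous f.
Proof. by case: k => // k []. Qed.

Lemma CkW k f : Ck k.+1 f -> Ck k f.
Proof.
elim: k f => [|k IH] f; first by case.
by move=> [cf df Df]; split => // v; exact/IH/Df.
Qed.

Lemma continuous_modulus f x (e : R) : continuous f -> 0 < e ->
  exists2 d : R, 0 < d & forall y, `|x - y| < d -> `|f x - f y| < e.
Proof.
move=> cf e0.
have /cvgrPdist_lt/(_ _ e0)/nbhs_ballP[d /= d0 H] := cf x.
by exists d => // y; have := H y; rewrite -ball_normE.
Qed.

Lemma continuous_line f x v : continuous f -> continuous (fun r : R => f (x + r *: v)).
Proof.
move=> cf r; apply: (continuous_comp (f := fun r : R => x + r *: v)); last exact: cf.
by apply: cvgD; [exact: cvg_cst|apply: cvgZr_tmp; exact: cvg_id].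
Qed.

Lemma MVT_line f x v t : Ck 1 f -> 0 < t ->
  exists2 c : R, 0 < c < t & f (x + t *: v) - f x = t * 'D_v f (x + c *: v).
Proof.
move=> [cf df _] t0.
have [c /[!in_itv]/= ct E] := @MVT R (fun r => f (x + r *: v)) (fun r => 'D_v f (x + r *: v)) 0 t t0
  (fun r _ => is_derive_line (df _ _)) (continuous_subspaceT (@continuous_line f x v cf)).
exists c => //.
by move: E; rewrite /= scale0r addr0 subr0 mulrC.
Qed.

Lemma derive_scale f x v c : Ck 1 f -> 'D_(c *: v) f x = c * 'D_v f x.
Proof.
move=> [cf df _].
have H1 := @is_derive_line f x (c *: v) 0 (df _ _).
have H2 := @is_derive_line f x v (c * 0) (df _ _).
have H3 : is_derive (0 : R) (1 : R) (fun r : R => c * r) c.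
  by have := @is_deriveZ R R R id c 0 1 1 (is_derive_id _ _); rewrite [c *: 1]mulr1.
have H4 := @is_derive1_comp R (fun r : R => f (x + r *: v)) (fun r => c * r) 0 _ _ H2 H3.
have E : (fun r : R => f (x + r *: v)) \o (fun r => c * r) = (fun r : R => f (x + r *: (c *: v))).
  by apply/funext => r /=; rewrite scalerA mulrC.
rewrite E in H4.
have := @derive_val _ _ _ _ _ _ _ H1; rewrite (@derive_val _ _ _ _ _ _ _ H4).
by rewrite !mulr0 !scale0r addr0 mulrC => ->.
Qed.

(** Additivity in the direction needs the continuity of the derivatives: the increment along
    [u + v] is split at [x + h u] and each half is a mean value at a nearby point. *)
Lemma derive_add f x u v : Ck 1 f -> 'D_(u + v) f x = 'D_u f x + 'D_v f x.
Proof.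
move=> cf; have [cf0 df Df] := cf.
have Q1 : (fun h : R => h^-1 *: ((f \o shift x) (h *: (u + v)) - f x)) @ 0^'+ --> 'D_(u + v) f x.
  exact: cvg_dnbhs_at_right (df (u + v) x).
suff Q2 : (fun h : R => h^-1 *: ((f \o shift x) (h *: (u + v)) - f x)) @ 0^'+ -->
    'D_u f x + 'D_v f x by exact: cvg_unique Q1 Q2.
apply/cvgrPdist_lt => /= e e0.
have e2 : 0 < e / 2 by rewrite divr_gt0.
have [d1 d10 H1] := continuous_modulus x (Df u : continuous ('D_u f)) e2.
have [d2 d20 H2] := continuous_modulus x (Df v : continuous ('D_v f)) e2.
have K0 : 0 < `|u| + `|v| + 1 by rewrite ltr_wpDl// addr_ge0.
near=> h.
have h0 : 0 < h by near: h; exact: nbhs_right_gt.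
have hd : h * (`|u| + `|v| + 1) < Num.min d1 d2.
  by rewrite -ltr_pdivlMr//; near: h; apply: nbhs_right_lt; rewrite divr_gt0// lt_min d10 d20.
have [a ah Ea] := MVT_line (x + h *: u) v cf h0.
have [b bh Eb] := MVT_line x u cf h0.
rewrite /= (addrC (h *: (u + v))) (scalerDr h) addrA.
rewrite -[_ - f x](subrKA (f (x + h *: u))) Ea Eb -mulrDr.
rewrite [_ *: _]mulrA mulVf ?gt_eqF// mul1r.
have /andP[a0 ah'] := ah; have /andP[b0 bh'] := bh.
have B1 : `|'D_u f x - 'D_u f (x + b *: u)| < e / 2.
  apply: H1; rewrite opprD addNKr normrN normrZ gtr0_norm//.
  apply: (le_lt_trans _ (lt_le_trans hd _)); last by rewrite ge_min lexx.
  have nu := normr_ge0 u; have nv := normr_ge0 v.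
  apply: ler_pM; [exact: ltW|exact: nu|exact: ltW|].
  by clear -nv; lra.
have B2 : `|'D_v f x - 'D_v f (x + h *: u + a *: v)| < e / 2.
  apply: H2; rewrite -addrA opprD addNKr normrN.
  apply: le_lt_trans (lt_le_trans hd _); last by rewrite ge_min lexx orbT.
  apply: le_trans (ler_normD _ _) _; rewrite !normrZ !gtr0_norm//.
  by have := normr_ge0 u; have := normr_ge0 v; nra.
rewrite (_ : _ - _ = ('D_u f x - 'D_u f (x + b *: u)) + ('D_v f x - 'D_v f (x + h *: u + a *: v))).
  by apply: le_lt_trans (ler_normD _ _) _; lra.
by ring.
Unshelve. all: by end_near. Qed.

Lemma derive_lincomb f x n (a : 'I_n -> R) (e : 'I_n -> V) : Ck 1 f ->
  'D_(\sum_i a i *: e i) f x = \sum_i a i * 'D_(e i) f x.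
Proof.
move=> cf; elim: n a e => [|n IH] a e; first by rewrite !big_ord0 derive0.
by rewrite !big_ord_recl derive_add// derive_scale// IH.
Qed.

Lemma derive2_lincomb f x n (a : 'I_n -> R) (e : 'I_n -> V) : Ck 2 f ->
  let v := \sum_i a i *: e i in
  'D_v ('D_v f) x = \sum_i \sum_j a i * a j * 'D_(e i) ('D_(e j) f) x.
Proof.
move=> cf v.
have D1 : 'D_v f = (fun y => \sum_j a j * 'D_(e j) f y).
  by apply/funext => y; rewrite derive_lincomb//; exact: CkW.
have [_ _ c1] := cf.
rewrite [LHS]derive_lincomb//.
apply: eq_bigr => i _; rewrite D1.
have -> : (fun y => \sum_j a j * 'D_(e j) f y) = \sum_j (a j *: 'D_(e j) f).
  by apply/funext => y; rewrite fct_sumE.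
rewrite derive_sum; last by move=> j; apply: derivableZ; have [] := c1 (e j).
rewrite mulr_sumr; apply: eq_bigr => j _.
by rewrite deriveZ ?mulrA//; have [] := c1 (e j).
Qed.

(** The mixed difference [f (x + t u + t v) - f (x + t u) - f (x + t v) + f x] is [t ^ 2] times
    a mean value of either iterated derivative, as two applications of the mean value theorem
    show; let [t] tend to 0. *)
Lemma derive_swap f x u v : Ck 2 f -> 'D_u ('D_v f) x = 'D_v ('D_u f) x.
Proof.
move=> cf; have [_ _ c1] := cf; have cf1 : Ck 1 f := CkW cf.
have key a b t : 0 < t -> exists c d : R, [/\ 0 < c < t, 0 < d < t &
    f (x + t *: a + t *: b) - f (x + t *: a) - f (x + t *: b) + f x =
    t ^+ 2 * 'D_a ('D_b f) (x + c *: a + d *: b)].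
  move=> t0.
  pose g y := f (y + t *: a) - f y.
  have gE : g = (f \o shift (t *: a)) - f by [].
  have dsh w y : derivable (f \o shift (t *: a)) y w /\
      'D_w (f \o shift (t *: a)) y = 'D_w f (y + t *: a).
    have E : (fun h => h^-1 *: (((f \o shift (t *: a)) \o shift y) (h *: w) -
        (f \o shift (t *: a)) y)) =
      (fun h => h^-1 *: ((f \o shift (y + t *: a)) (h *: w) - f (y + t *: a))).
      by apply/funext => h /=; rewrite -!addrA.
    rewrite /derivable /derive E; split => //.
    by have [_ df _] := cf1; exact: df.
  have Dg w : 'D_w g = fun y => 'D_w f (y + t *: a) - 'D_w f y.
    apply/funext => y; rewrite gE deriveB; first by rewrite (dsh w y).2.
      exact: (dsh w y).1.
    by have [_ df _] := cf1; exact: df.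
  have csh (h : V -> R) : continuous h -> continuous (fun y : V => h (y + t *: a) - h y : R).
    move=> ch y; apply: cvgB; last exact: ch.
    apply: (continuous_comp (f := fun y => y + t *: a)); last exact: ch.
    by apply: cvgD; [exact: cvg_id|exact: cvg_cst].
  have cg : Ck 1 g.
    split; first exact/csh/(Ck_cont cf).
      move=> w y; have [_ df _] := cf1.
      exact: (@derivableB _ _ _ (f \o shift (t *: a)) f y w (dsh w y).1 (df _ _)).
    by move=> w; rewrite Dg /=; apply: csh; have [_ _ Dc] := cf1; exact: Dc.
  have [d dt Ed] := MVT_line x b cg t0.
  have [c ct Ec] := MVT_line (x + d *: b) a (c1 b) t0.
  exists c, d; split; [exact: ct|exact: dt|].
  rewrite (addrAC x (c *: a)) expr2 -mulrA -Ec.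
  transitivity (t * 'D_b g (x + d *: b)); last first.
    exact: (congr1 (fun F : V -> R => t * F (x + d *: b)) (Dg b)).
  rewrite -Ed /g.
  by rewrite (addrAC x (t *: b)); ring.
apply/eqP; rewrite -subr_eq0 -normr_le0; apply/ler_addgt0Pr => e e0; rewrite add0r.
have cuv : continuous ('D_u ('D_v f)) by have [_ _ H] := c1 v; exact: H.
have cvu : continuous ('D_v ('D_u f)) by have [_ _ H] := c1 u; exact: H.
have e2 : 0 < e / 2 by rewrite divr_gt0.
have [d1 d10 H1] := continuous_modulus x cuv e2.
have [d2 d20 H2] := continuous_modulus x cvu e2.
pose d := Num.min d1 d2; have d0 : 0 < d by rewrite lt_min d10.
have K0 : 0 < `|u| + `|v| + 1 by rewrite ltr_wpDl// addr_ge0.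
pose t := d / (`|u| + `|v| + 1).
have t0 : 0 < t by rewrite divr_gt0.
have tK : t * (`|u| + `|v| + 1) = d by rewrite divfK// gt_eqF.
have nu := normr_ge0 u; have nv := normr_ge0 v.
have small a b c c' : `|a| + `|b| = `|u| + `|v| -> 0 < c < t -> 0 < c' < t -> `|x - (x + c *: a + c' *: b)| < d.
  move=> ab /andP[c0 ct] /andP[c'0 c't].
  rewrite -addrA opprD addNKr normrN; apply: le_lt_trans (ler_normD _ _) _.
  rewrite !normrZ !gtr0_norm// -tK.
  have na := normr_ge0 a; have nb := normr_ge0 b.
  by rewrite -ab; nra.
have [p [q [pt qt E1]]] := key u v t t0.
have [p' [q' [pt' qt' E2]]] := key v u t t0.
have E : 'D_u ('D_v f) (x + p *: u + q *: v) = 'D_v ('D_u f) (x + p' *: v + q' *: u).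
  apply: (@mulfI _ (t ^+ 2)); first by rewrite expf_neq0// gt_eqF.
  apply: etrans (esym E1) _; apply: etrans _ E2.
  by rewrite (addrAC x (t *: v)) [X in X + _]addrAC.
have B1 := H1 (x + p *: u + q *: v); have B2 := H2 (x + p' *: v + q' *: u).
have {}B1 : `|'D_u ('D_v f) x - 'D_u ('D_v f) (x + p *: u + q *: v)| < e / 2.
  by apply: B1; apply: lt_le_trans (small _ _ _ _ erefl pt qt) _; rewrite ge_min lexx.
have {}B2 : `|'D_v ('D_u f) x - 'D_v ('D_u f) (x + p' *: v + q' *: u)| < e / 2.
  apply: B2; apply: lt_le_trans (small _ _ _ _ (addrC _ _) pt' qt') _.
  by rewrite ge_min lexx orbT.
rewrite E in B1.
have := ler_distD ('D_v ('D_u f) (x + p' *: v + q' *: u)) ('D_u ('D_v f) x) ('D_v ('D_u f) x).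
move/le_trans; apply; rewrite [e]splitr; apply: lerD; first exact: ltW B1.
by rewrite distrC; exact: ltW B2.
Qed.

(** The first mean value gives a difference of first derivatives at the symmetric points
    [x + a v] and [x - a v], the second one a second derivative between them. *)
Lemma second_difference_MVT f x v : Ck 2 f -> exists a b : R, [/\ 0 < a < 1, -1 < b < 1 &
  f (x + v) + f (x - v) - 2 * f x = 2 * a * 'D_v ('D_v f) (x + b *: v)].
Proof.
move=> cf; have [_ _ c1] := cf; have [cf0 df _] : Ck 1 f := CkW cf.
pose g (r : R) := f (x + r *: v) + f (x + r *: (- v)).
have dg (r : R) : is_derive r (1 : R) g ('D_v f (x + r *: v) + 'D_(- v) f (x + r *: (- v))).
  by apply: is_deriveD; exact/is_derive_line/df.
have cg : {within `[0, 1], continuous g}.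
  apply: continuous_subspaceT => r.
  by apply: cvgD; exact: continuous_line.
have [a /[!in_itv]/= a01 E] := MVT (ltr01 : (0 : R) < 1) (fun r _ => dg r) cg.
move: E; rewrite /g !scale1r !scale0r !addr0 subr0 mulr1.
rewrite -(scaleN1r v) derive_scale; last exact: CkW.
rewrite scaleN1r scalerN => E.
have a20 : 0 < 2 * a by lra.
have [c ca Ec] := MVT_line (x - a *: v) v (c1 v) a20.
exists a, (c - a); split; [by []|by clear -a01 ca; lra|].
have -> : x + (c - a) *: v = x - a *: v + c *: v by rewrite scalerBl addrA addrAC.
have Ea : x - a *: v + (2 * a) *: v = x + a *: v.
  by rewrite mulr2n mulrDl mul1r scalerDl addrA addrNK.
by rewrite -Ec Ea; clear -E; lra.
Qed.

End LineCalculus.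

(** * The kernel and its integrable functions *)

Section PowerIntegrals.
Context {R : realType}.
Notation mu := (@lebesgue_measure R).

Lemma derivable_powR_primitive (a x : R) : a + 1 != 0 -> 0 < x ->
  is_derive x 1 (fun y => y `^ (a + 1) / (a + 1)) (x `^ a).
Proof.
move=> a1 x0.
have := @is_deriveZ R R R ((fun y : R => y `^ (a + 1))) (a + 1)^-1 x 1 _ (is_derive1_powR (a + 1) x0).
rewrite addrK [_ *: (_ * _)]mulKf//.
by congr is_derive; apply/funext => y /=; rewrite mulrC.
Qed.

Lemma continuous_powR (a x : R) : 0 < x -> {for x, continuous (fun y : R => y `^ a)}.
Proof.
move=> x0; apply: differentiable_continuous; apply/derivable1_diffP.
by apply: derivable_powR; rewrite in_itv/= x0.
Qed.

Lemma cvg_powR_pinfty0 (a : R) : a < 0 -> (y `^ a) @[y --> +oo] --> (0 : R).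
Proof.
move=> a0; apply/cvgrPdist_lt => e e0; near=> y.
have y0 : 0 < y by near: y; exact: nbhs_pinfty_gt.
rewrite sub0r normrN ger0_norm ?powR_ge0//.
have -> : e = (e `^ a^-1) `^ a by rewrite -powRrM mulVf ?lt_eqF// powRr1// ltW.
have ea : 0 < e `^ a^-1 by exact: powR_gt0.
have : e `^ a^-1 < y by near: y; apply: nbhs_pinfty_gt; rewrite num_real.
move=> ey; rewrite -(opprK a) (powRN y) (powRN (e `^ _)) ltf_pV2 ?posrE ?powR_gt0//.
by rewrite opprK gt0_ltr_powR// ?oppr_gt0// nnegrE ltW.
Unshelve. all: by end_near. Qed.

Lemma integral_powR_tail (a e : R) : 0 < e -> a < -1 ->
  (\int[mu]_(x in `[e, +oo[) (x `^ a)%:E = (e `^ (a + 1) / (- (a + 1)))%:E)%E.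
Proof.
move=> e0 a1; have a10 : a + 1 < 0 by lra.
have a1n : a + 1 != 0 by rewrite lt_eqF.
have E := @ge0_continuous_FTC2y R (fun y : R => y `^ a) (fun y => y `^ (a + 1) / (a + 1)) e 0.
rewrite E //.
- by rewrite sub0e -EFinN invrN mulrN.
- by move=> x _; exact: powR_ge0.
- apply/continuous_within_itvcyP; split.
    by move=> x; rewrite in_itv/= andbT => ex; apply: continuous_powR; exact: lt_trans ex.
  by apply: cvg_at_right_filter; exact: continuous_powR.
- rewrite -(mul0r (a + 1)^-1); apply: cvgMr_tmp; exact: cvg_powR_pinfty0.
- move=> x ex; have [] := derivable_powR_primitive a1n (lt_trans e0 ex); by [].
- apply: cvg_at_right_filter; apply: cvgMr_tmp; exact: continuous_powR.
- move=> x; rewrite in_itv/= andbT => ex; rewrite derive1E.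
  by have [_ ->] := derivable_powR_primitive a1n (lt_trans e0 ex).
Qed.

Lemma integral_powR_segment (a e b : R) : 0 < e -> e < b -> a + 1 != 0 ->
  (\int[mu]_(x in `[e, b]) (x `^ a)%:E = (b `^ (a + 1) / (a + 1) - e `^ (a + 1) / (a + 1))%:E)%E.
Proof.
move=> e0 eb a1n.
have E := @continuous_FTC2 R (fun y : R => y `^ a) (fun y => y `^ (a + 1) / (a + 1)) e b eb.
have cp x : 0 < x -> {for x, continuous (fun y : R => y `^ a)} by exact: continuous_powR.
rewrite E ?EFinB//.
- apply/continuous_within_itvP => //; split.
  + by move=> x /[!in_itv]/= /andP[ex _]; apply: cp; exact: lt_trans ex.
  + by apply: cvg_at_right_filter; exact: cp.
  + by apply: cvg_at_left_filter; apply: cp; exact: lt_trans eb.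
- split.
  + move=> x /[!in_itv]/= /andP[ex _].
    by have [] := derivable_powR_primitive a1n (lt_trans e0 ex).
  + by apply: cvg_at_right_filter; apply: cvgMr_tmp; exact: continuous_powR.
  + by apply: cvg_at_left_filter; apply: cvgMr_tmp; apply: continuous_powR; exact: lt_trans eb.
- move=> x /[!in_itv]/= /andP[ex _]; rewrite derive1E.
  by have [_ ->] := derivable_powR_primitive a1n (lt_trans e0 ex).
Qed.

(** The integrals over [[1 / (n + 2), 1]] are bounded by [1 / (a + 1)]; let [n] tend to infinity. *)
Lemma integral_powR_head_lty (a : R) : -1 < a ->
  (\int[mu]_(x in `]0%R, 1%R]) (x `^ a)%:E < +oo)%E.
Proof.
move=> a1; have a10 : 0 < a + 1 by lra.
pose F n := `[(n.+2%:R : R)^-1, 1]%classic.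
have UF : \bigcup_n F n = `]0, 1]%classic.
  apply/seteqP; split => x /=.
    by move=> [n _]; rewrite /F /= !in_itv/= => /andP[nx ->]; rewrite andbT (lt_le_trans _ nx)// invr_gt0.
  rewrite in_itv/= => /andP[x0 x1]; exists (Num.truncn x^-1) => //.
  rewrite /F /= in_itv/= x1 andbT -[leRHS]invrK lef_pV2 ?posrE ?invr_gt0//.
  apply: le_trans (ltW (truncnS_gt _)) _.
  by rewrite ler_nat.
have ndF : nondecreasing_seq F.
  move=> m n mn; apply/subsetPset => x; rewrite /F /= !in_itv/= => /andP[mx ->].
  by rewrite andbT (le_trans _ mx)// lef_pV2 ?posrE// ler_nat.
have mp (D : set R) : measurable_fun D (EFin \o (fun x : R => x `^ a)).
  by apply/measurable_EFinP; apply: measurable_funTS; exact: measurable_powR.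
have H : (\int[mu]_(x in F n) (x `^ a)%:E @[n --> \oo] -->
    \int[mu]_(x in `]0%R, 1%R]) (x `^ a)%:E)%E.
  rewrite -UF; apply: ge0_nondecreasing_set_cvg_integral => //.
  - by move=> n; exact: measurable_itv.
  - by move=> n; exact: mp.
  - by move=> n x _; rewrite lee_fin powR_ge0.
apply: (@le_lt_trans _ _ ((a + 1)^-1)%:E); last exact: ltry.
rewrite -(cvg_lim _ H)//; apply: lime_le; first by apply/cvg_ex; eexists; exact: H.
apply: nearW => n; rewrite /F integral_powR_segment ?gt_eqF ?invr_gt0//; last first.
  by rewrite invf_lt1 ?ltr1n.
by rewrite lee_fin powR1 div1r gerBl divr_ge0 ?powR_ge0// ltW.
Qed.

End PowerIntegrals.

Section LevyIntegral.
Context {R : realType} (s : R).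
Hypothesis s01 : 0 < s < 1.
Notation mu := (@lebesgue_measure R).
Notation Rpos := (`]0, +oo[%classic : set R).
Implicit Types f g : R -> R.

Definition kern (t : R) : R := (t `^ (1 + 2 * s))^-1.

(** The integrability bound of second differences against [kern]: quadratic at 0, bounded at infinity. *)
Definition cap (t : R) : R := Num.min 1 (t ^+ 2).

(** Second differences along a line of a bounded function which is [C^2] at the base point are of
    this kind. *)
Definition levy f : Prop := measurable_fun Rpos f /\
  exists C, forall t, 0 < t -> `|f t| <= C * cap t.

Definition levyI f : R := \int[mu]_(t in Rpos) (f t * kern t).

Lemma kern_gt0 t : 0 < t -> 0 < kern t.
Proof. by move=> t0; rewrite invr_gt0 powR_gt0. Qed.

Lemma kern_powR t : kern t = t `^ (- (1 + 2 * s)).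
Proof. by rewrite powRN. Qed.

Lemma cap_ge0 t : 0 <= cap t.
Proof. by rewrite /cap le_min ler01 sqr_ge0. Qed.

Lemma cap_gt0 t : 0 < t -> 0 < cap t.
Proof. by move=> t0; rewrite /cap lt_min ltr01 exprn_gt0. Qed.

Lemma measurable_kern (D : set R) : measurable_fun D kern.
Proof.
rewrite (_ : kern = fun t => t `^ (- (1 + 2 * s))); last by apply/funext => t; rewrite kern_powR.
by apply: measurable_funTS; exact: measurable_powR.
Qed.

Lemma measurable_cap (D : set R) : measurable_fun D cap.
Proof.
apply: measurable_funTS; apply: measurable_minr; first exact: measurable_cst.
exact: exprn_measurable.
Qed.

(** The integrand is [t `^ (1 - 2 s)] on ]0, 1] and [t `^ (- (1 + 2 s))] beyond, and [0 < s < 1]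
    makes both integrable. *)
Lemma integrable_cap : mu.-integrable Rpos (EFin \o (fun t => cap t * kern t)).
Proof.
apply/integrableP; split.
  apply/measurable_EFinP; apply: measurable_funM.
    exact: measurable_cap.
  exact: measurable_kern.
have mF (D : set R) : measurable_fun D (fun x => `|(cap x * kern x)%:E|%E).
  apply: measurableT_comp => //; apply/measurable_EFinP; apply: measurable_funM.
    exact: measurable_cap.
  exact: measurable_kern.
have mP a (D : set R) : measurable_fun D (fun x => (x `^ a)%:E).
  by apply/measurable_EFinP; apply: measurable_funTS; exact: measurable_powR.
rewrite (_ : `]0, +oo[%classic = `]0, 1]%classic `|` `]1, +oo[%classic); last first.
  apply/seteqP; split => x /=; rewrite !in_itv/= !andbT.
    by move=> x0; have [x1|x1] := leP x 1; [left; rewrite x0|right].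
  by case=> [/andP[]//|]; exact: lt_trans.
rewrite ge0_integral_setU//=; last 2 first.
- exact: mF.
- rewrite disj_set2E; apply/eqP/seteqP; split => // x /=; rewrite !in_itv/= andbT.
  by move=> [/andP[_ x1] /(le_lt_trans x1)]; rewrite ltxx.
have /andP[s0 s1] := s01.
apply: lte_add_pinfty.
  apply: le_lt_trans (@integral_powR_head_lty R (1 - 2 * s) _); last by lra.
  apply: ge0_le_integral => //.
  - exact: mF.
  - exact: mP.
  move=> x; rewrite /= in_itv/= => /andP[x0 x1].
  rewrite ger0_norm ?mulr_ge0 ?cap_ge0 ?(ltW (kern_gt0 x0))// lee_fin kern_powR.
  rewrite (_ : 1 - 2 * s = 2 + - (1 + 2 * s)); last by lra.
  rewrite powRD; last by rewrite (gt_eqF x0) implybT.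
  rewrite (@powR_mulrn _ x 2) ?(ltW x0)// ler_wpM2r ?powR_ge0//.
  by rewrite /cap ge_min lexx orbT.
have e01 : - (1 + 2 * s) < -1 by lra.
apply: (@le_lt_trans _ _ (\int[mu]_(x in `[1%R, +oo[) (x `^ (- (1 + 2 * s)))%:E)%E); last first.
  by rewrite integral_powR_tail// ltry.
apply: (@le_trans _ _ (\int[mu]_(x in `]1%R, +oo[) (x `^ (- (1 + 2 * s)))%:E)%E).
  apply: ge0_le_integral => //.
  - exact: mF.
  - exact: mP.
  move=> x; rewrite /= in_itv/= andbT => x1; have x0 := lt_trans ltr01 x1.
  rewrite ger0_norm ?mulr_ge0 ?cap_ge0 ?(ltW (kern_gt0 x0))// lee_fin kern_powR.
  by rewrite ler_piMl ?powR_ge0// /cap ge_min lexx.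
apply: ge0_subset_integral => //.
- exact: mP.
- by move=> x _; rewrite lee_fin powR_ge0.
- by move=> x /=; rewrite !in_itv/= !andbT => /ltW.
Qed.

Lemma levy_integrable f : levy f -> mu.-integrable Rpos (EFin \o (fun t => f t * kern t)).
Proof.
move=> [mf [C fC]].
have H := @integrableZl _ _ R mu Rpos (measurable_itv _) C _ integrable_cap.
apply: le_integrable H => //.
  by apply/measurable_EFinP; apply: measurable_funM => //; exact: measurable_kern.
move=> t; rewrite /= in_itv/= andbT => t0.
rewrite lee_fin normrM mulrA [in leRHS]normrM ler_wpM2r//.
by apply: le_trans (fC t t0) _; exact: ler_norm.
Qed.

Lemma levyD f g : levy f -> levy g -> levy (fun t => f t + g t).
Proof.
move=> [mf [C fC]] [mg [D gD]]; split; first exact: measurable_funD.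
exists (C + D) => t t0; rewrite mulrDl; apply: le_trans (ler_normD _ _) _.
by rewrite lerD ?fC ?gD.
Qed.

Lemma levyZ c f : levy f -> levy (fun t => c * f t).
Proof.
move=> [mf [C fC]]; split; first by apply: measurable_funM => //; exact: measurable_cst.
exists (`|c| * C) => t t0; rewrite normrM -mulrA.
by rewrite ler_wpM2l ?fC.
Qed.

Lemma levyN f : levy f -> levy (fun t => - f t).
Proof.
by move=> /(levyZ (-1)); congr levy; apply/funext => t; rewrite mulN1r.
Qed.

Lemma levyB f g : levy f -> levy g -> levy (fun t => f t - g t).
Proof. by move=> lf /levyN; exact: levyD. Qed.

Lemma levyI_D f g : levy f -> levy g ->
  levyI (fun t => f t + g t) = levyI f + levyI g.
Proof.
move=> lf lg; rewrite /levyI -RintegralD//; [|exact: levy_integrable..].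
by apply: eq_Rintegral => t _; rewrite mulrDl.
Qed.

Lemma levyI_Z c f : levy f -> levyI (fun t => c * f t) = c * levyI f.
Proof.
move=> lf; rewrite /levyI -RintegralZl//; last exact: levy_integrable.
by apply: eq_Rintegral => t _; rewrite mulrA.
Qed.

Lemma levyI_N f : levy f -> levyI (fun t => - f t) = - levyI f.
Proof.
move=> lf; rewrite -mulN1r -levyI_Z//; congr levyI.
by apply/funext => t; rewrite mulN1r.
Qed.

Lemma levyI_B f g : levy f -> levy g ->
  levyI (fun t => f t - g t) = levyI f - levyI g.
Proof. by move=> lf lg; rewrite levyI_D ?levyI_N//; exact: levyN. Qed.

Lemma levyI_le f g : levy f -> levy g -> (forall t, 0 < t -> f t <= g t) ->
  levyI f <= levyI g.
Proof.
move=> lf lg fg; apply: le_Rintegral => //; [exact: levy_integrable..|].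
move=> t; rewrite /= in_itv/= andbT => t0.
by rewrite ler_wpM2r ?fg// ltW// kern_gt0.
Qed.

Lemma levyI_eq f g : (forall t, 0 < t -> f t = g t) -> levyI f = levyI g.
Proof.
move=> fg; apply: eq_Rintegral => t; rewrite inE/= in_itv/= andbT => t0.
by rewrite fg.
Qed.

Lemma levyI_ge0 f : (forall t, 0 < t -> 0 <= f t) -> 0 <= levyI f.
Proof.
move=> f0; apply: Rintegral_ge0 => t; rewrite /= in_itv/= andbT => t0.
by rewrite mulr_ge0 ?f0// ltW// kern_gt0.
Qed.

Lemma levyI_cvg (f_ : nat -> R -> R) f C :
  (forall n, measurable_fun Rpos (f_ n)) ->
  (forall n t, 0 < t -> `|f_ n t| <= C * cap t) ->
  (forall t, 0 < t -> f_ n t @[n --> \oo] --> f t) ->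
  levyI (f_ n) @[n --> \oo] --> levyI f.
Proof.
move=> mf fC ff.
have C0 : 0 <= C.
  by rewrite -(pmulr_lge0 _ (cap_gt0 ltr01)); apply: le_trans (fC 0 1 ltr01).
have H := @integrableZl _ _ R mu Rpos (measurable_itv _) C _ integrable_cap.
have mfk n : measurable_fun Rpos (fun t => f_ n t * kern t).
  by apply: measurable_funM => //; exact: measurable_kern.
have mfl : measurable_fun Rpos (fun t => f t * kern t).
  apply: measurable_funM; last exact: measurable_kern.
  by apply: measurable_fun_cvg mf _ => t; rewrite /= in_itv/= andbT; exact: ff.
have [] := @dominated_convergence _ _ R mu Rpos (measurable_itv _)
  (fun n t => (f_ n t * kern t)%:E) (fun t => (f t * kern t)%:E) _ _ _ _ H _.
- by move=> n; apply/measurable_EFinP; exact: mfk.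
- by apply/measurable_EFinP; exact: mfl.
- apply: aeW => t; rewrite /= in_itv/= andbT => t0; apply: cvg_EFin.
    by apply: nearW.
  by apply: cvgMr_tmp; exact: ff.
- apply: aeW => t n; rewrite /= in_itv/= andbT => t0.
  rewrite lee_fin normrM mulrA (gtr0_norm (kern_gt0 t0)).
  by rewrite ler_wpM2r ?fC// ltW// kern_gt0.
move=> fi _; rewrite /levyI => cv.
apply: fine_cvg; rewrite fineK//; exact: integrable_fin_num.
Qed.

End LevyIntegral.

(** * Limits and truncations of kernel integrals *)

Section LevyMore.
Context {R : realType} (s : R).
Hypothesis s01 : 0 < s < 1.
Notation mu := (@lebesgue_measure R).
Notation Rpos := (`]0, +oo[%classic : set R).
Notation levyI := (levyI s).
Implicit Types f g h : R -> R.

Lemma levy_away f (r M : R) : 0 < r -> measurable_fun Rpos f ->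
  (forall t, 0 < t -> `|f t| <= M) -> (forall t, 0 < t < r -> f t = 0) -> levy f.
Proof.
move=> r0 mf fM fr; split => //.
have M0 : 0 <= M by apply: le_trans (fM 1 ltr01).
exists (M / cap r) => t t0; have [tr|rt] := ltP t r.
  by rewrite fr ?t0// normr0 mulr_ge0 ?cap_ge0// divr_ge0 ?cap_ge0.
rewrite mulrAC ler_pdivlMr ?cap_gt0//.
apply: ler_pM => //; first exact: cap_ge0.
  exact: fM.
rewrite /cap le_min ge_min lexx/= ge_min lerXn2r ?orbT ?nnegrE//; first exact: ltW.
exact: ltW.
Qed.

(** Fatou's lemma in its limsup form; the maxima [max (g_ n) G] converge to [G] and dominate [g_ n],
    so that dominated convergence applies to them. *)
Lemma levyI_limsup (g_ : nat -> R -> R) (G : R -> R) C :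
  (forall n, measurable_fun Rpos (g_ n)) ->
  (forall n t, 0 < t -> `|g_ n t| <= C * cap t) ->
  measurable_fun Rpos G -> (forall t, 0 < t -> `|G t| <= C * cap t) ->
  (forall t e, 0 < t -> 0 < e -> \forall n \near \oo, g_ n t <= G t + e) ->
  forall e, 0 < e -> \forall n \near \oo, levyI (g_ n) <= levyI G + e.
Proof.
move=> mg gC mG GC gG e e0.
pose m n t := Num.max (g_ n t) (G t).
have mm n : measurable_fun Rpos (m n) by exact: measurable_maxr.
have mC n t : 0 < t -> `|m n t| <= C * cap t.
  by move=> t0; rewrite /m maxEle; case: ifP => _; [exact: GC|exact: gC].
have cv : levyI (m n) @[n --> \oo] --> levyI G.
  apply: (levyI_cvg s01 mm mC) => t t0; apply/cvgrPdist_le => d d0.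
  near=> n; have H : g_ n t <= G t + d by near: n; exact: gG.
  rewrite /m; have [gG'|gG'] := leP (g_ n t) (G t); first by rewrite subrr normr0 ltW.
  by rewrite distrC ger0_norm ?subr_ge0 ?(ltW gG')// lerBlDl.
have /cvgrPdist_le/(_ _ e0) H := cv.
near=> n.
have Hn : `|levyI G - levyI (m n)| <= e by near: n.
have : levyI (g_ n) <= levyI (m n).
  apply: levyI_le => //; [by split; [exact: mg|exists C; exact: gC]|by split; [exact: mm|exists C; exact: mC]|].
  by move=> t t0; rewrite /m le_max lexx.
by move: Hn; rewrite ler_norml => /andP[]; lra.
Unshelve. all: by end_near. Qed.

(** Second differences of a test function below [d] and of a semicontinuous function above it are
    glued with this operation. *)
Definition splice (d : R) f g t := if t < d then f t else g t.

Lemma measurable_splice d f g : measurable_fun Rpos f -> measurable_fun Rpos g ->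
  measurable_fun Rpos (splice d f g).
Proof.
move=> mf mg; apply: measurable_fun_if => //.
- by apply: measurable_fun_ltr => //; exact: measurable_cst.
- by apply: measurable_funS mf => //; exact: subIsetl.
- by apply: measurable_funS mg => //; exact: subIsetl.
Qed.

Lemma levy_splice_away (r M : R) g : 0 < r -> measurable_fun Rpos g ->
  (forall t, r <= t -> `|g t| <= M) -> levy (splice r (fun=> 0) g).
Proof.
move=> r0 mg gM; apply: (@levy_away _ r `|M|) => //.
- by apply: measurable_splice => //; exact: measurable_cst.
- move=> t _; rewrite /splice; case: ltP => [|rt]; first by rewrite normr0.
  exact: le_trans (gM _ rt) (ler_norm _).
- by move=> t /andP[_ tr]; rewrite /splice tr.
Qed.

Lemma levy_ge (r : R) : 0 < r -> levy (splice r (fun=> 0) (fun=> 1)).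
Proof.
move=> r0; apply: (@levy_splice_away r 1) => //.
by move=> t _; rewrite normr1.
Qed.

Lemma cap_sqr (t : R) : t <= 1 -> 0 < t -> cap t = t ^+ 2.
Proof. by move=> t1 t0; rewrite /cap; apply/min_idPr; rewrite exprn_ile1// ltW. Qed.

Lemma levy_splice_near (d M C : R) f g : 0 < d ->
  measurable_fun Rpos f -> measurable_fun Rpos g ->
  (forall t, 0 < t < d -> `|f t| <= C * t ^+ 2) ->
  (forall t, d <= t -> `|g t| <= M) -> levy (splice d f g).
Proof.
move=> d0 mf mg fC gM; split; first exact: measurable_splice.
have M0 : 0 <= M := le_trans (normr_ge0 _) (gM d (lexx _)).
have C0 : 0 <= C.
  have d2 : 0 < d / 2 < d by lra.
  have /andP[dd _] := d2.
  by rewrite -(pmulr_lge0 _ (exprn_gt0 2 dd)); apply: le_trans (fC _ d2).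
exists (C * (1 + d ^+ 2) + M * (1 + (d ^+ 2)^-1)) => t t0; rewrite /splice.
have d20 : 0 < d ^+ 2 by rewrite exprn_gt0.
have di0 : 0 < (d ^+ 2)^-1 by rewrite invr_gt0.
have t20 : 0 < t ^+ 2 by rewrite exprn_gt0.
have c0 := cap_ge0 t.
rewrite mulrDl; case: ltP => td.
  have B0 : 0 <= M * (1 + (d ^+ 2)^-1) * cap t by rewrite !mulr_ge0// addr_ge0// ltW.
  apply: le_trans (fC _ _) _; first by rewrite t0.
  rewrite -[leLHS]addr0; apply: lerD => //; rewrite -mulrA ler_wpM2l//.
  rewrite /cap minEle; case: ifP => _; last by rewrite ler_peMl ?(ltW t20)// lerDl ltW.
  have : t ^+ 2 <= d ^+ 2 by rewrite lerXn2r ?nnegrE ?ltW.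
  by clear -d20; lra.
have B0 : 0 <= C * (1 + d ^+ 2) * cap t by rewrite !mulr_ge0// addr_ge0// ltW.
apply: le_trans (gM _ td) _.
rewrite -[leLHS]add0r; apply: lerD => //; rewrite -mulrA ler_peMr//.
rewrite /cap minEle; case: ifP => _; first by clear -di0; lra.
have : d ^+ 2 <= t ^+ 2 by rewrite lerXn2r ?nnegrE// ltW.
move=> dt; rewrite mulrDl mul1r; apply: (@le_trans _ _ ((d ^+ 2)^-1 * t ^+ 2)).
  by rewrite mulrC ler_pdivlMr ?mul1r.
by rewrite lerDr ltW.
Qed.

Lemma levy_lt_sqr (d : R) : 0 < d -> levy (splice d (fun t => t ^+ 2) (fun=> 0)).
Proof.
move=> d0; apply: (@levy_splice_near d 0 1) => //.
- by move=> t _; rewrite mul1r ger0_norm ?sqr_ge0.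
- by move=> t _; rewrite normr0.
Qed.

Lemma levyI0 : levyI (fun=> 0) = 0.
Proof.
rewrite /levyI /Rintegral (eq_integral (fun=> 0%E)) ?integral0//.
by move=> x _; rewrite mul0r.
Qed.

Let invn_lt (t : R) : 0 < t -> \forall n \near \oo, (n.+1%:R^-1 : R) <= t.
Proof.
move=> t0; exists (Num.truncn t^-1) => // n /= Hn.
rewrite invf_ple ?posrE ?ltr0n//.
by apply: le_trans (ltW (truncnS_gt _)) _; rewrite ler_nat ltnS.
Qed.

Lemma levyI_head_small (e : R) : 0 < e -> exists2 d0 : R, 0 < d0 &
  forall d, 0 < d <= d0 -> levyI (splice d (fun t => t ^+ 2) (fun=> 0)) <= e.
Proof.
move=> e0.
pose dn n : R := n.+1%:R^-1.
have dn0 n : 0 < dn n by rewrite invr_gt0 ltr0n.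
have cv : levyI (splice (dn n) (fun t => t ^+ 2) (fun=> 0)) @[n --> \oo] --> levyI (fun=> 0).
  apply: (levyI_cvg s01 (C := 1)).
  - by move=> n; have [] := levy_lt_sqr (dn0 n).
  - move=> n t t0; rewrite mul1r /splice; case: ltP => td; last first.
      by rewrite normr0 cap_ge0.
    rewrite ger0_norm ?sqr_ge0// cap_sqr//.
    by rewrite ltW// (lt_le_trans td)// invf_le1 ?ler1n.
  - move=> t t0; apply: cvg_near_cst; near=> n.
    by rewrite /splice ltNge (_ : _ <= t)//; near: n; exact: invn_lt.
have /cvgrPdist_le/(_ _ e0)[n _ /(_ n (leqnn n))] := cv.
rewrite levyI0 sub0r normrN => Hn.
exists (dn n) => // d /andP[d0 ddn].
apply: le_trans _ (le_trans (ler_norm _) Hn).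
apply: levyI_le => //; [exact: levy_lt_sqr|exact: levy_lt_sqr|].
move=> t t0; rewrite /splice; case: ltP => td; first by rewrite (lt_le_trans td).
by case: ltP => _ //; exact: sqr_ge0.
Unshelve. all: by end_near. Qed.

Lemma levyI_tail_small (e : R) : 0 < e -> exists2 r : R, 0 < r &
  levyI (splice r (fun=> 0) (fun=> 1)) <= e.
Proof.
move=> e0.
have cv : levyI (splice n.+1%:R (fun=> 0) (fun=> 1)) @[n --> \oo] --> levyI (fun=> 0).
  apply: (levyI_cvg s01 (C := 1)).
  - by move=> n; apply: measurable_splice; exact: measurable_cst.
  - move=> n t t0; rewrite mul1r /splice; case: ltP => td; first by rewrite normr0 cap_ge0.
    rewrite normr1 /cap le_min lexx/=.
    by rewrite exprn_ege1// (le_trans _ td)// ler1n.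
  - move=> t t0; apply: cvg_near_cst; near=> n.
    rewrite /splice (_ : t < _)//; near: n; exists (Num.truncn t) => // n /= Hn.
    by rewrite (lt_le_trans (truncnS_gt _))// ler_nat ltnS.
have /cvgrPdist_le/(_ _ e0)[n _ /(_ n (leqnn n))] := cv.
rewrite levyI0 sub0r normrN => Hn.
by exists n.+1%:R; rewrite ?ltr0n// (le_trans (ler_norm _) Hn).
Unshelve. all: by end_near. Qed.

Lemma levyI_tail (r : R) : 0 < r ->
  levyI (splice r (fun=> 0) (fun=> 1)) = r `^ (- (2 * s)) / (2 * s).
Proof.
move=> r0; rewrite /levyI /Rintegral.
have sub : `[r, +oo[%classic `<=` Rpos.
  by move=> x; rewrite /= !in_itv/= !andbT; exact: lt_le_trans.
have E : (\int[mu]_(t in Rpos) (splice r (fun=> 0) (fun=> 1) t * kern s t)%:E =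
    \int[mu]_(t in `[r, +oo[) (t `^ (- (1 + 2 * s)))%:E)%E.
  rewrite -[in RHS](setIidr sub) integral_mkcondr; apply: eq_integral => t _.
  rewrite patchE mem_setE in_itv/= andbT /splice leNgt.
  by case: ltP => _ /=; rewrite ?mul0r ?mul1r ?kern_powR.
have /andP[s0 s1] := s01; rewrite E integral_powR_tail//; last by lra.
by congr (_ `^ _ / _); lra.
Qed.

Lemma levyI_tail_powR (r L b : R) : 0 < r -> 0 <= b < 2 * s ->
  levyI (splice r (fun=> 0) (splice L (fun t => t `^ b) (fun=> 0))) <= r `^ (b - 2 * s) / (2 * s - b).
Proof.
move=> r0 /andP[b0 bs]; have /andP[s0 s1] := s01; rewrite /levyI /Rintegral.
have sub : `[r, +oo[%classic `<=` Rpos.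
  by move=> x; rewrite /= !in_itv/= !andbT; exact: lt_le_trans.
have mpow a (D : set R) : measurable_fun D (fun t : R => t `^ a).
  by apply: measurable_funTS; exact: measurable_powR.
have le : (\int[mu]_(t in Rpos)
      (splice r (fun=> 0) (splice L (fun t => t `^ b) (fun=> 0)) t * kern s t)%:E <=
    \int[mu]_(t in `[r, +oo[) (t `^ (b - (1 + 2 * s)))%:E)%E.
  rewrite -[in leRHS](setIidr sub) integral_mkcondr; apply: ge0_le_integral => //.
  - move=> t; rewrite /= in_itv/= andbT => t0; rewrite lee_fin mulr_ge0//; last first.
      by rewrite ltW// kern_gt0.
    by rewrite /splice; do 2 (case: ifP => _ //); rewrite powR_ge0.
  - apply/measurable_EFinP; apply: measurable_funM; last exact: measurable_kern.
    by do 2 (apply: measurable_splice => //; try exact: measurable_cst).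
  - apply/measurable_restrict => //.
    by apply/measurable_EFinP; exact: mpow.
  move=> t; rewrite /= in_itv/= andbT => t0.
  rewrite patchE mem_setE in_itv/= andbT /splice.
  have [tr|rt] := ltP t r; first by rewrite mul0r.
  have [tL|Lt] := ltP t L; last by rewrite mul0r lee_fin powR_ge0.
  by rewrite kern_powR -powRD ?lexx// (gt_eqF t0) implybT.
have E : (\int[mu]_(t in `[r, +oo[) (t `^ (b - (1 + 2 * s)))%:E)%E =
    (r `^ (b - 2 * s) / (2 * s - b))%:E.
  rewrite integral_powR_tail//; last by lra.
  by congr (_ `^ _ / _)%:E; lra.
rewrite E in le.
rewrite -[leRHS]/(fine (_%:E)); apply: fine_le => //.
rewrite ge0_fin_numE; first exact: le_lt_trans le (ltry _).
apply: integral_ge0 => t; rewrite /= in_itv/= andbT => t0.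
rewrite lee_fin mulr_ge0//; last by rewrite ltW// kern_gt0.
by rewrite /splice; do 2 (case: ifP => _ //); rewrite powR_ge0.
Qed.

(** The part of the integral over negative [t] is reflected onto the positive one, where the two
    increments add up to a second difference. *)
Lemma integral_symmetric (A : set R) h (c C : R) : 0 < c -> measurable A ->
  (forall t, A t -> c <= t) -> measurable_fun setT h ->
  (forall t, A t -> `|h t| <= C /\ `|h (- t)| <= C) ->
  (\int[mu]_(t in A `|` -%R @^-1` A) (h t / `|t| `^ (1 + 2 * s))%:E)%E =
    (levyI (fun t => \1_A t * (h t + h (- t))))%:E.
Proof.
move=> c0 mA Ac mh hC.
have dis : [disjoint A & -%R @^-1` A].
  rewrite disj_set2E; apply/eqP/seteqP; split => [t /= [/Ac ct /Ac cnt]|t []].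
  by have := lt_le_trans c0 ct; have := lt_le_trans c0 cnt; lra.
pose F t := h t / `|t| `^ (1 + 2 * s).
have mN : measurable_fun [set: R] (-%R : R -> R) by exact: oppr_measurable.
have mF : measurable_fun setT F.
  apply: measurable_funM => //.
  rewrite (_ : (fun t => _) = (fun t => kern s `|t|)); last by [].
  by apply: measurableT_comp; [exact: measurable_kern|exact: normr_measurable].
have mFN : measurable_fun setT (fun t : R => F (- t)).
  by apply: (measurableT_comp mF); exact: mN.
have mhN : measurable_fun setT (fun t : R => h (- t)).
  by apply: (measurableT_comp mh); exact: mN.
have mNA : measurable (-%R @^-1` A : set R) by rewrite -[X in measurable X]setTI; exact: mN.
have lev f : measurable_fun setT f -> (forall t, A t -> `|f t| <= C) ->
    levy (fun t => \1_A t * f t).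
  move=> mf fC; apply: (@levy_away _ c `|C|) => //.
  - apply: measurable_funM; first exact: measurable_indic.
    exact: measurable_funTS.
  - move=> t t0; rewrite indicE; case: (boolP (t \in A)) => [/set_mem At|_].
      by rewrite mul1r; apply: le_trans (fC _ At) (ler_norm _).
    by rewrite mul0r normr0.
  - move=> t /andP[t0 tc]; rewrite indicE memNset ?mul0r// => /Ac.
    by rewrite leNgt tc.
have toI f : measurable_fun setT f -> (forall t, A t -> `|f t| <= C) ->
    (\int[mu]_(t in A) (f t * kern s t)%:E = (levyI (fun t => \1_A t * f t))%:E)%E.
  move=> mf fC; rewrite /levyI /Rintegral fineK; last first.
    by apply: integrable_fin_num => //; exact: (levy_integrable s01 (lev f mf fC)).
  have sub : A `<=` Rpos.
    by move=> t At; rewrite /= in_itv/= andbT (lt_le_trans c0)// Ac.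
  rewrite -[in LHS](setIidr sub) integral_mkcondr; apply: eq_integral => t _.
  rewrite patchE indicE; case: (t \in A); first by rewrite mul1r.
  by rewrite !mul0r.
have FA t : A t -> F t = h t * kern s t.
  by move=> /Ac ct; rewrite /F gtr0_norm// (lt_le_trans c0).
have FNA t : A t -> F (- t) = h (- t) * kern s t.
  by move=> /Ac ct; rewrite /F normrN gtr0_norm// (lt_le_trans c0).
have E1 : (\int[mu]_(t in A) (F t)%:E = (levyI (fun t => \1_A t * h t))%:E)%E.
  apply: etrans _ (toI h mh (fun t At => (hC t At).1)).
  by apply: eq_integral => t /set_mem/FA ->.
have E2 : (\int[mu]_(t in A) (F (- t))%:E = (levyI (fun t => \1_A t * h (- t)))%:E)%E.
  apply: etrans _ (toI _ mhN (fun t At => (hC t At).2)).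
  by apply: eq_integral => t /set_mem/FNA ->.
have E3 : (\int[mu]_(t in -%R @^-1` A) (F t)%:E = \int[mu]_(t in A) (F (- t))%:E)%E.
  have mFE : measurable_fun setT (fun t : R => (F t)%:E) by exact/measurable_EFinP.
  have opA : -%R @^-1` (-%R @^-1` A) = A :> set R.
    by apply/seteqP; split => t /=; rewrite opprK.
  have iF : mu.-integrable (-%R @^-1` (-%R @^-1` A)) ((fun t : R => (F t)%:E) \o -%R).
    rewrite opA; apply/integrableP; split.
      by apply/measurable_EFinP; exact: measurable_funTS.
    have /integrableP[_] := levy_integrable s01 (lev _ mhN (fun t At => (hC t At).2)).
    apply: le_lt_trans.
    have sub : A `<=` Rpos.
      by move=> t At; rewrite /= in_itv/= andbT (lt_le_trans c0)// Ac.
    rewrite -[in leLHS](setIidr sub) integral_mkcondr; apply: ge0_le_integral => //.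
    - by move=> t _; rewrite patchE; case: ifP.
    - apply/measurable_restrict => //; apply: measurableT_comp => //.
      by apply/measurable_EFinP; exact: measurable_funTS.
    - apply: measurableT_comp => //; apply/measurable_EFinP.
      apply: measurable_funM; last exact: measurable_kern.
      by apply: measurable_funM; [exact: measurable_indic|exact: measurable_funTS].
    move=> t _; rewrite patchE /= indicE; case: ifPn => [/set_mem At|_].
      by rewrite /= FNA// mul1r.
    exact: (@abse_ge0 _ (_%:E)).
  have mN' : measurable_fun [set: measurableTypeR R] (-%R : measurableTypeR R -> measurableTypeR R).
    exact: mN.
  have mFE' : measurable_fun [set: measurableTypeR R] (fun t : measurableTypeR R => (F t)%:E).
    exact: mFE.
  have mNA' : measurable (-%R @^-1` A : set (measurableTypeR R)) by exact: mNA.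
  have := integral_pushforward mN' mFE' iF mNA'.
  rewrite opA => <-.
  by apply: eq_measure_integral => B mB _; apply/esym; exact: lebesgue_measureN.
have mFU : measurable_fun (A `|` -%R @^-1` A) (fun t : R => (F t)%:E).
  by apply/measurable_EFinP; apply: measurable_funTS; exact: mF.
have E4 : (\int[mu]_(t in A `|` -%R @^-1` A) (F t)%:E =
    \int[mu]_(t in A) (F t)%:E + \int[mu]_(t in -%R @^-1` A) (F t)%:E)%E.
  by apply: integral_setU; [exact: mA|exact: mNA|exact: mFU|exact: dis].
have E5 : levyI (fun t => \1_A t * (h t + h (- t))) =
    levyI (fun t => \1_A t * h t) + levyI (fun t => \1_A t * h (- t)).
  apply: etrans _ (levyI_D s01 (lev _ mh (fun t At => (hC t At).1))
    (lev _ mhN (fun t At => (hC t At).2))).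
  by congr (levyI _); apply/funext => t; rewrite mulrDr.
rewrite E5 EFinD; apply: etrans E4 _; congr (_ + _)%E; first exact: E1.
exact: etrans E3 E2.
Qed.

End LevyMore.

(** * The operator as a one-sided integral of second differences *)

Definition sd {R : realType} {V : zmodType} (w : V -> R) (x v : V) : R :=
  w (x + v) + w (x - v) - 2 * w x.

Section OperatorIntegrals.
Context {R : realType} {N : nat} (s : R).
Hypothesis s01 : 0 < s < 1.
Notation mu := (@lebesgue_measure R).
Notation Rpos := (`]0, +oo[%classic : set R).
Notation levyI := (levyI s).
Implicit Types (u phi : 'rV[R]_N -> R) (x theta : 'rV[R]_N).

(** All that the far part of the operator requires of a semicontinuous function. *)
Definition line_bounded u x theta (M : R) : Prop :=
  measurable_fun setT (fun t : R => u (x + t *: theta)) /\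
  forall t, `|u (x + t *: theta)| <= M.

Lemma measurable_sd u x theta : measurable_fun setT (fun t : R => u (x + t *: theta)) ->
  measurable_fun setT (fun t : R => sd u x (t *: theta)).
Proof.
move=> mu_; apply: measurable_funB; last exact: measurable_cst.
apply: measurable_funD => //.
rewrite (_ : (fun t : R => u (x - t *: theta)) =
   (fun t : R => u (x + t *: theta)) \o -%R); last by apply/funext => t /=; rewrite scaleNr.
by apply: measurableT_comp => //; exact: oppr_measurable.
Qed.

Lemma sd_bounded u x theta M t : line_bounded u x theta M -> `|sd u x (t *: theta)| <= 4 * M.
Proof.
move=> [_ uM]; rewrite /sd.
have := uM t; have := uM (- t); have := uM 0; rewrite scale0r addr0 scaleNr.
by rewrite !ler_norml; lra.
Qed.

Lemma levy_tail u x theta M (d : R) : 0 < d -> line_bounded u x theta M ->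
  levy (splice d (fun=> 0) (fun t => sd u x (t *: theta))).
Proof.
move=> d0 uM; apply: (levy_splice_away (M := 4 * M) d0).
  by apply: measurable_funTS; apply: measurable_sd; case: uM.
by move=> t _; exact: sd_bounded.
Qed.

Lemma line_integral_tail u x theta M (d : R) : 0 < d -> line_bounded u x theta M ->
  line_integral s u x theta (~` `](- d), d[) =
  (levyI (splice d (fun=> 0) (fun t => sd u x (t *: theta))))%:E.
Proof.
move=> d0 [mu_ uM]; rewrite /line_integral.
have -> : ~` `](- d), d[%classic = `[d, +oo[%classic `|` -%R @^-1` `[d, +oo[%classic :> set R.
  apply/seteqP; split => t /=; rewrite !in_itv/= ?andbT; last first.
    by move=> H /andP[]; case: H; lra.
  have [dt|td] := leP d t; first by left.
  by move=> /negP; rewrite andbT -leNgt; right; lra.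
rewrite (@integral_symmetric R s s01 `[d, +oo[%classic (fun t => u (x + t *: theta) - u x) d (2 * M)) //.
- congr (_%:E); apply: levyI_eq => t t0; rewrite indicE mem_setE in_itv/= andbT /splice.
  have [_|_] := ltP t d; first by rewrite mul0r.
  by rewrite mul1r scaleNr /sd; lra.
- by move=> t; rewrite /= in_itv/= andbT.
- by apply: measurable_funB => //; exact: measurable_cst.
- move=> t _; have := uM t; have := uM (- t); have := uM 0; rewrite scale0r addr0.
  by rewrite !ler_norml; lra.
Qed.

Lemma levy_head phi x theta C (d : R) : 0 < d -> continuous phi ->
  (forall t, 0 < t < d -> `|sd phi x (t *: theta)| <= C * t ^+ 2) ->
  levy (splice d (fun t => sd phi x (t *: theta)) (fun=> 0)).
Proof.
move=> d0 cphi phiC; apply: (levy_splice_near (M := 0) (C := C) d0) => //.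
  apply: measurable_funTS; apply: measurable_sd.
  by apply: continuous_measurable_fun; exact: continuous_line.
by move=> t _; rewrite normr0.
Qed.

(** On a symmetric set the principal value integrates second differences, which are [O(t ^ 2)]:
    the truncated integrals converge by dominated convergence. *)
Lemma pv_integral_head phi x theta C (d : R) : 0 < d -> continuous phi ->
  (forall t, 0 < t < d -> `|sd phi x (t *: theta)| <= C * t ^+ 2) ->
  pv_integral s phi x theta `](- d), d[ =
  (levyI (splice d (fun t => sd phi x (t *: theta)) (fun=> 0)))%:E.
Proof.
move=> d0 cphi phiC; rewrite /pv_integral.
pose h t := phi (x + t *: theta) - phi x.
have ch : continuous h.
  by move=> t; apply: cvgB; [exact: continuous_line|exact: cvg_cst].
have [M hM] : exists M : R, forall t, -d <= t <= d -> `|h t| <= M.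
  have ab : - d <= d by lra.
  have [a _ aM] := EVT_max ab (continuous_subspaceT (fun t => cvg_norm (ch t))).
  by exists `|h a| => t td; apply: aM; rewrite in_itv.
have msd : measurable_fun setT (fun t : R => sd phi x (t *: theta)).
  by apply: measurable_sd; apply: continuous_measurable_fun; exact: continuous_line.
pose g (e t : R) := splice e (fun=> 0) (splice d (fun t => sd phi x (t *: theta)) (fun=> 0)) t.
have trunc e : 0 < e -> truncated_integral s phi x theta `](- d), d[ e = (levyI (g e))%:E.
  move=> e0; rewrite /truncated_integral /line_integral.
  have -> : `](- d), d[%classic `&` [set t | e <= `|t|] =
      `[e, d[%classic `|` -%R @^-1` `[e, d[%classic :> set R.
    apply/seteqP; split => t /=; rewrite !in_itv/=.
      move=> [/andP[dt td]]; have [t0|t0] := leP 0 t => et; [left|right].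
        by rewrite td andbT -(ger0_norm t0).
      by rewrite -(ltr0_norm t0) et /= ltr0_norm//; lra.
    by case=> /andP[et td]; [rewrite ger0_norm|rewrite ler0_norm]; lra.
  rewrite (@integral_symmetric R s s01 `[e, d[%classic h e M) //.
  - congr (_%:E); apply: levyI_eq => t t0; rewrite indicE mem_setE in_itv/= /g /splice.
    have [_|_] /= := ltP t e; first by rewrite mul0r.
    have [_|_] := ltP t d; last by rewrite mul0r.
    by rewrite mul1r /h scaleNr /sd; lra.
  - by move=> t; rewrite /= in_itv/= => /andP[].
  - exact: continuous_measurable_fun.
  - by move=> t; rewrite /= in_itv/= => td; split; apply: hM; lra.
apply: cvg_lim => //.
have cv : levyI (g e) @[e --> 0^'+] --> levyI (splice d (fun t => sd phi x (t *: theta)) (fun=> 0)).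
  apply/cvg_at_rightP => e_ [e_0 e_cv].
  have [mg [D gD]] := levy_head d0 cphi phiC.
  have D0 : 0 <= D by rewrite -(pmulr_lge0 _ (cap_gt0 ltr01)); apply: le_trans (gD 1 ltr01).
  apply: (levyI_cvg s01 (C := D)).
  - by move=> n; apply: measurable_splice => //; exact: measurable_cst.
  - move=> n t t0; rewrite /g {1}/splice; case: ifP => _; last exact: gD.
    by rewrite normr0 mulr_ge0// cap_ge0.
  - move=> t t0; apply: cvg_near_cst.
    have /cvgrPdist_lt/(_ _ t0) := e_cv; apply: filterS => n.
    by rewrite sub0r normrN gtr0_norm// => ent; rewrite /g {1}/splice ltNge ltW.
have cvE : (levyI (g e))%:E @[e --> 0^'+] -->
    (levyI (splice d (fun t => sd phi x (t *: theta)) (fun=> 0)))%:E.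
  by apply: cvg_EFin; [exact: nearW|exact: cv].
apply: cvg_trans cvE; apply: near_eq_cvg; near=> e.
by rewrite trunc//; near: e; exact: nbhs_right_gt.
Unshelve. all: by end_near. Qed.

(** The value of the operator in the direction [theta], with [phi] used up to [d] and [u] beyond,
    as a single absolutely convergent integral. *)
Definition testJ (d : R) phi u x theta : R :=
  levyI (splice d (fun t => sd phi x (t *: theta)) (fun t => sd u x (t *: theta))).

Lemma testJ_split phi u x theta C M (d : R) : 0 < d -> continuous phi ->
  (forall t, 0 < t < d -> `|sd phi x (t *: theta)| <= C * t ^+ 2) ->
  line_bounded u x theta M ->
  (pv_integral s phi x theta `](- d)%R, d[ +
   line_integral s u x theta (~` `](- d)%R, d[) = (testJ d phi u x theta)%:E)%E.
Proof.
move=> d0 cphi phiC uM.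
rewrite (pv_integral_head d0 cphi phiC) (line_integral_tail d0 uM) -EFinD; congr (_%:E).
rewrite -(levyI_D s01 (levy_head d0 cphi phiC) (levy_tail d0 uM)).
by apply: levyI_eq => t _; rewrite /splice; case: ifP; rewrite ?addr0 ?add0r.
Qed.

End OperatorIntegrals.

(** * The Euclidean norm, smooth functions of space and time, and residuals *)

Section EuclideanNorm.
Context {R : realType} {N : nat}.
Implicit Types (x v theta : 'rV[R]_N).

Lemma sum_sqr_ge0 v : 0 <= \sum_i v 0 i ^+ 2.
Proof. by apply: sumr_ge0 => i _; exact: sqr_ge0. Qed.

Lemma enorm_ge0 v : 0 <= enorm v.
Proof. exact: sqrtr_ge0. Qed.

Lemma sqr_enorm v : enorm v ^+ 2 = \sum_i v 0 i ^+ 2.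
Proof. by rewrite /enorm sqr_sqrtr ?sum_sqr_ge0. Qed.

Lemma enormZ (t : R) v : enorm (t *: v) = `|t| * enorm v.
Proof.
rewrite /enorm -sqrtr_sqr -sqrtrM ?sqr_ge0// mulr_sumr; congr Num.sqrt.
by apply: eq_bigr => i _; rewrite mxE exprMn.
Qed.

Lemma enormN v : enorm (- v) = enorm v.
Proof. by rewrite -scaleN1r enormZ normrN normr1 mul1r. Qed.

Lemma enorm0 : enorm (0 : 'rV[R]_N) = 0.
Proof. by rewrite -(scale0r (0 : 'rV[R]_N)) enormZ normr0 mul0r. Qed.

Lemma coord_le_enorm v i : `|v 0 i| <= enorm v.
Proof.
rewrite -sqrtr_sqr /enorm ler_wsqrtr// (bigD1 i)//= lerDl.
by apply: sumr_ge0 => j _; exact: sqr_ge0.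
Qed.

Lemma coord_le_norm v i : `|v 0 i| <= `|v|.
Proof. by rewrite [leRHS]/Num.norm/= mx_normrE; apply/bigmax_geP; right => /=; exists (0, i). Qed.

Lemma norm_le_coord v (c : R) : 0 <= c -> (forall i, `|v 0 i| <= c) -> `|v| <= c.
Proof.
move=> c0 vc; rewrite [leLHS]/Num.norm/= mx_normrE; apply: bigmax_le => //= -[i j] _ /=.
by rewrite (ord1 i).
Qed.

Lemma norm_le_enorm v : `|v| <= enorm v.
Proof. by apply: norm_le_coord (enorm_ge0 _) _ => i; exact: coord_le_enorm. Qed.

Lemma sum_sqr_le v : \sum_i v 0 i ^+ 2 <= N%:R * `|v| ^+ 2.
Proof.
apply: (@le_trans _ _ (\sum_(i < N) `|v| ^+ 2)).
  apply: ler_sum => i _; rewrite -real_normK ?num_real//.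
  by rewrite lerXn2r ?nnegrE// coord_le_norm.
by rewrite sumr_const card_ord -[_ *+ _]mulr_natl.
Qed.

Lemma enorm_le_norm v : enorm v <= N.+1%:R * `|v|.
Proof.
rewrite -(@ler_pXn2r _ 2)// ?nnegrE ?enorm_ge0 ?mulr_ge0// sqr_enorm.
apply: le_trans (sum_sqr_le _) _; rewrite exprMn ler_wpM2r ?sqr_ge0//.
by rewrite -natrX ler_nat expnS expn1 (leq_trans (leqnSn N))// leq_pmulr.
Qed.

Lemma usphere_norm theta : usphere theta -> `|theta| <= 1.
Proof. by move=> <-; exact: norm_le_enorm. Qed.

End EuclideanNorm.

Lemma usphere_nonempty {R : realType} {n : nat} : exists theta : 'rV[R]_n.+1, usphere theta.
Proof.
exists (delta_mx 0 0); rewrite /usphere /= /enorm (bigD1 0)//= big1 => [|i i0].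
  by rewrite mxE !eqxx expr1n addr0 sqrtr1.
by rewrite mxE (negbTE i0) andbF expr0n.
Qed.

Lemma continuous_of_modulus {R : realType} {V : normedModType R} (f : V -> R) :
  (forall x (e : R), 0 < e -> exists2 d : R, 0 < d &
    forall y, `|x - y| < d -> `|f x - f y| < e) -> continuous f.
Proof.
move=> H x; apply/cvgrPdist_lt => e e0; have [d d0 Hd] := H x e e0.
by apply/nbhs_normP; exists d.
Qed.

Section SmoothSpaceTime.
Context {R : realType} {N : nat}.
Notation V := ('rV[R]_N * R)%type.
Implicit Types (phi : V -> R) (x v theta : 'rV[R]_N).

Lemma sliceE phi t x : slice phi t x = phi (x, t). Proof. by []. Qed.

Lemma sd_slice phi t x v : sd (slice phi t) x v = sd phi (x, t) (v, 0).
Proof.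
rewrite /sd !sliceE; congr (phi _ + phi _ - _).
  by congr pair; rewrite addr0.
by rewrite -[RHS]/(x - v, t - 0) subr0.
Qed.

Lemma nbhs_prodP (z : V) (P : set V) : nbhs z P <-> exists2 e : R, 0 < e &
  forall y, `|y.1 - z.1| < e -> `|y.2 - z.2| < e -> P y.
Proof.
split=> [/nbhs_ballP[e /= e0 eP]|[e e0 eP]].
  exists e => // y y1 y2; apply: eP; split; rewrite -ball_normE /= distrC//.
apply/nbhs_ballP; exists e => // y [y1 y2].
by rewrite -ball_normE /= distrC in y1; rewrite -ball_normE /= distrC in y2; exact: eP.
Qed.

Lemma continuous_slice phi t : continuous phi -> continuous (slice phi t).
Proof.
move=> cphi; apply: continuous_of_modulus => x e e0.
have /cvgrPdist_lt/(_ _ e0)/nbhs_prodP[d d0 H] := cphi (x, t).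
exists d => // y xy; apply: H => /=; first by rewrite distrC.
by rewrite subrr normr0.
Qed.

Lemma space_dir_sum v : ((v, 0) : V) = \sum_i v 0 i *: ((delta_mx 0 i, 0) : V).
Proof.
have E (f : 'I_N -> 'rV[R]_N) : \sum_i ((f i, 0) : V) = (\sum_i f i, 0).
  apply: (big_ind2 (fun (a : V) b => a = (b, 0))) => //.
  by move=> a b c d -> ->; congr pair; rewrite addr0.
rewrite [in LHS](row_sum_delta v) -E; apply: eq_bigr => i _.
by congr pair; rewrite scaler0.
Qed.

Lemma compact_bound phi (K : set V) : compact K -> continuous phi ->
  exists2 C : R, 0 <= C & forall z, K z -> `|phi z| <= C.
Proof.
move=> cK cphi; have := continuous_compact (continuous_subspaceT cphi) cK.
move=> /compact_bounded[M [_ MH]].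
have [M1 M0] : M < `|M| + 1 /\ 0 <= `|M| + 1.
  by split; [rewrite (le_lt_trans (ler_norm _))// ltrDl|rewrite addr_ge0].
by exists (`|M| + 1) => // z Kz; apply: (MH _ M1); exists z.
Qed.

Lemma compact_norm_ball x (r : R) : compact [set y | `|y - x| <= r].
Proof.
apply: bounded_closed_compact.
  exists (`|x| + `|r|); split; first exact: num_real.
  move=> M HM y /= yx; rewrite -(subrK x y).
  apply: le_trans (ler_normD _ _) (le_trans _ (ltW HM)).
  by rewrite addrC lerD2l (le_trans yx)// ler_norm.
have -> : [set y | `|y - x| <= r] = closed_ball_ Num.norm x r.
  by apply/seteqP; split => y; rewrite /closed_ball_ /= distrC.
exact: closed_closed_ball_.
Qed.

Lemma compact_cylinder x (t r r' : R) : compact [set z : V | `|z.1 - x| <= r /\ `|z.2 - t| <= r'].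
Proof.
have -> : [set z : V | `|z.1 - x| <= r /\ `|z.2 - t| <= r'] =
    [set v | `|v - x| <= r] `*` `[t - r', t + r']%classic.
  by apply/seteqP; split => -[y q] /=; rewrite in_itv/= -ler_distl.
apply: compact_setX; first exact: compact_norm_ball.
exact: segment_compact.
Qed.

(** By [second_difference_MVT] the second difference is, up to a factor in ]0, 2[, a second
    derivative at an intermediate point, hence a quadratic form in the direction whose
    coefficients are bounded on compact sets. The constant has to be uniform in the base point:
    it will be used along converging sequences of points. *)
Lemma sd_quadratic_bound phi x (t r r' : R) : smooth phi -> exists2 C : R, 0 <= C &
  forall y q v, `|y - x| <= r -> `|q - t| <= r' -> `|v| <= r ->
    `|sd (slice phi q) y v| <= C * enorm v ^+ 2.
Proof.
move=> sphi.
pose d i j := 'D_((delta_mx 0 i, 0) : V) ('D_((delta_mx 0 j, 0) : V) phi).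
have cd i j : continuous (d i j).
  have [_ _ /(_ (delta_mx 0 j, 0))[_ _ H]] := sphi 2; exact: H.
pose K := [set z : V | `|z.1 - x| <= r + r /\ `|z.2 - t| <= r'].
have cK : compact K by exact: compact_cylinder.
have /choice[C HC] i : exists c : 'I_N -> R, forall j, 0 <= c j /\
    forall z, K z -> `|d i j z| <= c j.
  have /choice[c Hc] j : exists c : R, 0 <= c /\ forall z, K z -> `|d i j z| <= c.
    by have [c c0 Hc] := compact_bound cK (cd i j); exists c.
  by exists c.
exists (2 * \sum_i \sum_j C i j).
  by rewrite mulr_ge0//; apply: sumr_ge0 => i _; apply: sumr_ge0 => j _; have [] := HC i j.
move=> y q v yx qt vr; rewrite sd_slice /sd.
have [a [b [/andP[a0 a1] /andP[b0 b1] E]]] := second_difference_MVT (y, q) (v, 0) (sphi 2).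
rewrite {}E.
set z := _ + _.
have Kz : K z.
  rewrite /z; split => /=; last by rewrite scaler0 addr0.
  rewrite addrAC; apply: le_trans (ler_normD _ _) _; apply: lerD => //.
  rewrite normrZ; apply: le_trans _ vr; rewrite ler_piMl// ler_norml !ltW//.
rewrite space_dir_sum derive2_lincomb// normrM.
have a2 : `|2 * a| <= 2 by rewrite ger0_norm; lra.
rewrite -mulrA; apply: ler_pM => //.
rewrite mulr_suml; apply: le_trans (ler_norm_sum _ _ _) _; apply: ler_sum => i _.
rewrite mulr_suml; apply: le_trans (ler_norm_sum _ _ _) _; apply: ler_sum => j _.
rewrite normrM mulrC; apply: ler_pM => //; first by have [_] := HC i j; apply.
by rewrite normrM expr2; apply: ler_pM => //; exact: coord_le_enorm.
Qed.

Lemma derive1_time phi x (t : R) : derivable phi (x, t) (0, 1) ->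
  derive1 (fun r => phi (x, r)) t = 'D_((0, 1) : V) phi (x, t).
Proof.
move=> dphi; have := @is_derive_line R V phi (x, 0) (0, 1) t.
have E r : (x, 0) + r *: ((0, 1) : V) = (x, r).
  rewrite -[LHS]/(x + r *: 0, 0 + r * 1).
  by rewrite scaler0 addr0 add0r mulr1.
have F : (fun r => phi (x, r)) = (fun r => phi ((x, 0) + r *: ((0, 1) : V))).
  by apply/funext => r; rewrite E.
rewrite E => /(_ dphi)[_ D]; rewrite F derive1E; exact: D.
Qed.

End SmoothSpaceTime.

Section Semicontinuity.
Context {R : realType} {N : nat}.
Notation V := ('rV[R]_N * R)%type.
Implicit Types (u : V -> R) (A : set V).

Lemma usc_onP A u : usc_on A u <->
  forall z c, A z -> u z < c -> \forall y \near within A (nbhs z), u y < c.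
Proof.
split=> [usc z c Az uc|H z c].
  have [|W] := usc z (- c) _; first by rewrite lte_fin ltrN2.
  rewrite /nbhs/= -nbhs_subspace_in// => nW HW; apply: filterS nW => y /HW.
  by rewrite lte_fin ltrN2.
rewrite lte_fin ltrNr => uc.
case: (pselect (A z)) => Az.
  exists [set y | u y < - c]; last by move=> y /= yc; rewrite lte_fin ltrNr.
  by rewrite /nbhs/= -nbhs_subspace_in//; exact: H.
exists [set z]; first by rewrite /nbhs/= -nbhs_subspace_out.
by move=> y ->; rewrite lte_fin ltrNr.
Qed.

Lemma lsc_on_opp A u : lsc_on A u <-> usc_on A (fun z => - u z).
Proof.
rewrite /lsc_on /usc_on; split; congr lower_semicontinuous;
by apply/funext => z; rewrite opprK.
Qed.

Lemma usc_on_line_bounded A u x (t : R) theta (M : R) : (forall y, A (y, t)) -> usc_on A u ->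
  (forall z, A z -> `|u z| <= M) -> line_bounded (slice u t) x theta M.
Proof.
move=> At /usc_onP usc uM; split; last by move=> r; exact: uM.
rewrite (_ : (fun r : R => _) = (fun r : R => - - u (x + r *: theta, t))); last first.
  by apply/funext => r; rewrite opprK.
apply: measurableT_comp; first exact: oppr_measurable.
apply/measurable_EFinP; apply: lower_semicontinuous_measurable => r c.
rewrite lte_fin ltrNr => uc.
exists [set q | u (x + q *: theta, t) < - c]; last by move=> q /= qc; rewrite lte_fin ltrNr.
have /nbhs_prodP[e e0 He] := usc _ _ (At _) uc.
apply/nbhs_normP; exists (e / (`|theta| + 1)) => /= [|q rq].
  by rewrite divr_gt0// ltr_wpDl.
apply: (He (x + q *: theta, t)); [|by rewrite subrr normr0|exact: At] => /=.
rewrite opprD addrACA subrr add0r -scalerBl normrZ distrC.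
rewrite /ball_ /= ltr_pdivlMr in rq; last by rewrite ltr_wpDl.
by apply: le_lt_trans rq; rewrite ler_wpM2l// lerDl.
Qed.

Lemma lsc_on_line_bounded A u x (t : R) theta (M : R) : (forall y, A (y, t)) -> lsc_on A u ->
  (forall z, A z -> `|u z| <= M) -> line_bounded (slice u t) x theta M.
Proof.
move=> At /lsc_on_opp usc uM; split; last by move=> r; exact: uM.
have [] := @usc_on_line_bounded A (fun z => - u z) x t theta M At usc.
  by move=> z Az; rewrite normrN; exact: uM.
move=> mu_ _; rewrite (_ : (fun r : R => _) = (fun r : R => - slice (fun z => - u z) t (x + r *: theta))).
  by apply: measurableT_comp => //; exact: oppr_measurable.
by apply/funext => r; rewrite /slice opprK.
Qed.

End Semicontinuity.

Section Residual.
Context {R : realType} {N : nat} (s : R).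
Hypothesis s01 : 0 < s < 1.
Notation V := ('rV[R]_N * R)%type.
Implicit Types (phi u : V -> R) (x theta : 'rV[R]_N).

(** Every element of the set whose infimum defines the operator is a finite number, so that the
    viscosity inequalities become inequalities between real integrals, one for each direction. *)
Lemma Lambda1_testE phi u x (t d : R) : smooth phi -> 0 < d ->
  (forall theta, exists M : R, line_bounded (slice u t) x theta M) ->
  Lambda1_test s d (slice phi t) (slice u t) x =
  ereal_inf [set (testJ s d (slice phi t) (slice u t) x theta)%:E | theta in usphere].
Proof.
move=> sphi d0 uM; congr ereal_inf.
apply: eq_imagel => theta sth.
have [M HM] := uM theta.
have [C C0 HC] := sd_quadratic_bound x t d 0 sphi.
apply: (testJ_split s01 (C := C) d0 _ _ HM).
  by apply: continuous_slice; exact: Ck_cont (sphi 0).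
move=> r /andP[r0 rd]; apply: le_trans (HC _ _ _ _ _ _) _.
- by rewrite subrr normr0 ltW.
- by rewrite subrr normr0.
- rewrite normrZ gtr0_norm//; apply: le_trans _ (ltW rd).
  by rewrite ler_piMr// ?usphere_norm// ltW.
by rewrite enormZ sth mulr1 gtr0_norm.
Qed.

Lemma residual_le0P phi u x (t d : R) : smooth phi -> 0 < d ->
  (forall theta, exists M : R, line_bounded (slice u t) x theta M) ->
  (viscosity_residual s d phi u x t <= 0)%E <->
  forall theta, usphere theta ->
    'D_((0, 1) : V) phi (x, t) <= testJ s d (slice phi t) (slice u t) x theta.
Proof.
move=> sphi d0 uM; rewrite /viscosity_residual Lambda1_testE// sube_le0.
rewrite derive1_time; last by have [_ + _] := sphi 1; apply.
split=> [H theta sth|H].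
  rewrite -lee_fin; apply: le_trans H _; apply: ereal_inf_lbound.
  by exists theta.
by apply: le_ereal_inf_tmp => _ [theta sth <-]; rewrite lee_fin; exact: H.
Qed.

(** The infimum over the sphere is approached but a minimizing direction is not provided by the
    definition, hence the margin [e]. *)
Lemma residual_ge0P phi u x (t d : R) : smooth phi -> 0 < d ->
  (forall theta, exists M : R, line_bounded (slice u t) x theta M) ->
  (0 <= viscosity_residual s d phi u x t)%E <->
  forall e : R, 0 < e -> exists2 theta, usphere theta &
    testJ s d (slice phi t) (slice u t) x theta <= 'D_((0, 1) : V) phi (x, t) + e.
Proof.
move=> sphi d0 uM; rewrite /viscosity_residual Lambda1_testE// sube_ge0 ?orbT//.
rewrite derive1_time; last by have [_ + _] := sphi 1; apply.
split=> [H e e0|H].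
  apply: contrapT => /forall2NP K.
  have : (('D_((0, 1) : V) phi (x, t) + e)%:E <=
      ereal_inf [set (testJ s d (slice phi t) (slice u t) x theta)%:E | theta in usphere])%E.
    apply: le_ereal_inf_tmp => _ [theta sth <-]; rewrite lee_fin ltW// ltNge.
    by apply/negP => Hth; have [] := K theta.
  move=> /le_trans/(_ H); rewrite lee_fin; lra.
apply/lee_addgt0Pr => e e0; have [theta sth Hth] := H e e0.
rewrite -EFinD; apply: le_trans (_ : (_ <= (testJ s d (slice phi t) (slice u t) x theta)%:E)%E) _.
  by apply: ereal_inf_lbound; exists theta.
by rewrite lee_fin.
Qed.

End Residual.

(** * Quadratic test functions *)

Section CkAlgebra.
Context {R : realType} {V : normedModType R}.
Implicit Types (f g : V -> R).

Lemma Ck_cst k (c : R) : Ck k (fun _ : V => c).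
Proof.
elim: k c => [|k IH] c /=; first exact: cst_continuous.
split; [exact: cst_continuous|by move=> v x; exact: derivable_cst|move=> v].
have -> : 'D_v (fun _ : V => c) = (fun=> 0) by apply/funext => x; exact: derive_cst.
exact: IH.
Qed.

Lemma Ck_linear k f : (forall x v (h : R), f (x + h *: v) = f x + h * f v) ->
  continuous f -> Ck k f.
Proof.
move=> lf cf; case: k => [//|k].
have lim x v : h^-1 *: ((f \o shift x) (h *: v) - f x) @[h --> 0^'] --> f v.
  apply: cvg_near_cst; near=> h.
  rewrite /= (addrC _ x) lf addrC addKr [_ *: _]mulrA mulVf ?mul1r//.
  by near: h; exact: nbhs_dnbhs_neq.
split=> //.
  by move=> v x; apply/cvg_ex; exists (f v); exact: lim.
move=> v; have -> : 'D_v f = (fun=> f v).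
  by apply/funext => x; apply: cvg_lim => //; exact: lim.
exact: Ck_cst.
Unshelve. all: by end_near. Qed.

Lemma CkD k f g : Ck k f -> Ck k g -> Ck k (fun x => f x + g x).
Proof.
elim: k f g => [|k IH] f g /=.
  by move=> cf cg x; apply: cvgD; [exact: cf|exact: cg].
move=> [cf df Df] [cg dg Dg]; split.
- by move=> x; apply: cvgD; [exact: cf|exact: cg].
- by move=> v x; exact: derivableD.
- move=> v; have -> : 'D_v (fun x => f x + g x) = (fun x => 'D_v f x + 'D_v g x).
    by apply/funext => x; exact: deriveD.
  exact: IH.
Qed.

Lemma CkM k f g : Ck k f -> Ck k g -> Ck k (fun x => f x * g x).
Proof.
elim: k f g => [|k IH] f g.
  by move=> cf cg x; apply: cvgM; [exact: cf|exact: cg].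
move=> Cf Cg; have [cf df Df] := Cf; have [cg dg Dg] := Cg; split.
- by move=> x; apply: cvgM; [exact: cf|exact: cg].
- by move=> v x; exact: derivableM.
- move=> v; have -> : 'D_v (fun x => f x * g x) = (fun x => f x * 'D_v g x + g x * 'D_v f x).
    by apply/funext => x; exact: deriveM.
  apply: CkD; first by apply: (IH f ('D_v g)); [exact: CkW|exact: Dg].
  by apply: (IH g ('D_v f)); [exact: CkW|exact: Df].
Qed.

Lemma Ck_sum k n (F : 'I_n -> V -> R) : (forall i, Ck k (F i)) -> Ck k (fun x => \sum_i F i x).
Proof.
move=> cF; elim: n F cF => [|n IH] F cF.
  rewrite (_ : (fun x => _) = fun=> 0); first exact: Ck_cst.
  by apply/funext => x; rewrite big_ord0.
rewrite (_ : (fun x => _) = fun x => F ord0 x + \sum_i F (lift ord0 i) x).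
  by apply: CkD; [exact: cF|apply: IH => i; exact: cF].
by apply/funext => x; rewrite big_ord_recl.
Qed.

End CkAlgebra.

Section QuadraticTest.
Context {R : realType} {N : nat}.
Notation V := ('rV[R]_N * R)%type.
Implicit Types (z c : V).

(** Squared Euclidean distance in space and time, a polynomial, unlike the square of the norm of
    the product space. *)
Definition dist2 z c : R := \sum_i (z.1 0 i - c.1 0 i) ^+ 2 + (z.2 - c.2) ^+ 2.

(** The test functions of the doubling of variables: a paraboloid plus a slope in time. *)
Definition quad c (a b : R) z : R := a * dist2 z c + b * z.2.

Lemma dist2C z c : dist2 z c = dist2 c z.
Proof.
rewrite /dist2 -sqrrN opprB; congr (_ + _).
by apply: eq_bigr => i _; rewrite -sqrrN opprB.
Qed.

Lemma dist2_ge0 z c : 0 <= dist2 z c.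
Proof. by rewrite addr_ge0 ?sqr_ge0// sumr_ge0// => i _; exact: sqr_ge0. Qed.

Lemma dist2xx z : dist2 z z = 0.
Proof. by rewrite /dist2 big1 ?subrr ?expr0n ?addr0// => i _; rewrite subrr expr0n. Qed.

Lemma dist2_small z c (r : R) : 0 <= r -> dist2 z c <= r ^+ 2 ->
  `|z.1 - c.1| <= r /\ `|z.2 - c.2| <= r.
Proof.
move=> r0 zr.
have le (d : R) : d ^+ 2 <= dist2 z c -> `|d| <= r.
  move=> dz; rewrite -(@ler_pXn2r _ 2)// ?nnegrE// real_normK ?num_real//.
  exact: le_trans dz zr.
have S0 : 0 <= \sum_i (z.1 0 i - c.1 0 i) ^+ 2 by apply: sumr_ge0 => i _; exact: sqr_ge0.
split; last by apply: le; rewrite lerDr.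
apply: norm_le_coord => // i; rewrite !mxE; apply: le.
apply: (@le_trans _ _ (\sum_i (z.1 0 i - c.1 0 i) ^+ 2)); last by rewrite lerDl sqr_ge0.
by rewrite (bigD1 i)//= lerDl; apply: sumr_ge0 => j _; exact: sqr_ge0.
Qed.

Lemma continuous_coord (i : 'I_N) : continuous (fun z : V => z.1 0 i).
Proof.
move=> z; apply/cvgrPdist_lt => e e0; apply/nbhs_prodP; exists e => // y yz _.
rewrite distrC; apply: le_lt_trans yz.
by have := coord_le_norm (y.1 - z.1) i; rewrite !mxE.
Qed.

Lemma continuous_time : continuous (fun z : V => z.2).
Proof.
move=> z; apply/cvgrPdist_lt => e e0; apply/nbhs_prodP; exists e => // y _.
by rewrite distrC.
Qed.

Lemma Ck_dist2 k c : Ck k (fun z => dist2 z c).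
Proof.
have sq f d : Ck k f -> Ck k (fun z : V => (f z - d) ^+ 2).
  move=> cf; have cfd : Ck k (fun z => f z - d) by apply: CkD => //; exact: Ck_cst.
  exact: CkM.
apply: CkD; last first.
  apply: sq; apply: Ck_linear; last exact: continuous_time.
  by [].
apply: Ck_sum => i; apply: sq; apply: Ck_linear; last exact: continuous_coord.
by move=> x v h; rewrite /= !mxE.
Qed.

Lemma smooth_quad c a b : smooth (quad c a b).
Proof.
move=> k; apply: CkD; apply: CkM; try exact: Ck_cst; first exact: Ck_dist2.
apply: Ck_linear; last exact: continuous_time.
by [].
Qed.

Lemma smoothD (f g : V -> R) : smooth f -> smooth g -> smooth (fun z => f z + g z).
Proof. by move=> sf sg k; exact: CkD. Qed.

Lemma derive_quad c a b x t :
  'D_((0, 1) : V) (quad c a b) (x, t) = 2 * a * (t - c.2) + b.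
Proof.
have E (h : R) : quad c a b (h *: ((0, 1) : V) + (x, t)) - quad c a b (x, t) =
    h * (a * (2 * (t - c.2) + h) + b).
  rewrite -[h *: _ + _]/(h *: 0 + x, h * 1 + t) scaler0 add0r mulr1 /quad /dist2 /=.
  by ring.
apply: cvg_lim => //; apply/cvgrPdist_lt => e e0; near=> h.
have h0 : h != 0 by near: h; exact: nbhs_dnbhs_neq.
rewrite /= E [_ *: _]mulrA mulVf// mul1r.
have -> : 2 * a * (t - c.2) + b - (a * (2 * (t - c.2) + h) + b) = - (a * h) by ring.
rewrite normrN normrM; apply: (@le_lt_trans _ _ ((`|a| + 1) * `|h|)).
  by rewrite ler_wpM2r// lerDl.
rewrite mulrC -ltr_pdivlMr; last by rewrite ltr_wpDl.
near: h; apply: dnbhs0_lt; by rewrite divr_gt0// ltr_wpDl.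
Unshelve. all: by end_near. Qed.

Lemma sd_quad c a b x t v : sd (slice (quad c a b) t) x v = 2 * a * enorm v ^+ 2.
Proof.
rewrite /sd /slice /quad /dist2 /= sqr_enorm.
have -> : \sum_i v 0 i ^+ 2 = 2^-1 * (\sum_i ((x + v) 0 i - c.1 0 i) ^+ 2 +
    \sum_i ((x - v) 0 i - c.1 0 i) ^+ 2) - \sum_i (x 0 i - c.1 0 i) ^+ 2.
  rewrite -big_split /= mulr_sumr -sumrB; apply: eq_bigr => i _.
  by rewrite !mxE; field.
by field.
Qed.

End QuadraticTest.

(** * The comparison principle *)

(** Otherwise the sets [f < c] with [c < sup f] form an open cover of the compact set. *)
Lemma usc_attains_max {R : realType} {X : topologicalType} (K : set X) (f : X -> R) :
  compact K -> K !=set0 -> (exists M, forall x, K x -> f x <= M) ->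
  (forall x c, K x -> f x < c -> \forall y \near x, K y -> f y < c) ->
  exists2 x, K x & forall y, K y -> f y <= f x.
Proof.
move=> cK [x0 Kx0] [M fM] usc.
pose S := sup (f @` K).
have hS : has_sup (f @` K).
  by split; [exists (f x0), x0|exists M => _ [x Kx <-]; exact: fM].
have fS x : K x -> f x <= S by move=> Kx; apply: ub_le_sup; [case: hS|exists x].
apply: contrapT => /forall2NP nomax.
have ltS x : K x -> f x < S.
  move=> Kx; have [//|/existsNP[y /not_implyP[Ky /negP]]] := nomax x.
  by rewrite -ltNge => /lt_le_trans; apply; exact: fS.
have /compact_near_coveringP cov := cK.
have [] := cov _ (S^'-) (fun c x => K x -> f x < c) _ _.
  move=> x Kx.
  pose c := (f x + S) / 2; have fxS := ltS x Kx.
  have fc : f x < c by rewrite /c; lra.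
  have cS : c < S by rewrite /c; lra.
  exists ([set y | K y -> f y < c], [set d | c < d]).
    by split; [exact: usc|exact: nbhs_left_gt].
  by move=> [y d] /= [yc cd] Ky; exact: lt_trans (yc Ky) cd.
move=> e /= e0 He.
have eS : `|S - (S - e / 2)| < e.
  by rewrite opprB addrC subrK gtr0_norm ?divr_gt0//; lra.
have HK := He (S - e / 2) eS (ltac:(lra)).
have : S <= S - e / 2.
  apply: sup_le_ub; first by case: hS.
  by move=> _ [x Kx <-]; apply/ltW/HK.
lra.
Qed.

(** Off the parabolic interior [u] stays below [v] up to [m], even when the two are evaluated at
    nearby distinct points: by semicontinuity around each point, uniformly by compactness. This
    forces the maximum points of the doubled function into the interior. *)
Lemma near_parabolic_boundary {R : realType} {N : nat} (Omega : set 'rV[R]_N)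
    (u v : 'rV[R]_N * R -> R) (r T m : R) : open Omega ->
  (forall z c, halfspace z -> u z < c -> \forall y \near z, halfspace y -> u y < c) ->
  (forall z c, halfspace z -> c < v z -> \forall y \near z, halfspace y -> c < v y) ->
  (forall z, halfspace z -> ~ Omega z.1 \/ z.2 = 0 -> u z <= v z) ->
  0 < m -> exists2 rho : R, 0 < rho &
  forall z z', `|z.1| <= r -> 0 <= z.2 <= T -> halfspace z' ->
    `|z'.1 - z.1| <= rho -> `|z'.2 - z.2| <= rho ->
    [\/ ~ Omega z.1, ~ Omega z'.1, z.2 = 0 | z'.2 = 0] -> u z - v z' < m.
Proof.
move=> oOmega usc lsc uv m0.
pose K := [set z : 'rV[R]_N * R | `|z.1 - 0| <= r /\ `|z.2 - T / 2| <= T / 2].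
have cK : compact K by exact: compact_cylinder.
have Khalf z : K z -> halfspace z by move=> [_]; rewrite /halfspace /= ler_norml; lra.
pose P (rho : R) z := K z -> forall z', halfspace z' ->
    `|z'.1 - z.1| <= rho -> `|z'.2 - z.2| <= rho ->
    [\/ ~ Omega z.1, ~ Omega z'.1, z.2 = 0 | z'.2 = 0] -> u z - v z' < m.
have /compact_near_coveringP cov := cK.
have step z : K z -> \forall z' \near z & rho \near 0^'+, P rho z'.
  move=> Kz; have hz := Khalf z Kz.
  (* a neighbourhood of z on which the pair (y, y') is controlled *)
  have [d d0 Hd] : exists2 d : R, 0 < d & forall y y', halfspace y -> halfspace y' ->
      `|y.1 - z.1| < d -> `|y.2 - z.2| < d -> `|y'.1 - z.1| < d -> `|y'.2 - z.2| < d ->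
      [\/ ~ Omega y.1, ~ Omega y'.1, y.2 = 0 | y'.2 = 0] -> u y - v y' < m.
    have [[Oz z0]|out] := pselect (Omega z.1 /\ z.2 != 0).
      have z20 : 0 < z.2 by rewrite lt_neqAle eq_sym z0.
      have /nbhs_normP[d /= d0 Hd] : nbhs z.1 Omega by exact: open_nbhs_nbhs.
      exists (Num.min d z.2); first by rewrite lt_min d0.
      have time q : `|q - z.2| < Num.min d z.2 -> q <> 0.
        by rewrite lt_min => /andP[_] + q0; rewrite q0 sub0r normrN gtr0_norm// ltxx.
      have space q : `|q - z.1| < Num.min d z.2 -> Omega q.
        by rewrite lt_min => /andP[+ _] => qd; apply: Hd; rewrite /ball_ /= distrC.
      move=> y y' _ _ y1 y2 y'1 y'2 [|||].
      - by move=> []; exact: space.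
      - by move=> []; exact: space.
      - by move=> /(time _ y2).
      - by move=> /(time _ y'2).
    have uvz : u z <= v z.
      apply: uv => //; have [Oz|] := pselect (Omega z.1); last by left.
      right; apply: contrapT => z0; apply: out; split => //; exact/eqP.
    have m2 : 0 < m / 2 by rewrite divr_gt0.
    have /nbhs_prodP[d1 d10 H1] : \forall y \near z, halfspace y -> u y < u z + m / 2.
      by apply: usc => //; lra.
    have /nbhs_prodP[d2 d20 H2] : \forall y \near z, halfspace y -> v z - m / 2 < v y.
      by apply: lsc => //; lra.
    exists (Num.min d1 d2); first by rewrite lt_min d10.
    move=> y y' hy hy'; rewrite !lt_min => /andP[y1 _] /andP[y2 _] /andP[_ y1'] /andP[_ y2'] _.
    by have := H1 y y1 y2 hy; have := H2 y' y1' y2' hy'; lra.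
  have d2 : 0 < d / 2 by rewrite divr_gt0.
  exists ([set y | `|y.1 - z.1| < d / 2 /\ `|y.2 - z.2| < d / 2], [set rho | rho < d / 2]).
    by split; [apply/nbhs_prodP; exists (d / 2)|exact: nbhs_right_lt].
  move=> [y rho] /= [[y1 y2] rhod] Ky y' hy' yy1 yy2; apply: Hd => //.
  - exact: Khalf.
  - lra.
  - lra.
  - by rewrite -(subrKA y.1); apply: le_lt_trans (ler_normD _ _) _; lra.
  - by rewrite -(subrKA y.2); apply: le_lt_trans (ler_normD _ _) _; lra.
have [e /= e0 He] := cov _ (0^'+) P _ step.
exists (e / 2); first by rewrite divr_gt0.
move=> z z' zr zT; have Kz : K z.
  by rewrite /K /= subr0; split => //; rewrite ler_norml; lra.
have ee : `|0 - e / 2| < e by rewrite sub0r normrN gtr0_norm ?divr_gt0//; lra.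
have e20 : 0 < e / 2 by rewrite divr_gt0.
exact: (He (e / 2) ee e20 z Kz Kz).
Qed.

Lemma continuous_dist2 {R : realType} {N : nat} :
  continuous (fun p : ('rV[R]_N * R) * ('rV[R]_N * R) => dist2 p.1 p.2).
Proof.
have sq (f g : ('rV[R]_N * R) * ('rV[R]_N * R) -> R) : Ck 0 f -> Ck 0 g ->
    Ck 0 (fun p => (f p - g p) ^+ 2).
  move=> cf cg; have cfg : Ck 0 (fun p => f p - g p).
    by move=> p; apply: cvgB; [exact: cf|exact: cg].
  exact: (CkM cfg cfg).
have cf1 (f : 'rV[R]_N * R -> R) : continuous f -> Ck 0 (fun p : ('rV[R]_N * R) * ('rV[R]_N * R) => f p.1).
  by move=> cf p; apply: (continuous_comp (f := fst)); [exact: cvg_fst|exact: cf].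
have cf2 (f : 'rV[R]_N * R -> R) : continuous f -> Ck 0 (fun p : ('rV[R]_N * R) * ('rV[R]_N * R) => f p.2).
  by move=> cf p; apply: (continuous_comp (f := snd)); [exact: cvg_snd|exact: cf].
apply: (@CkD _ _ 0); last first.
  by apply: sq; [exact: (cf1 _ continuous_time)|exact: (cf2 _ continuous_time)].
by apply: (@Ck_sum _ _ 0) => i; apply: sq;
  [exact: (cf1 _ (@continuous_coord _ _ i))|exact: (cf2 _ (@continuous_coord _ _ i))].
Qed.

Lemma continuous_penalty {R : realType} {N : nat} (a b : R) :
  continuous (fun p : ('rV[R]_N * R) * ('rV[R]_N * R) => a * dist2 p.1 p.2 + b * p.1.2).
Proof.
apply: (@CkD _ _ 0); apply: (@CkM _ _ 0).
- exact: (@Ck_cst _ _ 0).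
- exact: continuous_dist2.
- exact: (@Ck_cst _ _ 0).
- by move=> p; apply: (continuous_comp (f := fst)); [exact: cvg_fst|exact: continuous_time].
Qed.

(** Below [d] only the paraboloids contribute, and their second differences are multiples of
    [t ^ 2]; between [d] and [L] the maximum property orders the second differences of [u] and [v];
    beyond [L] only the bound [M] is available. *)
Lemma testJ_quad_diff {R : realType} {N : nat} (s : R) (s01 : 0 < s < 1)
    (u v : 'rV[R]_N * R -> R) (x1 x2 theta : 'rV[R]_N) (t1 t2 : R)
    (c1 c2 : 'rV[R]_N * R) (a b b' M d L : R) :
  0 < d -> d <= L -> usphere theta ->
  line_bounded (slice u t1) x1 theta M -> line_bounded (slice v t2) x2 theta M ->
  (forall r : R, 0 < r < L ->
     sd (slice u t1) x1 (r *: theta) <= sd (slice v t2) x2 (r *: theta)) ->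
  testJ s d (slice (quad c1 a b) t1) (slice u t1) x1 theta -
    testJ s d (slice (quad c2 (- a) b') t2) (slice v t2) x2 theta <=
  4 * a * levyI s (splice d (fun r : R => r ^+ 2) (fun=> 0)) +
    8 * M * levyI s (splice L (fun=> 0) (fun=> 1)).
Proof.
move=> d0 dL sth lbu lbv uv.
have L0 : 0 < L := lt_le_trans d0 dL.
have lJ (w : 'rV[R]_N * R -> R) c (e f : R) y q : line_bounded (slice w q) y theta M ->
    levy (splice d (fun r => sd (slice (quad c e f) q) y (r *: theta))
      (fun r => sd (slice w q) y (r *: theta))).
  move=> lb; apply: (levy_splice_near (M := 4 * M) (C := 2 * `|e|) d0).
  - apply: measurable_funTS; apply: measurable_sd; apply: continuous_measurable_fun.
    by apply: continuous_line; apply: continuous_slice; exact: Ck_cont (smooth_quad c e f 0).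
  - by apply: measurable_funTS; apply: measurable_sd; case: lb.
  - move=> r /andP[r0 _]; rewrite sd_quad enormZ sth mulr1 !normrM normr_id.
    by rewrite gtr0_norm// (gtr0_norm r0) expr2.
  - by move=> r _; exact: sd_bounded.
have lhd : levy (splice d (fun r : R => r ^+ 2) (fun=> 0)) by exact: levy_lt_sqr.
have ltl : levy (splice L (fun=> 0) (fun=> 1) : R -> R) by exact: levy_ge.
have lJu := lJ u c1 a b x1 t1 lbu.
have lJv := lJ v c2 (- a) b' x2 t2 lbv.
rewrite /testJ -levyI_B// -!levyI_Z// -levyI_D//; [|exact: levyZ..].
apply: levyI_le => //; [exact: levyB|by apply: levyD; exact: levyZ|].
move=> r r0; rewrite /splice.
have [rd|dr] := ltP r d.
  rewrite (lt_le_trans rd dL) !sd_quad enormZ sth mulr1 gtr0_norm//.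
  by lra.
have [rL|Lr] := ltP r L.
  by have := uv r; rewrite r0 rL => /(_ isT); lra.
have := sd_bounded r lbu; have := sd_bounded r lbv; rewrite !ler_norml.
by lra.
Qed.

(** Doubling of variables with the penalty [a * dist2 z1 z2 + eta * z1.2]. The penalty does not
    change when both space points are moved by the same vector, so at a maximum point the second
    differences of [u] are below those of [v] as long as the moved points stay in the compact set
    of maximization, which is chosen to contain the [L]-neighbourhood of the domain. One nearly optimal
    direction for [v] is then used for [u] as well, and the slope [eta] in time exceeds what
    remains: the far field, small for [L] large, and the paraboloids, small for [d] small. *)
Lemma comparison_principle {R : realType} {N : nat} (s : R) (Omega : set 'rV[R]_N)
    (u v : 'rV[R]_N * R -> R) (M : R) : 0 < s < 1 ->
  open Omega -> bounded_set Omega ->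
  (forall z, halfspace z -> `|u z| <= M) -> (forall z, halfspace z -> `|v z| <= M) ->
  usc_on halfspace u -> lsc_on halfspace v ->
  (forall z, halfspace z -> ~ Omega z.1 \/ z.2 = 0 -> u z <= v z) ->
  (forall phi, smooth phi -> forall x t d, Omega x -> 0 < t -> 0 < d ->
    cylinder x t d `<=` Omega `*` `]0, +oo[ ->
    (forall z, cylinder x t d z -> u z - phi z <= u (x, t) - phi (x, t)) ->
    forall theta, usphere theta ->
    'D_((0, 1) : 'rV[R]_N * R) phi (x, t) <= testJ s d (slice phi t) (slice u t) x theta) ->
  (forall phi, smooth phi -> forall x t d, Omega x -> 0 < t -> 0 < d ->
    cylinder x t d `<=` Omega `*` `]0, +oo[ ->
    (forall z, cylinder x t d z -> v (x, t) - phi (x, t) <= v z - phi z) ->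
    forall e : R, 0 < e -> exists2 theta, usphere theta &
    testJ s d (slice phi t) (slice v t) x theta <= 'D_((0, 1) : 'rV[R]_N * R) phi (x, t) + e) ->
  forall x t, Omega x -> 0 <= t -> u (x, t) <= v (x, t).
Proof.
move=> s01 oOmega bOmega uM vM usc_u lsc_v uv_boundary test_u test_v x t.
have usc_near z c : halfspace z -> u z < c -> \forall y \near z, halfspace y -> u y < c.
  by move=> hz uc; exact: (usc_onP _ _).1 usc_u _ _ hz uc.
have lsc_near z c : halfspace z -> c < v z -> \forall y \near z, halfspace y -> c < v y.
  move=> hz cv; have cv' : - v z < - c by rewrite ltrN2.
  have H : nbhs z (fun y => halfspace y -> - v y < - c).
    exact: (usc_onP _ _).1 ((lsc_on_opp _ _).1 lsc_v) z (- c) hz cv'.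
  by apply: filterS H => y H hy; rewrite -ltrN2; exact: H.
move=> Ox t0; rewrite leNgt; apply/negP => vu.
pose m := (u (x, t) - v (x, t)) / 2; have m0 : 0 < m by rewrite /m; lra.
have M0 : 0 <= M := le_trans (normr_ge0 _) (uM _ (t0 : halfspace (x, t))).
pose eta := m / (t + 1).
have t10 : 0 < t + 1 by lra.
have eta0 : 0 < eta by rewrite divr_gt0.
have etat : eta * t <= m by rewrite /eta mulrAC ler_pdivrMr// ler_wpM2l ?ltW//; lra.
(* the slope eta absorbs the contribution of the far field *)
have [L L0 HL] : exists2 L : R, 0 < L &
    8 * M * levyI s (splice L (fun=> 0) (fun=> 1)) <= eta / 4.
  have e1 : 0 < eta / 4 / (8 * M + 1) by rewrite !divr_gt0//; lra.
  have [L L0 HL] := levyI_tail_small s01 e1; exists L => //.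
  move: HL; rewrite ler_pdivlMr; last by lra.
  have : 0 <= levyI s (splice L (fun=> 0) (fun=> 1)).
    by apply: levyI_ge0 => // r _; rewrite /splice; case: ifP.
  nra.
have [B [B0 HB]] : exists B : R, 0 < B /\ forall y, Omega y -> `|y| <= B.
  have [B [_ HB]] := bOmega; exists (`|B| + 1); split; first by rewrite ltr_wpDl.
  by move=> y; apply: HB; rewrite (le_lt_trans (ler_norm _))// ltrDl.
pose T := 2 * M / eta + 1.
have Te0 : 0 <= 2 * M / eta by apply: divr_ge0; [exact: mulr_ge0|exact: ltW].
have T0 : 0 < T by rewrite /T; lra.
have [rho rho0 Hrho] := near_parabolic_boundary (B + L) T oOmega
  usc_near lsc_near uv_boundary m0.
pose rh := Num.min rho (2^-1).
have rh0 : 0 < rh by rewrite lt_min rho0 invr_gt0 ltr0n.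
pose a := (2 * M + 1) / rh ^+ 2.
have a0 : 0 < a by rewrite divr_gt0 ?exprn_gt0//; lra.
pose K1 := [set z : 'rV[R]_N * R | `|z.1 - 0| <= B + L /\ `|z.2 - T / 2| <= T / 2].
have cK1 : compact K1 by exact: compact_cylinder.
have K1half z : K1 z -> halfspace z by move=> [_]; rewrite /halfspace /= ler_norml; lra.
have K1I y q : `|y| <= B + L -> 0 <= q <= T -> K1 (y, q).
  by move=> yB qT; split => /=; [rewrite subr0|rewrite ler_norml; lra].
pose Phi (p : ('rV[R]_N * R) * ('rV[R]_N * R)) := u p.1 - v p.2 - (a * dist2 p.1 p.2 + eta * p.1.2).
have [[z1 z2] [/= K1z1 K1z2] Hmax] : exists2 p, (K1 `*` K1) p & forall q, (K1 `*` K1) q -> Phi q <= Phi p.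
  apply: usc_attains_max.
  - exact: compact_setX.
  - by exists ((0, 0), (0, 0)); split; apply: K1I; rewrite ?normr0 ?lexx/=; lra.
  - exists (2 * M) => -[p q] [Kp Kq]; rewrite /Phi /=.
    have := uM _ (K1half _ Kp); have := vM _ (K1half _ Kq); rewrite !ler_norml.
    have p0 : 0 <= p.2 := K1half _ Kp.
    have : 0 <= a * dist2 p q by rewrite mulr_ge0 ?dist2_ge0// ltW.
    have : 0 <= eta * p.2 by rewrite mulr_ge0// ltW.
    lra.
  - move=> [p q] c [/= Kp Kq]; rewrite /Phi /= => Pc.
    pose pen (p : ('rV[R]_N * R) * ('rV[R]_N * R)) := a * dist2 p.1 p.2 + eta * p.1.2.
    have cpen : {for (p, q), continuous pen} by exact: continuous_penalty.
    pose e := (c - (u p - v q - pen (p, q))) / 4.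
    have e0 : 0 < e by rewrite /e /pen /=; lra.
    have Nu : \forall y \near p, halfspace y -> u y < u p + e.
      by apply: usc_near; [exact: K1half|lra].
    have Nv : \forall y \near q, halfspace y -> v q - e < v y.
      by apply: lsc_near; [exact: K1half|lra].
    have /cvgrPdist_lt/(_ _ e0) Np := cpen.
    have Nuv : \forall y \near (p, q), (halfspace y.1 -> u y.1 < u p + e) /\
        (halfspace y.2 -> v q - e < v y.2).
      by exists ([set y | halfspace y -> u y < u p + e], [set y | halfspace y -> v q - e < v y]).
    apply: filterS2 Nuv Np => y [Hu Hv] Hp [K1y K2y].
    have {}Hu := Hu (K1half _ K1y); have {}Hv := Hv (K1half _ K2y).
    move: Hp; rewrite ltr_norml => /andP[_ Hp].
    have Ee : 4 * e = c - (u p - v q - pen (p, q)) by rewrite /e; field.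
    by move: Hp; rewrite -/(pen y); lra.
case: z1 K1z1 Hmax => x1 t1 K1z1; case: z2 K1z2 => x2 t2 K1z2 Hmax.
have tT : 0 <= t <= T.
  rewrite t0 /=; have : t <= 2 * M / eta by rewrite ler_pdivlMr//;
    have := uM _ (t0 : halfspace (x, t)); have := vM _ (t0 : halfspace (x, t));
    rewrite !ler_norml; move: etat; rewrite /m; lra.
  by rewrite /T; lra.
have Kxt : K1 (x, t) by apply: K1I => //; have := HB x Ox; lra.
have Em : m <= u (x1, t1) - v (x2, t2) - (a * dist2 (x1, t1) (x2, t2) + eta * t1).
  have := Hmax ((x, t), (x, t)) (conj Kxt Kxt); rewrite /Phi /= dist2xx mulr0 add0r.
  by move: etat; rewrite /m; lra.
have t1_0 : 0 <= t1 := K1half _ K1z1.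
have t2_0 : 0 <= t2 := K1half _ K1z2.
have [x1B t1T] : `|x1| <= B + L /\ t1 <= T.
  by case: K1z1 => /=; rewrite subr0 ler_norml; lra.
have D0 := dist2_ge0 (x1, t1) (x2, t2).
have aD0 : 0 <= a * dist2 (x1, t1) (x2, t2) by rewrite mulr_ge0// ltW.
have et0 : 0 <= eta * t1 by rewrite mulr_ge0// ltW.
have [uM1 vM2] : u (x1, t1) <= M /\ - M <= v (x2, t2).
  have := uM _ (K1half _ K1z1); have := vM _ (K1half _ K1z2).
  by rewrite !ler_norml => /andP[-> _] /andP[_ ->].
have t1T' : t1 <= T - 1.
  by rewrite /T addrK ler_pdivlMr//; lra.
have [x12 t12] : `|x2 - x1| <= rh /\ `|t2 - t1| <= rh.
  apply: (@dist2_small _ _ (x2, t2) (x1, t1)); first exact: ltW.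
  rewrite dist2C -(ler_pM2l a0); apply: (@le_trans _ _ (2 * M)); first by lra.
  by rewrite /a divfK ?gt_eqF ?exprn_gt0//; lra.
have rhrho : rh <= rho by rewrite ge_min lexx.
have rh2 : rh <= 2^-1 by rewrite ge_min lexx orbT.
have t2T : t2 < T by move: t12; rewrite ler_norml; lra.
have inside : ~ [\/ ~ Omega x1, ~ Omega x2, t1 = 0 | t2 = 0].
  move=> H; have := Hrho (x1, t1) (x2, t2) x1B _ t2_0 (le_trans x12 rhrho) (le_trans t12 rhrho) H.
  by rewrite /= t1_0 t1T => /(_ isT); lra.
have O1 : Omega x1 by apply: contrapT => n; apply: inside; constructor 1.
have O2 : Omega x2 by apply: contrapT => n; apply: inside; constructor 2.
have t1p : 0 < t1 by rewrite lt_neqAle t1_0 andbT eq_sym; apply/eqP => n; apply: inside; constructor 3.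
have t2p : 0 < t2 by rewrite lt_neqAle t2_0 andbT eq_sym; apply/eqP => n; apply: inside; constructor 4.
have /nbhs_normP[d1 /= d10 Hd1] : nbhs x1 Omega by exact: open_nbhs_nbhs.
have /nbhs_normP[d2 /= d20 Hd2] : nbhs x2 Omega by exact: open_nbhs_nbhs.
have e3 : 0 < eta / 4 / (4 * a) by apply: divr_gt0; [exact: divr_gt0|exact: mulr_gt0].
have [d3 d30 Hd3] := levyI_head_small s01 e3.
pose d := Num.min (Num.min d1 d2) (Num.min (Num.min t1 t2) (Num.min (Num.min d3 L) (2^-1))).
have [dd1 dd2 dt1 dt2] : [/\ d <= d1, d <= d2, d <= t1 & d <= t2].
  by rewrite /d; split; rewrite !ge_min lexx ?orbT.
have [dd3 dL d12] : [/\ d <= d3, d <= L & d <= 2^-1].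
  by rewrite /d; split; rewrite !ge_min lexx ?orbT.
have d0 : 0 < d by rewrite /d !lt_min d10 d20 t1p t2p d30 L0 invr_gt0 ltr0n.
have cyl y q (r : R) : d <= r -> d <= q -> q <= T - 2^-1 -> (ball_ Num.norm y r `<=` Omega) ->
    cylinder y q d `<=` Omega `*` `]0, +oo[ /\ cylinder y q d `<=` K1.
  move=> dr dq qT yO.
  have sub : cylinder y q d `<=` Omega `*` `]0, T].
    move=> [y' q'] [/= yd]; rewrite in_itv/= => /andP[q1 q2]; split => /=.
      apply: yO; rewrite /ball_ /= distrC; apply: le_lt_trans (norm_le_enorm _) _.
      exact: lt_le_trans yd dr.
    by rewrite in_itv/=; apply/andP; clear -q1 q2 dq qT d12; split; lra.
  split=> -[y' q'] /sub[/= Oy]; rewrite in_itv/= => /andP[q1 q2].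
    by split=> //=; rewrite in_itv/= q1.
  by apply: K1I; [have := HB y' Oy; clear -L0; lra|rewrite (ltW q1)].
have [c1 c1K] := cyl x1 t1 d1 dd1 dt1 (ltac:(clear -t1T'; lra)) Hd1.
have [c2 c2K] : cylinder x2 t2 d `<=` Omega `*` `]0, +oo[ /\ cylinder x2 t2 d `<=` K1.
  apply: (cyl x2 t2 d2) => //.
  by move: t12; rewrite ler_norml; clear -t1T' rh2; lra.
have max_u z : cylinder x1 t1 d z ->
    u z - quad (x2, t2) a eta z <= u (x1, t1) - quad (x2, t2) a eta (x1, t1).
  move=> /c1K Kz; have := Hmax (z, (x2, t2)) (conj Kz K1z2).
  by rewrite /Phi /quad /=; clear; lra.
have min_v z : cylinder x2 t2 d z ->
    v (x2, t2) - quad (x1, t1) (- a) 0 (x2, t2) <= v z - quad (x1, t1) (- a) 0 z.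
  move=> /c2K Kz; have := Hmax ((x1, t1), z) (conj K1z1 Kz).
  by rewrite /Phi /quad /= !(dist2C _ (x1, t1)); clear; lra.
have e4 : 0 < eta / 4 by rewrite divr_gt0.
have [theta sth Hv] := test_v _ (smooth_quad (x1, t1) (- a) 0) _ _ _ O2 t2p d0 c2 min_v _ e4.
have Hu := test_u _ (smooth_quad (x2, t2) a eta) _ _ _ O1 t1p d0 c1 max_u _ sth.
rewrite derive_quad /= in Hu; rewrite derive_quad /= in Hv.
have lbu : line_bounded (slice u t1) x1 theta M.
  exact: (@usc_on_line_bounded _ _ halfspace).
have lbv : line_bounded (slice v t2) x2 theta M.
  exact: (@lsc_on_line_bounded _ _ halfspace).
have th1 := usphere_norm sth.
have hdI := Hd3 d (ltac:(by rewrite d0)).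
have key := @testJ_quad_diff R N s s01 u v x1 x2 theta t1 t2 (x2, t2) (x1, t1) a eta 0 M d L
  d0 dL sth lbu lbv.
suff uv r : 0 < r < L ->
    sd (slice u t1) x1 (r *: theta) <= sd (slice v t2) x2 (r *: theta).
  have := key uv.
  have : 4 * a * levyI s (splice d (fun r : R => r ^+ 2) (fun=> 0)) <= eta / 4.
    by rewrite mulrC -ler_pdivlMr// mulr_gt0.
  by clear -Hu Hv HL eta0; lra.
move=> /andP[r0 rL].
have inc (sg : R) : `|sg| = 1 -> u (x1 + (sg * r) *: theta, t1) - v (x2 + (sg * r) *: theta, t2) <=
    u (x1, t1) - v (x2, t2).
  move=> sg1.
  have K y q : Omega y -> 0 <= q <= T -> K1 (y + (sg * r) *: theta, q).
    move=> Oy qT; apply: K1I => //; apply: le_trans (ler_normD _ _) _.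
    apply: lerD; first exact: HB.
    rewrite normrZ normrM sg1 mul1r gtr0_norm//; apply: le_trans (ltW rL).
    by rewrite ler_piMr// ltW.
  have K1' : K1 (x1 + (sg * r) *: theta, t1) by apply: K => //; rewrite t1_0.
  have K2' : K1 (x2 + (sg * r) *: theta, t2) by apply: K => //; rewrite t2_0 ltW.
  have := Hmax (_, _) (conj K1' K2'); rewrite /Phi /=.
  have -> : dist2 (x1 + (sg * r) *: theta, t1) (x2 + (sg * r) *: theta, t2) =
      dist2 (x1, t1) (x2, t2).
    by rewrite /dist2 /=; congr (_ + _); apply: eq_bigr => i _; rewrite !mxE; congr (_ ^+ 2); ring.
  by clear; lra.
have := inc 1 (normr1 _); have := inc (-1) (normrN1 _).
rewrite mul1r mulN1r scaleNr /sd /slice; clear; lra.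
Qed.

(** * A monotone scheme *)

Section Step.
Context {R : realType}.

Definition step (rho t : R) : R := rho * (Num.truncn (t / rho))%:R.

Implicit Types (rho t : R).

Lemma step_ge0 rho t : 0 < rho -> 0 <= step rho t.
Proof. by move=> r0; rewrite mulr_ge0// ltW. Qed.

Lemma step_le rho t : 0 < rho -> 0 <= t -> step rho t <= t.
Proof.
move=> r0 t0; rewrite /step mulrC -ler_pdivlMr//.
by rewrite truncn_le// divr_ge0// ltW.
Qed.

Lemma step_gt rho t : 0 < rho -> t - rho < step rho t.
Proof.
move=> r0; have := truncnS_gt (t / rho); rewrite ltr_pdivrMr// -natr1 mulrDl mul1r mulrC.
by rewrite /step; lra.
Qed.

Lemma step_small rho t : 0 < rho -> t < rho -> step rho t = 0.
Proof.
move=> r0 tr; rewrite /step; have : (Num.truncn (t / rho) <= 0)%N.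
  by rewrite truncn_le_nat ltr_pdivrMr// mul1r.
by rewrite leqn0 => /eqP ->; rewrite mulr0.
Qed.

(** Functions of the rounded variable are constant on grid intervals, so that the scheme below is
    meaningful for arbitrary bounded functions. *)
Lemma measurable_step rho (f : R -> R) : 0 < rho ->
  measurable_fun (`]0, +oo[%classic : set R) (fun t => f (step rho t)).
Proof.
move=> r0 mD Y mY.
pose J n : set R := if `[< Y (f (rho * n%:R)) >] then `[rho * n%:R, rho * n.+1%:R[%classic else set0.
have -> : `]0, +oo[%classic `&` (fun t => f (step rho t)) @^-1` Y =
    `]0, +oo[%classic `&` \bigcup_n J n :> set R.
  apply/seteqP; split=> t [/=]; rewrite in_itv/= andbT => t0.
    move=> Yt; split => //; exists (Num.truncn (t / rho)) => //.
    rewrite /J; case: asboolP => //= _.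
    have : 0 <= t / rho by rewrite divr_ge0// ltW.
    move=> /truncn_itv; rewrite in_itv/=.
    by rewrite ler_pdivlMr// ltr_pdivrMr// !(mulrC rho).
  move=> [n _]; rewrite /J; case: asboolP => //= Yn.
  rewrite in_itv/= => nt; split => //; rewrite /step.
  suff -> : Num.truncn (t / rho) = n by [].
  apply: truncn_def.
  by rewrite ler_pdivlMr// ltr_pdivrMr// !(mulrC _ rho).
apply: measurableI => //; apply: bigcupT_measurable => n.
by rewrite /J; case: ifP => _; [exact: measurable_itv|exact: measurable0].
Qed.
End Step.

Section DiscreteOperator.
Context {R : realType} {N : nat} (s : R).
Hypothesis s01 : 0 < s < 1.
Implicit Types (w : 'rV[R]_N -> R) (x theta : 'rV[R]_N) (rho M : R).

(** The directional operator sampled at multiples of [rho]; the second difference vanishes for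
    [t < rho], so that the singularity of the kernel is never seen. *)
Definition stepI rho w x theta : R := levyI s (fun t => sd w x (step rho t *: theta)).

Lemma sd0 w x : sd w x 0 = 0.
Proof. by rewrite /sd subr0 addr0; ring. Qed.

Lemma sd_le4 w x v M : (forall y, `|w y| <= M) -> `|sd w x v| <= 4 * M.
Proof.
move=> wM; have := wM (x + v); have := wM (x - v); have := wM x.
by rewrite /sd !ler_norml; clear; lra.
Qed.

Lemma levy_step rho w x theta M : 0 < rho -> (forall y, `|w y| <= M) ->
  levy (fun t => sd w x (step rho t *: theta)).
Proof.
move=> rho0 wM; apply: (levy_away (r := rho) (M := 4 * M)) => //.
- exact: (measurable_step (fun q => sd w x (q *: theta))).
- by move=> t _; exact: sd_le4.
- by move=> t /andP[_ tr]; rewrite step_small// scale0r sd0.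
Qed.

Definition tailmass rho : R := levyI s (splice rho (fun=> 0) (fun=> 1)).

Lemma tailmass_ge0 rho : 0 <= tailmass rho.
Proof. by apply: levyI_ge0 => // t _; rewrite /splice; case: ifP. Qed.

(** With this time step the explicit scheme is monotone: the coefficient of [w x] in
    [w x + cfl rho * stepI rho w x theta] is [1 - 2 * cfl rho * tailmass rho]. *)
Definition cfl rho : R := rho / (1 + 2 * tailmass rho).

Lemma cfl_gt0 rho : 0 < rho -> 0 < cfl rho.
Proof. by move=> r0; rewrite divr_gt0//; have := tailmass_ge0 rho; lra. Qed.

Lemma cfl_le rho : 0 < rho -> cfl rho <= rho.
Proof.
move=> r0; have T0 := tailmass_ge0 rho; rewrite /cfl ler_pdivrMr; last by lra.
by apply: ler_peMr; [exact: ltW|lra].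
Qed.

Lemma cfl_monotone rho : 0 < rho <= 1 -> 2 * cfl rho * tailmass rho <= 1.
Proof.
move=> /andP[r0 r1]; have T0 := tailmass_ge0 rho.
have -> : 2 * cfl rho * tailmass rho = (rho * (2 * tailmass rho)) / (1 + 2 * tailmass rho).
  by rewrite /cfl; ring.
rewrite ler_pdivrMr; last by lra.
rewrite mul1r; apply: le_trans (_ : 1 * (2 * tailmass rho) <= _); last by lra.
by apply: ler_wpM2r => //; lra.
Qed.

(** Monotonicity in a form that serves three purposes: ordering two functions, and replacing [w] by
    an upper bound which is [b] at [x] and is described elsewhere through its second differences. *)
Lemma stepI_monotone rho w x theta M b G : 0 < rho <= 1 -> (forall y, `|w y| <= M) ->
  levy G -> w x <= b -> (forall t, 0 < t < rho -> 0 <= G t) ->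
  (forall t, rho <= t ->
     w (x + step rho t *: theta) + w (x - step rho t *: theta) - 2 * b <= G t) ->
  w x + cfl rho * stepI rho w x theta <= b + cfl rho * levyI s G.
Proof.
move=> r01 wM lG wb G0 HG; have /andP[r0 r1] := r01.
have h0 := cfl_gt0 r0; have cfl1 := cfl_monotone r01.
have lt1 : levy (splice rho (fun=> 0) (fun=> 1) : R -> R) by exact: levy_ge.
suff H : stepI rho w x theta <= levyI s G + 2 * (b - w x) * tailmass rho.
  apply: (@le_trans _ _ (w x + cfl rho * (levyI s G + 2 * (b - w x) * tailmass rho))).
    by rewrite lerD2l ler_pM2l.
  have : (b - w x) * (2 * cfl rho * tailmass rho) <= (b - w x) * 1.
    by rewrite ler_wpM2l// subr_ge0.
  by move=> ?; lra.
rewrite /tailmass -levyI_Z// -levyI_D//; last exact: levyZ.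
apply: levyI_le => //; first exact: (levy_step _ _ _ wM).
  by apply: levyD => //; exact: levyZ.
move=> t t0; rewrite /splice; have [tr|rt] := ltP t rho.
  by rewrite step_small// scale0r sd0 mulr0 addr0; apply: G0; rewrite t0.
by have := HG t rt; rewrite /sd; lra.
Qed.

Lemma stepI_le rho w1 w2 x theta M : 0 < rho <= 1 ->
  (forall y, `|w1 y| <= M) -> (forall y, `|w2 y| <= M) -> (forall y, w1 y <= w2 y) ->
  w1 x + cfl rho * stepI rho w1 x theta <= w2 x + cfl rho * stepI rho w2 x theta.
Proof.
move=> r01 w1M w2M w12; have /andP[r0 _] := r01.
apply: (stepI_monotone r01 w1M) => //; first exact: (levy_step _ _ _ w2M).
  by move=> t /andP[_ tr]; rewrite step_small// scale0r sd0.
by move=> t _; rewrite /sd; have := w12 (x + step rho t *: theta);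
  have := w12 (x - step rho t *: theta); lra.
Qed.

Lemma stepI_cst rho x theta (c : R) : stepI rho (fun=> c) x theta = 0.
Proof.
rewrite /stepI -[RHS](@levyI0 R s); apply: levyI_eq => t _.
by rewrite /sd; ring.
Qed.

Lemma stepI_addcst rho w x theta (c : R) : stepI rho (fun y => w y + c) x theta = stepI rho w x theta.
Proof. by apply: levyI_eq => t _; rewrite /sd; ring. Qed.

Lemma stepI_opp rho w x theta M : 0 < rho -> (forall y, `|w y| <= M) ->
  stepI rho (fun y => - w y) x theta = - stepI rho w x theta.
Proof.
move=> r0 wM; rewrite /stepI -levyI_N//; last exact: (levy_step _ _ _ wM).
by apply: levyI_eq => t _; rewrite /sd; ring.
Qed.

Lemma stepI_bounds rho w x theta M : 0 < rho <= 1 -> (forall y, `|w y| <= M) ->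
  - M <= w x + cfl rho * stepI rho w x theta <= M.
Proof.
move=> r01 wM; have wM' y : - M <= w y <= M by rewrite -ler_norml.
have M0 : 0 <= M := le_trans (normr_ge0 _) (wM x).
have cM (c : R) : `|c| = M -> forall y : 'rV[R]_N, `|(fun=> c) y| <= M by move=> <-.
apply/andP; split.
  have := @stepI_le rho (fun=> - M) w x theta M r01 (cM _ _) wM.
  rewrite stepI_cst mulr0 addr0; apply; first by rewrite normrN ger0_norm.
  by move=> y; case/andP: (wM' y).
have := @stepI_le rho w (fun=> M) x theta M r01 wM (cM _ _).
rewrite stepI_cst mulr0 addr0; apply; first by rewrite ger0_norm.
by move=> y; case/andP: (wM' y).
Qed.

End DiscreteOperator.

Section Scheme.
Context {R : realType} {N : nat} (s : R) (Omega : set 'rV[R]_N.+1) (u0 : 'rV[R]_N.+1 -> R) (M : R).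
Hypotheses (s01 : 0 < s < 1) (u0M : forall x, `|u0 x| <= M).
Implicit Types (rho : R) (x theta : 'rV[R]_N.+1).

(** Explicit Euler steps for the infimum over all directions, at the points where the stencil of the
    shortest length stays in the domain. *)
Fixpoint scheme rho n x : R :=
  if n is n'.+1 then
    if `[< eball x rho `<=` Omega >] then
      inf [set scheme rho n' x + cfl s rho * stepI s rho (scheme rho n') x theta | theta in usphere]
    else u0 x
  else u0 x.

Lemma scheme_bounded rho n x : 0 < rho <= 1 -> `|scheme rho n x| <= M.
Proof.
move=> r01; elim: n x => [x|n IH x]/=; first exact: u0M.
case: asboolP => _; last exact: u0M.
have [th0 sth0] := @usphere_nonempty R N.
have bd theta := @stepI_bounds _ _ _ s01 rho _ x theta M r01 IH.
rewrite ler_norml; apply/andP; split.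
  apply: lb_le_inf; first by eexists; exists th0.
  by move=> _ [th _ <-]; case/andP: (bd th).
apply: (@le_trans _ _ (scheme rho n x + cfl s rho * stepI s rho (scheme rho n) x th0)).
  apply: ge_inf; last by exists th0.
  by exists (- M) => _ [th _ <-]; case/andP: (bd th).
by case/andP: (bd th0).
Qed.

Lemma scheme_le rho n x theta : 0 < rho <= 1 -> eball x rho `<=` Omega -> usphere theta ->
  scheme rho n.+1 x <= scheme rho n x + cfl s rho * stepI s rho (scheme rho n) x theta.
Proof.
move=> r01 xO sth /=; case: asboolP => // _; apply: ge_inf; last by exists theta.
exists (- M) => _ [th _ <-].
have bd theta := @stepI_bounds _ _ _ s01 rho _ x theta M r01 (fun y => scheme_bounded n y r01).
by case/andP: (bd th).
Qed.

Lemma scheme_ge rho n x (e : R) : 0 < rho <= 1 -> eball x rho `<=` Omega -> 0 < e ->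
  exists2 theta, usphere theta &
  scheme rho n x + cfl s rho * stepI s rho (scheme rho n) x theta - e <= scheme rho n.+1 x.
Proof.
move=> r01 xO e0 /=; case: asboolP => // _.
have [th0 sth0] := @usphere_nonempty R N.
have bd theta := @stepI_bounds _ _ _ s01 rho _ x theta M r01 (fun y => scheme_bounded n y r01).
have [|_ [th sth <-] lt] := @inf_adherent R
  [set scheme rho n x + cfl s rho * stepI s rho (scheme rho n) x theta | theta in usphere] e e0.
  split; first by eexists; exists th0.
  by exists (- M) => _ [th _ <-]; case/andP: (bd th).
by exists th => //; apply/ltW; rewrite ltrBlDr.
Qed.

End Scheme.

(** The one-sided form of the scheme shared by it (with [Theta] any singleton, as the infimum is below
    each of its members) and by its opposite (with [Theta] the sphere, as the infimum is almost
    attained). Everything below is proved for [substep] and used twice. *)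
Definition substep {R : realType} {N : nat} (s : R) (Omega Theta : set 'rV[R]_N) (rho : R)
    (U : nat -> 'rV[R]_N -> R) : Prop :=
  forall n x, eball x rho `<=` Omega -> forall e : R, 0 < e -> exists2 theta, Theta theta &
    U n.+1 x <= U n x + cfl s rho * (stepI s rho (U n) x theta + e).

Lemma substep_scheme {R : realType} {N : nat} (s : R) (Omega : set 'rV[R]_N.+1) u0 (M rho : R) theta :
  0 < s < 1 -> (forall x, `|u0 x| <= M) -> 0 < rho <= 1 -> usphere theta ->
  substep s Omega [set theta] rho (scheme s Omega u0 rho).
Proof.
move=> s01 u0M r01 sth n x xO e e0; exists theta => //.
apply: (le_trans (scheme_le s01 u0M n r01 xO sth)).
have /andP[r0 _] := r01; have := mulr_gt0 (cfl_gt0 s r0) e0; clear; lra.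
Qed.

Lemma substep_schemeN {R : realType} {N : nat} (s : R) (Omega : set 'rV[R]_N.+1) u0 (M rho : R) :
  0 < s < 1 -> (forall x, `|u0 x| <= M) -> 0 < rho <= 1 ->
  substep s Omega usphere rho (fun n x => - scheme s Omega u0 rho n x).
Proof.
move=> s01 u0M r01 n x xO e e0; have /andP[r0 _] := r01.
have [th sth le] := scheme_ge s01 u0M n r01 xO (mulr_gt0 (cfl_gt0 s r0) e0).
exists th => //; rewrite (stepI_opp s01 x th r0 (fun y => scheme_bounded Omega s01 u0M n y r01)).
by clear -le; lra.
Qed.

(** Discrete comparison with a barrier: by monotonicity each step raises the bound by [C] times the
    time step at most. *)
Lemma substep_barrier {R : realType} {N : nat} (s : R) (Omega Theta : set 'rV[R]_N)
    (U : nat -> 'rV[R]_N -> R) psi (rho M C : R) :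
  0 < s < 1 -> 0 < rho <= 1 -> substep s Omega Theta rho U -> 0 <= C ->
  (forall n x, `|U n x| <= M) -> (forall x, `|psi x| <= M) ->
  (forall x, U 0 x <= psi x) -> (forall n x, ~ (eball x rho `<=` Omega) -> U n x <= psi x) ->
  (forall x theta, eball x rho `<=` Omega -> Theta theta -> stepI s rho psi x theta <= C) ->
  forall n x, U n x <= psi x + C * (cfl s rho * n%:R).
Proof.
move=> s01 r01 US C0 UM psiM U0 Uout psiC n; have /andP[r0 _] := r01.
have h0 := cfl_gt0 s r0.
elim: n => [x|n IH x]; first by rewrite !mulr0 addr0.
have [xO|xO] := pselect (eball x rho `<=` Omega); last first.
  by apply: le_trans (Uout _ _ xO) _; rewrite lerDl; apply: mulr_ge0 => //; apply: mulr_ge0 => //; exact: ltW.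
apply/ler_addgt0Pr => e e0.
have [theta Th le] := US n x xO (e / cfl s rho) (divr_gt0 e0 h0).
set c := C * (cfl s rho * n%:R).
have c0 : 0 <= c by apply: mulr_ge0 => //; apply: mulr_ge0 => //; exact: ltW.
have psiM' y : `|psi y + c| <= M + c.
  by apply: le_trans (ler_normD _ _) _; rewrite (ger0_norm c0) lerD2r.
have UM' y : `|U n y| <= M + c by apply: le_trans (UM n y) _; rewrite lerDl.
have := stepI_le s01 x theta r01 UM' psiM' IH.
rewrite stepI_addcst => H.
have HC : cfl s rho * stepI s rho psi x theta <= cfl s rho * C by rewrite ler_pM2l// psiC.
have Ee : cfl s rho * (e / cfl s rho) = e by field; rewrite gt_eqF.
have -> : C * (cfl s rho * n.+1%:R) = c + cfl s rho * C by rewrite /c -natr1; ring.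
by clear -H HC Ee le; lra.
Qed.

(** * Relaxed upper limits *)

(** Sequential compactness without subsequences: a family of approximate solutions [D e], for every
    precision [e], has approximate solutions of every precision near a single point. *)
Lemma compact_selection {R : realType} {T : topologicalType} (K : set T) (D : R -> T -> Prop) :
  compact K -> (forall e e' y, e <= e' -> D e y -> D e' y) ->
  (forall e, 0 < e -> exists2 y, K y & D e y) ->
  exists2 p, K p & forall B, nbhs p B -> forall e, 0 < e -> exists2 y, B y & D e y.
Proof.
move=> cK Dmono Dex.
have /choice[y_ Hy] : forall n : nat, exists y, K y /\ D (n.+1%:R^-1) y.
  move=> n; have [|y Ky Dy] := Dex (n.+1%:R^-1); first by rewrite invr_gt0.
  by exists y.
have FK : \forall n \near \oo, K (y_ n) by apply: nearW => n; case: (Hy n).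
have [p [Kp clp]] := cK (y_ @ \oo) _ FK.
exists p => // B pB e e0.
have FD : \forall n \near \oo, [set y | D e y] (y_ n).
  near=> n; have [_] := Hy n; apply: Dmono; apply/ltW.
  by near: n; exact: near_infty_natSinv_lt (PosNum e0).
by have [y [Dy By]] := clp _ _ FD pB; exists y.
Unshelve. all: by end_near. Qed.

Lemma prod_modulus {R : realType} {N : nat} (f : 'rV[R]_N * R -> R) z (e : R) :
  continuous f -> 0 < e -> exists2 d : R, 0 < d &
  forall y, `|y.1 - z.1| < d -> `|y.2 - z.2| < d -> `|f y - f z| < e.
Proof.
move=> cf e0; have /cvgrPdist_lt/(_ _ e0)/nbhs_prodP[d d0 H] := cf z.
by exists d => // y y1 y2; rewrite distrC; exact: H.
Qed.

Section UpperLimit.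
Context {R : realType} {N : nat} (w : nat -> 'rV[R]_N * R -> R) (M : R).
Hypothesis wM : forall k z, `|w k z| <= M.

Definition eventually_le z (c : R) := exists2 e : R, 0 < e &
  forall k y, k.+1%:R^-1 < e -> `|y.1 - z.1| < e -> `|y.2 - z.2| < e -> w k y <= c.

(** The half-relaxed limit of [w], the upper limit over [k] tending to infinity and points tending
    to [z] together. *)
Definition upper_limit z : R := inf [set c | eventually_le z c].

Let inhabited z : eventually_le z M.
Proof.
by exists 1 => // k y _ _ _; have := wM k y; rewrite ler_norml => /andP[].
Qed.

Let lower z c : eventually_le z c -> - M <= c.
Proof.
move=> [e e0 H]; have := near_infty_natSinv_lt (PosNum e0) => -[k _ Hk].
have := H k z (Hk k (leqnn k)); rewrite !subrr !normr0 => /(_ e0 e0).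
by have := wM k z; rewrite ler_norml => /andP[H1 _] H2; exact: le_trans H1 H2.
Qed.

Lemma upper_limit_ge z (e : R) : 0 < e -> eventually_le z (upper_limit z + e).
Proof.
move=> e0; have [|c Hc /ltW lt] := @inf_adherent R [set c | eventually_le z c] e e0.
  by split; [exists M; exact: inhabited|exists (- M) => c /lower].
by have [d d0 Hd] := Hc; exists d => // k y *; apply: le_trans lt; exact: Hd.
Qed.

Lemma upper_limit_le z c : eventually_le z c -> upper_limit z <= c.
Proof. by move=> H; apply: ge_inf => //; exists (- M) => d /lower. Qed.

Lemma upper_limit_adherent z (e d : R) : 0 < e -> 0 < d -> exists k y,
  [/\ k.+1%:R^-1 < d, `|y.1 - z.1| < d, `|y.2 - z.2| < d & upper_limit z - e < w k y].
Proof.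
move=> e0 d0; apply: contrapT => H.
suff /upper_limit_le : eventually_le z (upper_limit z - e) by lra.
exists d => // k y kd y1 y2; rewrite leNgt; apply/negP => lt.
by apply: H; exists k, y.
Qed.

Lemma upper_limit_bounded z : `|upper_limit z| <= M.
Proof.
rewrite ler_norml; apply/andP; split; last by apply: upper_limit_le; exact: inhabited.
by apply: lb_le_inf; [exists M; exact: inhabited|move=> c /lower].
Qed.

Lemma upper_limit_usc z c : upper_limit z < c -> \forall y \near z, upper_limit y < c.
Proof.
move=> zc; pose e := (c - upper_limit z) / 2; have e0 : 0 < e by rewrite /e; lra.
have [d d0 Hd] := upper_limit_ge z e0; have d2 : 0 < d / 2 by lra.
apply/nbhs_prodP; exists (d / 2) => // y y1 y2.
apply: (@le_lt_trans _ _ (upper_limit z + e)); last by rewrite /e; lra.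
apply: upper_limit_le; exists (d / 2) => // k y' kd y1' y2'; apply: Hd.
- by apply: lt_le_trans kd _; lra.
- by rewrite -(subrKA y.1); apply: le_lt_trans (ler_normD _ _) _; lra.
- by rewrite -(subrKA y.2); apply: le_lt_trans (ler_normD _ _) _; lra.
Qed.

(** Near maximizers of [w k - P] accumulate only at points where the relaxed limit of [w - P] is
    at least its value at [z0], hence only at a strict maximum point. *)
Lemma upper_limit_localize P (K : set ('rV[R]_N * R)) z0 (h : nat -> R) :
  continuous P -> compact K -> nbhs z0 K -> (forall k, 0 < h k) ->
  (forall y, K y -> upper_limit z0 - P z0 <= upper_limit y - P y -> y = z0) ->
  forall e : R, 0 < e -> exists k y,
  [/\ k.+1%:R^-1 < e /\ K y, `|y.1 - z0.1| < e, `|y.2 - z0.2| < e,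
      forall y', K y' -> w k y' - P y' <= w k y - P y + h k
    & upper_limit z0 - P z0 - e <= w k y - P y].
Proof.
move=> cP cK /[dup] nK /nbhs_prodP[rK rK0 HK] h0 strict.
pose D (e : R) y := exists k, [/\ k.+1%:R^-1 < e /\ K y,
   forall y', K y' -> w k y' - P y' <= w k y - P y + h k
   & upper_limit z0 - P z0 - e <= w k y - P y].
have Dmono e e' y : e <= e' -> D e y -> D e' y.
  move=> ee [k [[ke Ky] H1 H2]]; exists k; split => //; first by split => //; exact: lt_le_trans ee.
  by apply: le_trans H2; clear -ee; lra.
have [C C0 PC] := compact_bound cK cP.
have Dex e : 0 < e -> exists2 y, K y & D e y.
  move=> e0; have e4 : 0 < e / 4 by lra.
  have [d d0 Hd] := prod_modulus z0 cP e4.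
  pose dd := Num.min (Num.min d rK) e.
  have dd0 : 0 < dd by rewrite !lt_min d0 rK0.
  have [k [y [kd y1 y2 wy]]] := upper_limit_adherent z0 e4 dd0.
  move: kd y1 y2; rewrite !lt_min => /andP[_ ke] /andP[/andP[y1 y1K] _] /andP[/andP[y2 y2K] _].
  have Ky := HK y y1K y2K; have Py := Hd y y1 y2.
  pose S := [set w k y' - P y' | y' in K].
  have hS : has_sup S.
    split; first by eexists; exists y.
    exists (M + C) => _ [y' Ky' <-]; have := wM k y'; have := PC y' Ky'.
    by rewrite !ler_norml; clear; lra.
  have t0 : 0 < Num.min (h k) (e / 4) by rewrite lt_min h0.
  have [_ [y' Ky' <-] lt] := sup_adherent t0 hS.
  have Sub y'' : K y'' -> w k y'' - P y'' <= sup S.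
    by move=> K''; apply: sup_ubound; [case: hS|exists y''].
  have [m1 m2] : Num.min (h k) (e / 4) <= h k /\ Num.min (h k) (e / 4) <= e / 4.
    by rewrite !ge_min !lexx orbT.
  exists y' => //; exists k; split => //.
    by move=> y'' /Sub; clear -lt m1; lra.
  have := Sub y Ky; move: Py; rewrite ltr_norml; clear -wy lt m2; lra.
have [p Kp Hp] := compact_selection cK Dmono Dex.
have pz0 : p = z0.
  apply: strict => //; apply/ler_addgt0Pr => e e0; have e4 : 0 < e / 4 by lra.
  have [d d0 Hd] := prod_modulus p cP e4.
  have [d' d0' Hd'] := upper_limit_ge p e4.
  pose m := Num.min (Num.min d d') (e / 4); have m0 : 0 < m by rewrite !lt_min d0 d0'.
  have [|y [y1 y2] [k [[km Ky] _ H]]] := Hp [set y | `|y.1 - p.1| < m /\ `|y.2 - p.2| < m] _ m m0.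
    by apply/nbhs_prodP; exists m.
  move: km y1 y2; rewrite !lt_min => /andP[/andP[_ k1] _] /andP[/andP[y1 y1'] _] /andP[/andP[y2 y2'] _].
  have := Hd y y1 y2; have := Hd' k y k1 y1' y2'; rewrite ltr_norml.
  have : m <= e / 4 by rewrite /m ge_min lexx orbT.
  by clear -H; lra.
move=> e e0.
have [|y [y1 y2] [k [kK Hk1 Hk2]]] := Hp [set y | `|y.1 - p.1| < e /\ `|y.2 - p.2| < e] _ e e0.
  by apply/nbhs_prodP; exists e.
by exists k, y; rewrite -pz0; split => //; rewrite pz0.
Qed.

End UpperLimit.

(** * Test inequalities at near maximizers of the scheme *)

(** What the scheme inequality at a near maximizer leaves of the sampled integral: below [d] the
    second differences of [f] and of the penalty [a * dist2], beyond [d] those of [u] with the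
    value at the centre replaced by [b]. *)
Definition test_integrand {R : realType} {N : nat} (rho d a b : R) (f u : 'rV[R]_N -> R) (x theta : 'rV[R]_N) : R -> R :=
  splice rho (fun=> 0) (splice d
    (fun t => sd f x (step rho t *: theta) + 2 * a * enorm (step rho t *: theta) ^+ 2)
    (fun t => u (x + step rho t *: theta) + u (x - step rho t *: theta) - 2 * b)).

Lemma measurable_test_integrand {R : realType} {N : nat} (rho d a b : R) (f u : 'rV[R]_N -> R) x theta : 0 < rho ->
  measurable_fun (`]0, +oo[%classic : set R) (test_integrand rho d a b f u x theta).
Proof.
move=> r0; apply: measurable_splice; first exact: measurable_cst.
apply: measurable_splice.
  exact: (measurable_step (fun q => sd f x (q *: theta) + 2 * a * enorm (q *: theta) ^+ 2)).
exact: (measurable_step (fun q => u (x + q *: theta) + u (x - q *: theta) - 2 * b)).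
Qed.

Lemma enorm_step {R : realType} {N : nat} (rho t : R) (theta : 'rV[R]_N) : 0 < rho -> 0 <= t -> usphere theta ->
  enorm (step rho t *: theta) <= t.
Proof.
move=> r0 t0 sth; rewrite enormZ sth mulr1 ger0_norm; first exact: step_le.
exact: step_ge0.
Qed.

(** Uniform in [rho], [a], [b] and the base point, as dominated convergence requires. *)
Lemma test_integrand_bound {R : realType} {N : nat} (M rho d a b C B : R) (f u : 'rV[R]_N -> R) x theta : 0 < rho -> 0 < d <= 1 ->
  0 <= a <= 1 -> `|b| <= B -> 0 <= C -> usphere theta -> (forall y, `|u y| <= M) ->
  (forall v, enorm v <= d -> `|sd f x v| <= C * enorm v ^+ 2) ->
  forall t, 0 < t -> `|test_integrand rho d a b f u x theta t| <=
    (C + 2 + (2 * M + 2 * B) / d ^+ 2) * cap t.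
Proof.
move=> r0 /andP[d0 d1] /andP[a0 a1] bB C0 sth uM fC t t0.
have M0 : 0 <= M := le_trans (normr_ge0 _) (uM 0).
have B0 : 0 <= B := le_trans (normr_ge0 _) bB.
have d20 : 0 < d ^+ 2 by rewrite exprn_gt0.
have E0 : 0 <= (2 * M + 2 * B) / d ^+ 2.
  by apply: divr_ge0; [clear -M0 B0; lra|exact: ltW].
have capt := cap_ge0 t.
rewrite /test_integrand /splice; case: ltP => _.
  by rewrite normr0 mulr_ge0//; clear -C0 E0; lra.
set v := step rho t *: theta.
have vt : enorm v <= t by apply: enorm_step => //; exact: ltW.
have v0 := enorm_ge0 v.
have [td|dt] := ltP t d.
  rewrite (cap_sqr (le_trans (ltW td) d1) t0).
  have v2 : enorm v ^+ 2 <= t ^+ 2 by rewrite lerXn2r// ?nnegrE// ltW.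
  have H1 : `|sd f x v| <= C * t ^+ 2.
    by apply: le_trans (fC v (le_trans vt (ltW td))) _; rewrite ler_wpM2l.
  have H2 : `|2 * a * enorm v ^+ 2| <= 2 * t ^+ 2.
    rewrite ger0_norm ?mulr_ge0// ?sqr_ge0//; apply: ler_pM => //.
    - by rewrite mulr_ge0.
    - exact: sqr_ge0.
    - by clear -a1; lra.
  apply: le_trans (ler_normD _ _) _; apply: (le_trans (lerD H1 H2)).
  by rewrite -mulrDl ler_wpM2r ?sqr_ge0//; clear -E0; lra.
apply: (@le_trans _ _ (2 * M + 2 * B)).
  have := uM (x + v); have := uM (x - v); move: bB.
  by rewrite !ler_norml; clear; lra.
have capd : d ^+ 2 <= cap t.
  rewrite /cap le_min; apply/andP; split; first by rewrite exprn_ile1// ltW.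
  by rewrite lerXn2r// nnegrE ltW.
apply: (@le_trans _ _ ((2 * M + 2 * B) / d ^+ 2 * d ^+ 2)); first by rewrite divfK// gt_eqF.
apply: ler_pM => //; first exact: ltW.
by clear -C0; lra.
Qed.

(** The information gathered, for the precision [e], at a near maximizer: [k] is the index in the
    sequence, [x] and [q] the place and the time at which the scheme is evaluated, [c] the time
    of the mean value, [a] the strength of the penalty, and [b] an upper bound for the value at
    the centre. *)
Definition test_data {R : realType} {N : nat} (s : R) (w : nat -> 'rV[R]_N * R -> R) (M : R)
    (phi : 'rV[R]_N * R -> R) (x0 : 'rV[R]_N) (t0 U0 d e : R) (theta : 'rV[R]_N) : Prop :=
  exists k x q c a b, [/\ k.+1%:R^-1 < e, `|x - x0| < e, `|q - t0| < e & `|c - t0| < e] /\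
    [/\ 0 <= a <= 1, a <= e, U0 - e <= b, `|b| <= M + 1
      & 'D_((0, 1) : 'rV[R]_N * R) phi (x, c) <= e +
         levyI s (test_integrand k.+1%:R^-1 d a b (slice phi q) (slice (w k) q) x theta)].

Lemma test_data_le {R : realType} {N : nat} (s : R) w M phi (x0 : 'rV[R]_N) (t0 U0 d e e' : R) theta : e <= e' ->
  test_data s w M phi x0 t0 U0 d e theta -> test_data s w M phi x0 t0 U0 d e' theta.
Proof.
move=> ee [k [x [q [c [a [b [[H1 H2 H3 H4] [H5 H6 H7 H8 H9]]]]]]]].
exists k, x, q, c, a, b; split; split => //; [exact: lt_le_trans ee..| | |].
- exact: le_trans ee.
- by clear -H7 ee; lra.
- by apply: le_trans H9 _; rewrite lerD2r.
Qed.

Lemma derive_addquad {R : realType} {N : nat} (phi : 'rV[R]_N * R -> R) c0 (a : R) x t : smooth phi ->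
  'D_((0, 1) : 'rV[R]_N * R) (fun z => phi z + quad c0 a 0 z) (x, t) =
  'D_((0, 1) : 'rV[R]_N * R) phi (x, t) + 2 * a * (t - c0.2).
Proof.
move=> sphi; have := derive_quad c0 a 0 x t; rewrite addr0 => <-; rewrite -deriveD//.
- by have [_ + _] := sphi 1%N; exact.
- by have [_ + _] := smooth_quad c0 a 0 1%N; exact.
Qed.

(** The function [P], equal to [phi] plus a small paraboloid, touches the relaxed limit at a strict
    maximum. At a near maximizer [(x, t)] of [w k - P] the scheme inequality, in which the
    earlier value [w k (x, t - h)] is replaced by the bound [b] of [stepI_monotone], bounds the
    increment of [P] over one time step; the mean value theorem turns it into a derivative. *)
Lemma test_data_exists {R : realType} {N : nat} (s : R) (w : nat -> 'rV[R]_N * R -> R) (M : R)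
    (Omega Theta : set 'rV[R]_N) phi x0 (t0 d r : R) :
  0 < s < 1 -> (forall k z, `|w k z| <= M) ->
  Theta `<=` usphere ->
  (forall k x t, cfl s k.+1%:R^-1 <= t -> eball x k.+1%:R^-1 `<=` Omega ->
    exists2 theta, Theta theta & w k (x, t) <= w k (x, t - cfl s k.+1%:R^-1) +
      cfl s k.+1%:R^-1 * (stepI s k.+1%:R^-1 (slice (w k) (t - cfl s k.+1%:R^-1)) x theta
                          + k.+1%:R^-1)) ->
  smooth phi -> 0 < r -> r < t0 -> r <= 1 -> 0 < d -> d <= r / 2 ->
  (forall y, `|y - x0| <= r -> Omega y) ->
  (forall y, `|y.1 - x0| <= r -> `|y.2 - t0| <= r ->
     upper_limit w y - phi y <= upper_limit w (x0, t0) - phi (x0, t0)) ->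
  forall e, 0 < e -> exists2 theta, Theta theta &
    test_data s w M phi x0 t0 (upper_limit w (x0, t0)) d e theta.
Proof.
move=> s01 wM subTheta scheme_w sphi r0 rt0 r1 d0 dr rO touch e e0.
have [C C0 HC] := sd_quadratic_bound x0 t0 r r sphi.
pose a := Num.min (e / 8) 1.
have a0 : 0 < a by rewrite /a lt_min ltr01 andbT; clear -e0; lra.
have [ae a1] : a <= e / 8 /\ a <= 1 by rewrite !ge_min !lexx orbT.
pose P z := phi z + quad (x0, t0) a 0 z.
have sP : smooth P by apply: smoothD => //; exact: smooth_quad.
have cP : continuous P := Ck_cont (sP 0%N).
have e80 : 0 < Num.min (e / 8) (1 / 8) by rewrite lt_min; clear -e0; lra.
have [dm dm0 Hdm] := prod_modulus (x0, t0) cP e80.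
pose K := [set z : 'rV[R]_N * R | `|z.1 - x0| <= r /\ `|z.2 - t0| <= r].
have cK : compact K by exact: compact_cylinder.
have nK : nbhs (x0, t0) K.
  by apply/nbhs_prodP; exists r => // y /ltW y1 /ltW y2.
pose h k := cfl s (k.+1%:R^-1 : R).
have h0 k : 0 < h k by apply: cfl_gt0; rewrite invr_gt0.
have hk k : h k <= k.+1%:R^-1 by apply: cfl_le; rewrite invr_gt0.
have strict y : K y -> upper_limit w (x0, t0) - P (x0, t0) <= upper_limit w y - P y ->
    y = (x0, t0).
  move=> [y1 y2]; have := touch y y1 y2; rewrite /P /quad dist2xx !mul0r !mulr0 !addr0 => H1 H2.
  have D0 := dist2_ge0 y (x0, t0).
  have Dy : dist2 y (x0, t0) <= 0 ^+ 2 by rewrite expr0n /= -(ler_pM2l a0); clear -H1 H2; lra.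
  have [] := dist2_small (lexx 0) Dy; rewrite !normr_le0 !subr_eq0 => /eqP E1 /eqP E2.
  by rewrite (surjective_pairing y) E1 E2.
pose e' := Num.min (Num.min (e / 8) (dm / 2)) (r / 4).
have e'0 : 0 < e' by rewrite /e' !lt_min; clear -e0 dm0 r0; lra.
have [e'e e'd e'r] : [/\ e' <= e / 8, e' <= dm / 2 & e' <= r / 4].
  by rewrite /e' !ge_min !lexx ?orbT.
have ha0 k : 0 < h k * a by rewrite mulr_gt0.
have [k [[x t] /= [[ke [/= Kx Kt]] xe te near_max low]]] :=
  upper_limit_localize wM cP cK nK ha0 strict e'0.
set rho : R := k.+1%:R^-1 in ke.
have rho0 : 0 < rho by rewrite invr_gt0.
have rho1 : 0 < rho <= 1 by rewrite rho0 /=; clear -ke e'r r1; lra.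
have hrho : h k <= rho := hk k.
have hk0 := h0 k.
pose q := t - h k.
have qt0 : `|q - t0| < 2 * e'.
  by move: te; rewrite /q !ltr_norml; clear -hrho ke hk0; lra.
have ht : h k <= t by move: te; rewrite ltr_norml; clear -hrho ke e'r rt0 r0; lra.
have xO : eball x rho `<=` Omega.
  move=> y yx; apply: rO; rewrite -(subrKA x); apply: le_trans (ler_normD _ _) _.
  have := le_lt_trans (norm_le_enorm _) yx; clear -xe ke e'r r0; lra.
have [theta Th] := scheme_w k x t ht xO.
rewrite -/rho -/(h k) -/q => step_w; exists theta => //.
have sth := subTheta _ Th.
have [c' /andP[c'0 c'h] Hc'] := MVT_line (x, q) (0, 1) (sP 1%N) hk0.
have Eq (c : R) : (x, q) + c *: ((0, 1) : 'rV[R]_N * R) = (x, q + c).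
  by congr (_, _); rewrite /= ?scaler0 ?addr0// /GRing.scale /= mulr1.
move: Hc'; rewrite !Eq derive_addquad//= {2}/q subrK => Hc'.
pose b := P (x, q) + w k (x, t) - P (x, t) + h k * a.
have near_P y : `|y.1 - x0| < dm -> `|y.2 - t0| < dm ->
    `|P y - P (x0, t0)| < e / 8 /\ `|P y - P (x0, t0)| < 1 / 8.
  by move=> y1 y2; have := Hdm y y1 y2; rewrite lt_min => /andP[].
have [|| Pq1 Pq2] := near_P (x, q); [by clear -xe e'd e'0; rewrite /=; lra|by clear -qt0 e'd; rewrite /=; lra|].
have [|| Pt1 Pt2] := near_P (x, t); [by clear -xe e'd e'0; rewrite /=; lra|by clear -te e'd e'0; rewrite /=; lra|].
have ha1 : h k * a <= h k by apply: ler_piMr => //; exact: ltW.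
have b_le : `|b| <= M + 1.
  have := wM k (x, t); move: Pq2 Pt2; rewrite /b !ltr_norml !ler_norml.
  by have := ha0 k; clear -ha1 hrho ke e'r r1; lra.
have b_ge : upper_limit w (x0, t0) - e <= b.
  move: Pq1; rewrite /b !ltr_norml; have := ha0 k; move: low; clear -e'e e0; lra.
exists k, x, (t - h k), (q + c'), a, b; rewrite -/rho -/q.
have levy_g : levy (test_integrand rho d a b (slice phi q) (slice (w k) q) x theta).
  split; first exact: measurable_test_integrand.
  exists (C + 2 + (2 * M + 2 * (M + 1)) / d ^+ 2) => t' t'0.
  apply: test_integrand_bound => //.
  - by rewrite d0; clear -dr r1; lra.
  - by rewrite (ltW a0).
  - by move=> y; exact: wM.
  - move=> v vd; apply: HC.
    + by clear -xe e'r r0; lra.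
    + by clear -qt0 e'r r0; lra.
    + by apply: le_trans (norm_le_enorm v) _; clear -vd dr r0; lra.
have wb : slice (w k) q x <= b.
  have Kq : K (x, q) by split => /=; [exact: Kx|clear -qt0 e'r r0; lra].
  by have := near_max _ Kq; rewrite /slice /b; clear; lra.
have main : slice (w k) q x + cfl s rho * stepI s rho (slice (w k) q) x theta <= b +
    cfl s rho * levyI s (test_integrand rho d a b (slice phi q) (slice (w k) q) x theta).
  apply: (stepI_monotone s01 rho1 (M := M)) => //; first by move=> y; exact: wM.
    by move=> t' /andP[_ t'r]; rewrite /test_integrand /splice t'r.
  move=> t' rt'; rewrite /test_integrand /splice [t' < rho]ltNge rt' /=.
  have t'0 : 0 <= t' by apply: le_trans rt'; exact: ltW.
  have [t'd|//] := ltP t' d.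
  set v := step rho t' *: theta.
  have vt' : `|v| <= t' by apply: le_trans (norm_le_enorm v) _; exact: enorm_step.
  have Kv v' : `|v'| <= t' -> K (x + v', q).
    move=> v't; split => /=; last by clear -qt0 e'r r0; lra.
    by rewrite addrAC; apply: le_trans (ler_normD _ _) _; clear -v't t'd dr xe e'r r0; lra.
  have := near_max _ (Kv v vt'); have := near_max _ (Kv (- v) (ltac:(by rewrite normrN))).
  have := @sd_quad R N (x0, t0) a 0 x q v.
  by rewrite /b /P /sd /slice; clear; lra.
split; split => //.
- by clear -ke e'e e0; lra.
- by clear -xe e'e e0; lra.
- by clear -qt0 e'e e0; lra.
- by move: te; rewrite /q !ltr_norml; clear -c'0 c'h hrho ke e'e e0; lra.
- by rewrite (ltW a0).
- by clear -ae e0; lra.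
rewrite -(ler_pM2l hk0).
have qc : `|q + c' - t0| <= 1.
  by move: te; rewrite /q ltr_norml ler_norml; clear -c'0 c'h hrho ke e'r r1 r0; lra.
have B1 : - (2 * a) <= 2 * a * (q + c' - t0).
  move: qc; rewrite ler_norml => /andP[+ _] => /(ler_wpM2l (ltW a0)); clear; lra.
have B2 : h k * (- (2 * a)) <= h k * (2 * a * (q + c' - t0)) by rewrite ler_pM2l.
have B3 : h k * a <= h k * (e / 8) by rewrite ler_pM2l.
have B4 : h k * rho <= h k * (e / 8) by rewrite ler_pM2l//; clear -ke e'e; lra.
have B5 : 0 < h k * e by rewrite mulr_gt0.
move: step_w main Hc'; rewrite /b /slice -/(h k); clear -B2 B3 B4 B5; lra.
Qed.

(** * The relaxed limit of the scheme satisfies the test inequality *)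

Lemma near_norm_lt {R : realType} {V : normedModType R} (x : V) (e : R) : 0 < e ->
  nbhs x [set y | `|y - x| < e].
Proof.
by move=> e0; apply/nbhs_normP; exists e => //= y; rewrite /ball_ /= distrC.
Qed.

Lemma splice_sd_bound {R : realType} {N : nat} (M d C : R) (f u : 'rV[R]_N -> R) x theta :
  0 < d <= 1 -> 0 <= C -> usphere theta -> (forall y, `|u y| <= M) ->
  (forall v, enorm v <= d -> `|sd f x v| <= C * enorm v ^+ 2) ->
  forall t, 0 < t -> `|splice d (fun t => sd f x (t *: theta)) (fun t => sd u x (t *: theta)) t| <=
    (C + 4 * M / d ^+ 2) * cap t.
Proof.
move=> /andP[d0 d1] C0 sth uM fC t t0.
have M0 : 0 <= M := le_trans (normr_ge0 _) (uM 0).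
have d20 : 0 < d ^+ 2 by rewrite exprn_gt0.
have E0 : 0 <= 4 * M / d ^+ 2 by apply: divr_ge0; [clear -M0; lra|exact: ltW].
rewrite /splice; have [td|dt] := ltP t d.
  rewrite (cap_sqr (le_trans (ltW td) d1) t0).
  have et : enorm (t *: theta) = t by rewrite enormZ sth mulr1 gtr0_norm.
  apply: (@le_trans _ _ (C * t ^+ 2)).
    by have := fC (t *: theta); rewrite et => /(_ (ltW td)).
  by rewrite ler_wpM2r ?sqr_ge0//; clear -E0; lra.
apply: le_trans (sd_le4 x _ uM) _.
have capd : d ^+ 2 <= cap t.
  rewrite /cap le_min; apply/andP; split; first by rewrite exprn_ile1// ltW.
  by rewrite lerXn2r// nnegrE ltW.
apply: (@le_trans _ _ (4 * M / d ^+ 2 * d ^+ 2)); first by rewrite divfK// gt_eqF.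
apply: ler_pM => //; first exact: ltW.
by clear -C0; lra.
Qed.

Lemma stepped_point_near {R : realType} {N : nat} (rho t e : R) (x x0 theta theta0 : 'rV[R]_N) (sg : R) :
  0 < rho -> 0 < t -> rho <= e -> usphere theta -> `|x - x0| < e -> `|theta - theta0| < e ->
  `|sg| = 1 -> `|(x + sg *: (step rho t *: theta)) - (x0 + sg *: (t *: theta0))| < (2 + t) * e.
Proof.
move=> r0 t0 re sth xe the sg1.
have -> : (x + sg *: (step rho t *: theta)) - (x0 + sg *: (t *: theta0)) =
    (x - x0) + (sg *: ((step rho t - t) *: theta) + sg *: (t *: (theta - theta0))).
  by apply/rowP => i; rewrite !mxE; ring.
have H1 : `|sg *: ((step rho t - t) *: theta)| <= e.
  rewrite !normrZ sg1 mul1r; apply: le_trans re.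
  have st : `|step rho t - t| <= rho.
    have := step_gt t r0; have := step_le r0 (ltW t0); rewrite ler_norml; clear; lra.
  rewrite -[leRHS]mulr1; apply: ler_pM => //; exact: usphere_norm.
have H2 : `|sg *: (t *: (theta - theta0))| <= t * e.
  by rewrite !normrZ sg1 mul1r gtr0_norm// ler_wpM2l// ltW.
apply: le_lt_trans (ler_normD _ _) _.
have := ler_normD (sg *: ((step rho t - t) *: theta)) (sg *: (t *: (theta - theta0))).
by clear -H1 H2 xe; lra.
Qed.

(** The relaxed limit of the scheme satisfies the viscosity inequality for one direction in [Theta]:
    the directions at the near maximizers accumulate at some [theta], and Fatou's lemma bounds the
    upper limit of the sampled integrals. With a singleton [Theta] this is the subsolution
    property for that direction; with the whole sphere, applied to the opposite of the scheme,
    it is the supersolution property. *)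
Lemma upper_limit_test {R : realType} {N : nat} (s : R) (w : nat -> 'rV[R]_N * R -> R) (M : R)
    (Omega Theta : set 'rV[R]_N) :
  0 < s < 1 -> (forall k z, `|w k z| <= M) -> compact Theta ->
  Theta `<=` usphere ->
  (forall k x t, cfl s k.+1%:R^-1 <= t -> eball x k.+1%:R^-1 `<=` Omega ->
    exists2 theta, Theta theta & w k (x, t) <= w k (x, t - cfl s k.+1%:R^-1) +
      cfl s k.+1%:R^-1 * (stepI s k.+1%:R^-1 (slice (w k) (t - cfl s k.+1%:R^-1)) x theta
                          + k.+1%:R^-1)) ->
  forall phi, smooth phi -> forall x0 t0 delta, 0 < t0 -> 0 < delta ->
    cylinder x0 t0 delta `<=` Omega `*` `]0, +oo[ ->
    (forall z, cylinder x0 t0 delta z ->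
       upper_limit w z - phi z <= upper_limit w (x0, t0) - phi (x0, t0)) ->
  exists2 theta, Theta theta & 'D_((0, 1) : 'rV[R]_N * R) phi (x0, t0) <=
    testJ s delta (slice phi t0) (slice (upper_limit w) t0) x0 theta.
Proof.
move=> s01 wM cTheta subTheta scheme_w phi sphi x0 t0 delta t00 delta0 sub touch.
set U := upper_limit w.
have UM z : `|U z| <= M by exact: upper_limit_bounded.
have M0 : 0 <= M := le_trans (normr_ge0 _) (UM (x0, t0)).
have cphi : continuous phi := Ck_cont (sphi 0%N).
have [_ _ /(_ (0, 1)) cDphi] := sphi 1%N.
pose r := Num.min (Num.min (delta / N.+2%:R) (t0 / 2)) 1.
have N2 : 0 < N.+2%:R :> R by rewrite ltr0n.
have r0 : 0 < r by rewrite /r !lt_min ltr01 !divr_gt0.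
have [rd rt r1] : [/\ r <= delta / N.+2%:R, r <= t0 / 2 & r <= 1].
  by rewrite /r !ge_min !lexx ?orbT.
have rdelta : r < delta.
  apply: (le_lt_trans rd); rewrite ltr_pdivrMr// ltr_pMr// ltr1n//.
have cyl y : `|y.1 - x0| <= r -> `|y.2 - t0| <= r -> cylinder x0 t0 delta y.
  case: y => y q /= y1 y2; split => /=; last first.
    by rewrite in_itv/=; move: y2; rewrite ler_norml; clear -rdelta; lra.
  apply: le_lt_trans (enorm_le_norm _) _.
  apply: (@le_lt_trans _ _ (N.+1%:R * (delta / N.+2%:R))).
    by rewrite ler_wpM2l//; exact: le_trans rd.
  rewrite mulrA ltr_pdivrMr// mulrC ltr_pM2l// ltr_nat//.
have rO y : `|y - x0| <= r -> Omega y.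
  move=> yr; have [|/= Oy _] := sub (y, t0); last exact: Oy.
  by apply: cyl => //=; rewrite subrr normr0 ltW.
pose d := r / 2; have d0 : 0 < d by rewrite /d; clear -r0; lra.
have d1 : d <= 1 by rewrite /d; clear -r1 r0; lra.
have rt0 : r < t0 by clear -rt t00; lra.
have touch' y : `|y.1 - x0| <= r -> `|y.2 - t0| <= r -> U y - phi y <= U (x0, t0) - phi (x0, t0).
  by move=> y1 y2; apply: touch; exact: cyl.
have data := test_data_exists s01 wM subTheta scheme_w sphi r0 rt0 r1 d0 (lexx _) rO touch'.
have [theta Th Hth] := @compact_selection R _ Theta
  (fun e th => Theta th /\ test_data s w M phi x0 t0 (U (x0, t0)) d e th) cTheta
  (fun e e' y ee (H : _ /\ _) => conj H.1 (test_data_le ee H.2))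
  (fun e e0 => let: ex_intro2 th H1 H2 := data e e0 in ex_intro2 _ _ th H1 (conj H1 H2)).
have sth := subTheta _ Th.
exists theta => //.
(* a sequence of near maximizers whose directions converge to theta *)
have [C C0 HC] := sd_quadratic_bound x0 t0 r r sphi.
pose E n : R := r * n.+1%:R^-1.
have E0 n : 0 < E n by rewrite mulr_gt0.
have Er n : E n <= r by apply: ler_piMr; [exact: ltW|rewrite invf_le1// ler1n].
have HE D : 0 < D -> \forall n \near \oo, E n < D.
  move=> D0; have D' : 0 < D / r by rewrite divr_gt0.
  by apply: filterS (near_infty_natSinv_lt (PosNum D')) => n /=; rewrite ltr_pdivlMr// mulrC.
have /choice[F HF] : forall n, exists p : nat * 'rV[R]_N * R * R * R * R * 'rV[R]_N,
    let: (k, x, q, c, a, b, th) := p in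
    [/\ usphere th, `|th - theta| < E n, k.+1%:R^-1 < E n, `|x - x0| < E n & `|q - t0| < E n] /\
    [/\ `|c - t0| < E n, 0 <= a <= 1, a <= E n, U (x0, t0) - E n <= b & `|b| <= M + 1] /\
     'D_((0, 1) : 'rV[R]_N * R) phi (x, c) <= E n +
       levyI s (test_integrand k.+1%:R^-1 d a b (slice phi q) (slice (w k) q) x th).
  move=> n; have nth : nbhs theta [set th | `|th - theta| < E n].
    exact: (near_norm_lt (V := 'rV[R]_N)).
  have [th H1 [H2 [k [x [q [c [a [b [[H3 H4 H5 H6] [H7 H8 H9 H10 H11]]]]]]]]]] := Hth _ nth _ (E0 n).
  by exists (k, x, q, c, a, b, th); split; [split=> //; exact: subTheta|].
pose k_ n := let: (k, x, q, c, a, b, th) := F n in k.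
pose x_ n := let: (k, x, q, c, a, b, th) := F n in x.
pose q_ n := let: (k, x, q, c, a, b, th) := F n in q.
pose c_ n := let: (k, x, q, c, a, b, th) := F n in c.
pose a_ n := let: (k, x, q, c, a, b, th) := F n in a.
pose b_ n := let: (k, x, q, c, a, b, th) := F n in b.
pose h_ n := let: (k, x, q, c, a, b, th) := F n in th.
pose g_ n := test_integrand (k_ n).+1%:R^-1 d (a_ n) (b_ n) (slice phi (q_ n))
  (slice (w (k_ n)) (q_ n)) (x_ n) (h_ n).
have {}HF n : [/\ usphere (h_ n), `|h_ n - theta| < E n, (k_ n).+1%:R^-1 < E n,
      `|x_ n - x0| < E n & `|q_ n - t0| < E n] /\
    [/\ `|c_ n - t0| < E n, 0 <= a_ n <= 1, a_ n <= E n, U (x0, t0) - E n <= b_ n & `|b_ n| <= M + 1] /\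
     'D_((0, 1) : 'rV[R]_N * R) phi (x_ n, c_ n) <= E n + levyI s (g_ n).
  have := HF n; rewrite /g_ /k_ /x_ /q_ /c_ /a_ /b_ /h_.
  by case: (F n) => -[[[[[k x] q] c] a] b] th.
pose G := splice d (fun t => sd (slice phi t0) x0 (t *: theta)) (fun t => sd (slice U t0) x0 (t *: theta)).
pose CC := C + 2 + (2 * M + 2 * (M + 1)) / d ^+ 2.
have d20 : 0 < d ^+ 2 by rewrite exprn_gt0.
have mg n : measurable_fun (`]0, +oo[%classic : set R) (g_ n).
  by apply: measurable_test_integrand; rewrite invr_gt0.
have bg n t : 0 < t -> `|g_ n t| <= CC * cap t.
  have [[H1 H2 H3 H4 H5] [[H6 H7 H8 H9 H10] _]] := HF n.
  apply: test_integrand_bound => //; first by rewrite d0.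
    by move=> y; exact: wM.
  move=> v vd; apply: HC.
  - by apply: le_trans (ltW H4) _; exact: Er.
  - by apply: le_trans (ltW H5) _; exact: Er.
  - by apply: le_trans (norm_le_enorm v) _; rewrite /d in vd; clear -vd r0; lra.
have mU : measurable_fun setT (fun t : R => slice U t0 (x0 + t *: theta)).
  have [] // := @usc_on_line_bounded R N halfspace U x0 t0 theta M.
  - by move=> y; rewrite /halfspace /= ltW.
  - by apply/usc_onP => z c _ zc; apply: filterS (upper_limit_usc wM zc) => y.
have mphi : measurable_fun setT (fun t : R => slice phi t0 (x0 + t *: theta)).
  by apply: continuous_measurable_fun; apply: continuous_line; exact: continuous_slice.
have mG : measurable_fun (`]0, +oo[%classic : set R) G.
  by apply: measurable_splice; apply: measurable_funTS; exact: measurable_sd.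
have bG t : 0 < t -> `|G t| <= CC * cap t.
  move=> t_0; have := @splice_sd_bound R N M d C (slice phi t0) (slice U t0) x0 theta.
  rewrite d0 d1 => /(_ isT C0 sth (fun y => UM _)) H.
  apply: le_trans (H _ t t_0) _.
    move=> v vd; apply: HC; rewrite ?subrr ?normr0 ?(ltW r0)//.
    by apply: le_trans (norm_le_enorm v) _; rewrite /d in vd; clear -vd r0; lra.
  rewrite ler_wpM2r ?cap_ge0// /CC -addrA lerD2l.
  have : 4 * M / d ^+ 2 <= (2 * M + 2 * (M + 1)) / d ^+ 2.
    by rewrite ler_pM2r ?invr_gt0//; clear; lra.
  by clear; lra.
have lim t e : 0 < t -> 0 < e -> \forall n \near \oo, g_ n t <= G t + e.
  move=> t_0 e0; have e8 : 0 < e / 8 by clear -e0; lra.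
  have t2 : 0 < 2 + t by clear -t_0; lra.
  have conv (D : R) : 0 < D -> \forall n \near \oo,
      [/\ E n < D, (k_ n).+1%:R^-1 < D, (k_ n).+1%:R^-1 < t,
        `|(x_ n + step (k_ n).+1%:R^-1 t *: h_ n) - (x0 + t *: theta)| < D
      & `|(x_ n - step (k_ n).+1%:R^-1 t *: h_ n) - (x0 - t *: theta)| < D].
    move=> D0; have m0 : 0 < Num.min (Num.min D t) (D / (2 + t)) by rewrite !lt_min D0 t_0 divr_gt0.
    apply: filterS (HE _ m0) => n; rewrite !lt_min ltr_pdivlMr// => /andP[/andP[ED Et] Em].
    have [[H1 H2 H3 H4 H5] _] := HF n.
    have rho0 : 0 < (k_ n).+1%:R^-1 :> R by rewrite invr_gt0.
    have near sg := @stepped_point_near R N _ _ _ _ _ _ _ sg rho0 t_0 (ltW H3) H1 H4 H2.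
    split=> //; [exact: lt_trans H3 _|exact: lt_trans H3 _| |].
    - have := near 1 (normr1 _); rewrite !scale1r => H; apply: lt_trans H _.
      by rewrite mulrC.
    - have := near (-1) (normrN1 _); rewrite !scaleN1r => H; apply: lt_trans H _.
      by rewrite mulrC.
  have [td|dt] := ltP t d.
    have [D1 D10 HD1] := prod_modulus (x0 + t *: theta, t0) cphi e8.
    have [D2 D20 HD2] := prod_modulus (x0 - t *: theta, t0) cphi e8.
    have [D3 D30 HD3] := prod_modulus (x0, t0) cphi e8.
    have m0 : 0 < Num.min (Num.min D1 D2) (Num.min D3 (e / 8)) by rewrite !lt_min D10 D20 D30.
    apply: filterS (conv _ m0) => n []; rewrite !lt_min.
    move=> /andP[/andP[E1 E2] /andP[E3 E4]] _ rt' /andP[/andP[P1 _] _] /andP[/andP[_ P2] _].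
    have [[H1 H2 H3 H4 H5] [[H6 /andP[a0 a1] H8 H9 H10] _]] := HF n.
    rewrite /g_ /test_integrand /G /splice td ltNge (ltW rt') /=.
    have := HD1 (_, q_ n) P1 (lt_trans H5 E1); have := HD2 (_, q_ n) P2 (lt_trans H5 E2).
    have := HD3 (_, q_ n) (lt_trans H4 E3) (lt_trans H5 E3).
    set v := step _ t *: h_ n; rewrite /sd /slice !ltr_norml.
    have : 2 * a_ n * enorm v ^+ 2 <= e / 4.
      have v1 : enorm v <= 1.
        apply: le_trans (enorm_step _ (ltW t_0) H1) _; first by rewrite invr_gt0.
        exact: le_trans (ltW td) d1.
      have : enorm v ^+ 2 <= 1 by rewrite exprn_ile1// enorm_ge0.
      move=> /(ler_wpM2l a0); clear -H8 E4; lra.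
    by clear; lra.
  have [D1 D10 HD1] := upper_limit_ge wM (x0 + t *: theta, t0) e8.
  have [D2 D20 HD2] := upper_limit_ge wM (x0 - t *: theta, t0) e8.
  have m0 : 0 < Num.min (Num.min D1 D2) (e / 8) by rewrite !lt_min D10 D20.
  apply: filterS (conv _ m0) => n []; rewrite !lt_min.
  move=> /andP[/andP[E1 E2] E4] /andP[/andP[k1 k2] _] rt' /andP[/andP[P1 _] _] /andP[/andP[_ P2] _].
  have [[H1 H2 H3 H4 H5] [[H6 /andP[a0 a1] H8 H9 H10] _]] := HF n.
  rewrite /g_ /test_integrand /G /splice ![t < _]ltNge dt (ltW rt') /=.
  have aux (v1 v2 b u1 u2 u3 En : R) : v1 <= u1 + e / 8 -> v2 <= u2 + e / 8 -> u3 - En <= b ->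
      En < e / 8 -> v1 + v2 - 2 * b <= u1 + u2 - 2 * u3 + e by clear -e0; lra.
  exact: (aux _ _ _ _ _ _ _ (HD1 _ (_, q_ n) k1 P1 (lt_trans H5 E1))
    (HD2 _ (_, q_ n) k2 P2 (lt_trans H5 E2)) H9 E4).
apply: (@le_trans _ _ (testJ s d (slice phi t0) (slice U t0) x0 theta)).
  apply/ler_addgt0Pr => e e0; have e4 : 0 < e / 4 by clear -e0; lra.
  have Hlim := levyI_limsup s01 mg bg mG bG lim e4.
  have [D D0 HD] := prod_modulus (x0, t0) cDphi e4.
  have m0 : 0 < Num.min D (e / 4) by rewrite lt_min D0.
  have [n _ /(_ n (leqnn n))[Hn En]] := filterI Hlim (HE _ m0).
  have [[H1 H2 H3 H4 H5] [[H6 H7 H8 H9 H10] H11]] := HF n.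
  move: En; rewrite lt_min => /andP[ED Ee].
  have := HD (x_ n, c_ n) (lt_trans H4 ED) (lt_trans H6 ED).
  have -> : testJ s d (slice phi t0) (slice U t0) x0 theta = levyI s G by [].
  move: Hn H11; rewrite ltr_norml.
  set I1 := levyI s (g_ n); set I2 := levyI s G.
  set d1' := 'D_(_) phi _; set d2' := 'D_(_) phi _.
  by clear -Ee; move: d1' d2' I1 I2 => p1 p2 i1 i2; lra.
have [C' C'0 HC'] := sd_quadratic_bound x0 t0 delta 0 sphi.
have lG : levy G by split => //; exists CC.
apply: levyI_le => //.
  apply: (levy_splice_near (M := 4 * M) (C := C') delta0).
  - by apply: measurable_funTS; exact: measurable_sd.
  - by apply: measurable_funTS; exact: measurable_sd.
  - move=> t /andP[t_0 td]; have := HC' x0 t0 (t *: theta).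
    rewrite !subrr !normr0 lexx (ltW delta0) normrZ enormZ sth mulr1 gtr0_norm//; apply => //.
    apply: le_trans (ltW td); rewrite -[leRHS]mulr1.
    by apply: ler_wpM2l; [exact: ltW|exact: usphere_norm].
  - by move=> t _; apply: sd_le4 => y; exact: UM.
move=> t t_0; rewrite /splice.
have ddelta : d <= delta by rewrite /d; clear -rdelta r0; lra.
have [td|dt] := ltP t d; first by rewrite (lt_le_trans td ddelta).
have [tD|//] := ltP t delta.
have cyl' (sg : R) : `|sg| = 1 -> cylinder x0 t0 delta (x0 + sg *: (t *: theta), t0).
  move=> sg1; split => /=; last by rewrite in_itv/=; clear -delta0; lra.
  by rewrite /eball /= addrAC subrr add0r !enormZ sg1 sth mul1r mulr1 gtr0_norm.
have := touch _ (cyl' 1 (normr1 _)); have := touch _ (cyl' (-1) (normrN1 _)).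
rewrite -/U scale1r scaleN1r /sd /slice.
have aux (a1 a2 a3 b1 b2 b3 : R) : a2 - b2 <= a3 - b3 -> a1 - b1 <= a3 - b3 ->
  a1 + a2 - 2 * a3 <= b1 + b2 - 2 * b3 by clear; lra.
exact: aux.
Qed.

(** * A supersolution along a chord *)

(** Young's inequality for the exponents [1 / b] and [1 / (1 - b)], with one factor equal to 1. *)
Lemma powR_bernoulli {R : realType} (b u : R) : 0 < b < 1 -> 0 <= u -> u `^ b <= 1 + b * (u - 1).
Proof.
move=> /andP[b0 b1] u0.
have b1' : 0 < 1 - b by lra.
have := @conjugate_powR R (u `^ b) 1 b^-1 (1 - b)^-1 (powR_ge0 _ _) ler01.
rewrite !invr_gt0 !invrK -powRrM mulfV ?gt_eqF// powRr1// powR1 mulr1 mul1r.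
by move=> /(_ b0 b1' (ltac:(ring))); lra.
Qed.

(** On a chord with ends at the distances [r1] and [r2] of the origin, a power of the product of
    the distances of the point [t] to the ends, extended by 0. *)
Definition profile {R : realType} (b r1 r2 t : R) : R := Num.max 0 ((r1 + t) * (r2 - t)) `^ b.

Lemma profile_opp {R : realType} (b r1 r2 t : R) : profile b r1 r2 (- t) = profile b r2 r1 t.
Proof. by rewrite /profile opprK mulrC. Qed.

(** A power below 1 of a concave quadratic function is concave. *)
Lemma profile_concave {R : realType} (b r1 r2 t : R) : 0 < b < 1 -> 0 < r1 -> 0 <= t <= r1 -> r1 <= r2 ->
  profile b r1 r2 t + profile b r1 r2 (- t) <= 2 * profile b r1 r2 0.
Proof.
move=> b01 r10 /andP[t0 tr1] r12; have /andP[b0 b1] := b01.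
rewrite /profile addr0 subr0 opprK.
have w0 : 0 < r1 * r2 by rewrite mulr_gt0//; lra.
have u0 : 0 <= (r1 + t) * (r2 - t) by rewrite mulr_ge0//; lra.
have v0 : 0 <= (r1 - t) * (r2 + t) by rewrite mulr_ge0//; lra.
rewrite !max_r//; last exact: ltW.
set w := r1 * r2 in w0 *; set u := (r1 + t) * (r2 - t) in u0 *; set v := _ * (r2 + t) in v0 *.
have uv : u + v <= 2 * w by rewrite /u /v /w; nra.
have E y : 0 <= y -> y `^ b = w `^ b * (y / w) `^ b.
  by move=> y0; rewrite -powRM ?(ltW w0) ?divr_ge0 ?(ltW w0)// mulrC divfK// gt_eqF.
rewrite (E u)// (E v)// -mulrDr mulrC ler_wpM2r ?powR_ge0//.
have := powR_bernoulli b01 (divr_ge0 u0 (ltW w0)).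
have := powR_bernoulli b01 (divr_ge0 v0 (ltW w0)).
have : b * ((u + v) / w) <= b * 2 by rewrite ler_pM2l// ler_pdivrMr.
by rewrite mulrDl; lra.
Qed.

(** One of the two points has left the chord, and the other one has gained at most the factor
    [(2 t / r1) `^ b]. *)
Lemma profile_far {R : realType} (b r1 r2 t : R) : 0 < b < 1 -> 0 < r1 -> r1 <= t -> r1 <= r2 ->
  profile b r1 r2 t + profile b r1 r2 (- t) <= profile b r1 r2 0 * (2 * t / r1) `^ b.
Proof.
move=> /andP[b0 b1] r10 tr1 r12; rewrite /profile addr0 subr0 opprK.
have b0' : b != 0 by rewrite gt_eqF.
have w0 : 0 < r1 * r2 by rewrite mulr_gt0//; lra.
have -> : Num.max 0 ((r1 - t) * (r2 + t)) = 0.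
  by apply: max_l; rewrite mulr_le0_ge0//; lra.
rewrite powR0// addr0 (max_r (ltW w0)) -powRM; [|exact: ltW|by rewrite divr_ge0; lra].
have E : r1 * r2 * (2 * t / r1) = r2 * (2 * t) by field; rewrite gt_eqF.
apply: ge0_ler_powR; rewrite ?nnegrE ?(ltW b0)//; first by rewrite le_max lexx.
  by rewrite E mulr_ge0//; lra.
rewrite E ge_max; apply/andP; split; first by rewrite mulr_ge0//; lra.
have [rt|rt] := leP r2 t; last by rewrite mulrC; apply: ler_pM; lra.
apply: (@le_trans _ _ 0); first by rewrite mulr_ge0_le0//; lra.
by rewrite mulr_ge0//; lra.
Qed.

Lemma profile_outside {R : realType} (b r1 r2 t : R) : 0 < b -> 0 < r1 -> r1 <= r2 -> r2 <= t ->
  profile b r1 r2 t + profile b r1 r2 (- t) = 0.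
Proof.
move=> b0 r10 r12 r2t; rewrite /profile opprK !max_l ?powR0 ?addr0// ?gt_eqF//.
  by rewrite mulr_le0_ge0//; lra.
by rewrite mulr_ge0_le0//; lra.
Qed.

Lemma profile_bound {R : realType} (b r1 r2 t : R) : 0 < b -> 0 < r1 -> 0 < r2 ->
  `|profile b r1 r2 t| <= ((r1 + r2) ^+ 2) `^ b.
Proof.
move=> b0 r10 r20; rewrite ger0_norm ?powR_ge0//.
apply: ge0_ler_powR; rewrite ?nnegrE ?(ltW b0) ?sqr_ge0//; first by rewrite le_max lexx.
rewrite ge_max sqr_ge0 /=.
have := sqr_ge0 (r1 + t - (r2 - t)); have := sqr_ge0 (r1 + r2); rewrite !expr2; clear; nra.
Qed.

(** The second difference is nonpositive up to [2 r1]: by concavity up to the nearest end, and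
    then because [4 `^ (s / 8)] is less than 2. Beyond, the constant loss of twice the value at
    0 exceeds the slow growth [(2 t / r1) `^ (s / 8)]. What remains is at least a multiple of
    [r1 `^ (s / 4 - 2 s)], hence uniform up to the ends of the chord. *)
Lemma profile_supersolution {R : realType} (s rho r1 r2 D : R) : 0 < s < 1 -> 0 < rho <= 1 ->
  rho <= r1 -> r1 <= r2 -> r1 <= D ->
  levyI s (fun t => profile (s / 8) r1 r2 (step rho t) + profile (s / 8) r1 r2 (- step rho t)
     - 2 * profile (s / 8) r1 r2 0) <= - (6 * (2 * D) `^ (2 * s - 2 * (s / 8)))^-1.
Proof.
move=> s01 /andP[rho0 rho1] rho_r1 r12 r1D; have /andP[s0 s1] := s01.
set b := s / 8; have b01 : 0 < b < 1 by rewrite /b; lra.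
have /andP[b0 b1] := b01.
have r10 : 0 < r1 by lra.
have r20 : 0 < r2 by lra.
set W := profile b r1 r2 0.
have W0 : 0 < W.
  by rewrite /W /profile addr0 subr0 max_r; [rewrite powR_gt0// mulr_gt0|rewrite mulr_ge0// ltW].
have d20 : 0 < 2 * r1 by lra.
pose L := r2 + 1.
pose H1 : R -> R := splice (2 * r1) (fun=> 0) (splice L (fun t => t `^ b) (fun=> 0)).
pose H2 : R -> R := splice (2 * r1) (fun=> 0) (fun=> 1).
have lH2 : levy H2 by exact: levy_ge.
have lH1 : levy H1.
  apply: (levy_splice_away (M := L `^ b)) => //.
    by apply: measurable_splice; [by apply: measurable_funTS; exact: measurable_powR|exact: measurable_cst].
  move=> t dt; rewrite /splice; case: ltP => tL; last by rewrite normr0 powR_ge0.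
  rewrite ger0_norm ?powR_ge0// ge0_ler_powR// ?nnegrE ?(ltW b0)//; [lra|rewrite /L; lra|exact: ltW].
have [c4 c4'] : 4 `^ b <= 11 / 8 /\ 0 < (4 : R) `^ b.
  split; last exact: powR_gt0.
  by have := @powR_bernoulli R b 4 b01 (ltac:(lra)); rewrite /b; lra.
have key : levyI s (fun t => profile b r1 r2 (step rho t) + profile b r1 r2 (- step rho t) - 2 * W) <=
    W * ((2 / r1) `^ b * levyI s H1 - 2 * levyI s H2).
  rewrite -!levyI_Z// -levyI_B//; [|exact: levyZ..].
  rewrite -levyI_Z//; last by apply: levyB; exact: levyZ.
  apply: levyI_le => //.
  - apply: (levy_away (r := rho) (M := 4 * ((r1 + r2) ^+ 2) `^ b)) => //.
    + exact: (measurable_step (fun q => profile b r1 r2 q + profile b r1 r2 (- q) - 2 * W)).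
    + move=> t t0; have := profile_bound (step rho t) b0 r10 r20.
      have := profile_bound (- step rho t) b0 r10 r20.
      have := profile_bound 0 b0 r10 r20; rewrite -/W !ler_norml; clear; lra.
    + by move=> t /andP[_ tr]; rewrite step_small// oppr0 -/W; ring.
  - by apply: levyZ; apply: levyB; exact: levyZ.
  move=> t t0; set q := step rho t.
  have q0 : 0 <= q by exact: step_ge0.
  have qt : q <= t by apply: step_le => //; exact: ltW.
  have tq : t - rho < q by exact: step_gt.
  rewrite /H1 /H2 /splice; have [td|dt] := ltP t (2 * r1).
    rewrite !mulr0 subr0 mulr0 subr_le0.
    have [qr|rq] := leP q r1; first by apply: profile_concave => //; rewrite q0.
    apply: le_trans (profile_far b01 r10 (ltW rq) r12) _.
    rewrite -/W mulrC ler_wpM2r ?(ltW W0)//; apply: (@le_trans _ _ (4 `^ b)); last by clear -c4; lra.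
    apply: ge0_ler_powR; rewrite ?nnegrE ?(ltW b0)//; first by rewrite divr_ge0; lra.
    by rewrite ler_pdivrMr//; clear -qt td; lra.
  have rq : r1 <= q by clear -tq dt rho_r1; lra.
  have [tL|Lt] := ltP t L.
    apply: (@le_trans _ _ (W * (2 * q / r1) `^ b - 2 * W)).
      by rewrite lerD2r; exact: profile_far.
    rewrite mulr1 mulrBr (mulrC W 2) lerD2r ler_pM2l// -powRM ?divr_ge0 ?(ltW t0) ?(ltW r10)//.
    apply: ge0_ler_powR; rewrite ?nnegrE ?(ltW b0)//.
    - by apply: divr_ge0; [apply: mulr_ge0|exact: ltW].
    - by rewrite mulr_ge0 ?divr_ge0 ?(ltW t0) ?(ltW r10).
    by rewrite [leRHS]mulrAC ler_pM2r ?invr_gt0// ler_pM2l.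
  rewrite (profile_outside b0 r10 r12); last by rewrite /L in Lt; clear -Lt tq rho1; lra.
  by rewrite mulr0; clear; lra.
apply: (le_trans key).
have b2s : 0 <= b < 2 * s by rewrite /b; lra.
have I1 := levyI_tail_powR s01 L d20 b2s.
have I2 := levyI_tail s01 d20.
have X0 : 0 < (2 * r1) `^ (- (2 * s)) by exact: powR_gt0.
have EX : (2 / r1) `^ b * (2 * r1) `^ (b - 2 * s) = 4 `^ b * (2 * r1) `^ (- (2 * s)).
  rewrite powRD; last by rewrite (gt_eqF d20) implybT.
  rewrite mulrA -powRM ?divr_ge0 ?(ltW r10) ?(ltW d20)//; congr (_ `^ _ * _).
  by field; rewrite gt_eqF.
rewrite -/H1 in I1; rewrite -/H2 in I2.
set X := (2 * r1) `^ (- (2 * s)) in X0 EX I2.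
have B1 : (2 / r1) `^ b * levyI s H1 <= 4 `^ b * X / (2 * s - b).
  by rewrite -EX -mulrA ler_wpM2l// powR_ge0.
have B2 : 4 `^ b * X / (2 * s - b) <= 11 / 15 * (X / s).
  have -> : 2 * s - b = 15 / 8 * s by rewrite /b; field.
  have -> : 11 / 15 * (X / s) = 11 / 8 * X / (15 / 8 * s) by field; rewrite gt_eqF.
  by rewrite ler_pM2r ?invr_gt0 ?mulr_gt0// ler_pM2r.
have B3 : (2 / r1) `^ b * levyI s H1 - 2 * levyI s H2 <= - (X / 4).
  rewrite I2; have -> : 2 * (X / (2 * s)) = X / s by field; rewrite gt_eqF.
  have : X <= X / s by rewrite ler_pdivlMr// ler_piMr// ltW.
  by clear -B1 B2 X0; lra.
apply: (@le_trans _ _ (W * - (X / 4))); first by rewrite ler_pM2l.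
rewrite mulrN lerN2.
(* as r1 <= r2, the value W of the profile at 0 is at least r1 `^ (2 * b) *)
have WX : (4 `^ b)^-1 * (2 * r1) `^ (2 * b) <= W.
  rewrite ler_pdivrMl// /W /profile addr0 subr0 max_r; last by rewrite mulr_ge0// ltW.
  rewrite -powRM//; last by rewrite mulr_ge0// ltW.
  have -> : (2 * r1) `^ (2 * b) = ((2 * r1) ^+ 2) `^ b.
    by rewrite powRrM powR_mulrn// ltW.
  apply: ge0_ler_powR; rewrite ?nnegrE ?sqr_ge0 ?(ltW b0)//; first by rewrite !mulr_ge0// ltW.
  by nra.
have D0 : 0 < 2 * D by lra.
have Y : (2 * D) `^ (2 * s - 2 * b) >= (2 * r1) `^ (2 * s - 2 * b).
  by apply: ge0_ler_powR; rewrite ?nnegrE; rewrite /b; lra.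
have Y0 : 0 < (2 * r1) `^ (2 * s - 2 * b) by exact: powR_gt0.
have EY : (2 * r1) `^ (2 * b) * X = ((2 * r1) `^ (2 * s - 2 * b))^-1.
  rewrite -powRN /X -powRD; last by rewrite (gt_eqF d20) implybT.
  by congr (_ `^ _); ring.
apply: (@le_trans _ _ ((4 `^ b)^-1 / 4 * ((2 * r1) `^ (2 * s - 2 * b))^-1)).
  rewrite invfM; apply: ler_pM; rewrite ?invr_ge0 ?powR_ge0//.
    by have := @lef_pV2 R (11/8) (4 `^ b); rewrite !posrE c4' => /(_ (ltac:(lra)) isT); rewrite c4; lra.
  by rewrite lef_pV2 ?posrE ?powR_gt0.
rewrite -EY; have : X * ((4 `^ b)^-1 * (2 * r1) `^ (2 * b)) <= X * W by rewrite ler_pM2l.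
by clear; lra.
Qed.

(** * Powers of the defining function of a ball *)

Definition dot {R : realType} {N : nat} (v w : 'rV[R]_N) : R := \sum_i v 0 i * w 0 i.

Section Dot.
Context {R : realType} {N : nat}.
Implicit Types v w : 'rV[R]_N.

Lemma dotC v w : dot v w = dot w v.
Proof. by apply: eq_bigr => i _; rewrite mulrC. Qed.

Lemma dotDl v v' w : dot (v + v') w = dot v w + dot v' w.
Proof. by rewrite /dot -big_split; apply: eq_bigr => i _; rewrite mxE mulrDl. Qed.

Lemma dotZl (c : R) v w : dot (c *: v) w = c * dot v w.
Proof. by rewrite /dot mulr_sumr; apply: eq_bigr => i _; rewrite mxE mulrA. Qed.

Lemma dotNl v w : dot (- v) w = - dot v w.
Proof. by rewrite -scaleN1r dotZl mulN1r. Qed.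

Lemma dotDr v w w' : dot v (w + w') = dot v w + dot v w'.
Proof. by rewrite dotC dotDl !(dotC v). Qed.

Lemma dotZr (c : R) v w : dot v (c *: w) = c * dot v w.
Proof. by rewrite dotC dotZl dotC. Qed.

Lemma dotNr v w : dot v (- w) = - dot v w.
Proof. by rewrite dotC dotNl dotC. Qed.

Lemma dotvv v : dot v v = enorm v ^+ 2.
Proof. by rewrite sqr_enorm; apply: eq_bigr => i _; rewrite expr2. Qed.

Lemma enorm_eq0 v : enorm v = 0 -> v = 0.
Proof.
move=> v0; apply/rowP => i; rewrite mxE; apply/eqP; rewrite -normr_le0 -v0.
exact: coord_le_enorm.
Qed.

Lemma enormD_sqr v w : enorm (v + w) ^+ 2 = enorm v ^+ 2 + 2 * dot v w + enorm w ^+ 2.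
Proof. by rewrite -!dotvv dotDl !dotDr (dotC w v); ring. Qed.

Lemma enormB_sqr v w : enorm (v - w) ^+ 2 = enorm v ^+ 2 - 2 * dot v w + enorm w ^+ 2.
Proof. by rewrite enormD_sqr enormN dotNr; ring. Qed.

Lemma dot_le v w : dot v w <= enorm v * enorm w.
Proof.
have [v0|v0] := eqVneq (enorm v) 0.
  by rewrite (enorm_eq0 v0) enorm0 mul0r /dot big1// => i _; rewrite mxE mul0r.
have [w0|w0] := eqVneq (enorm w) 0.
  by rewrite (enorm_eq0 w0) enorm0 mulr0 /dot big1// => i _; rewrite mxE mulr0.
have v1 : 0 < enorm v by rewrite lt_neqAle eq_sym v0 enorm_ge0.
have w1 : 0 < enorm w by rewrite lt_neqAle eq_sym w0 enorm_ge0.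
have := sqr_ge0 (enorm (enorm w *: v - enorm v *: w)).
rewrite enormB_sqr !enormZ !ger0_norm ?(ltW v1) ?(ltW w1)// dotZl dotZr.
set c := dot v w; set p := enorm v in v1 *; set q := enorm w in w1 *.
have -> : (q * p) ^+ 2 - 2 * (q * (p * c)) + (p * q) ^+ 2 = 2 * (p * q) * (p * q - c) by ring.
by rewrite pmulr_rge0 ?subr_ge0// !mulr_gt0.
Qed.

Lemma enormD v w : enorm (v + w) <= enorm v + enorm w.
Proof.
rewrite -(@ler_pXn2r _ 2)// ?nnegrE ?enorm_ge0 ?addr_ge0 ?enorm_ge0//.
rewrite enormD_sqr; have := dot_le v w; rewrite !expr2; lra.
Qed.

End Dot.

Section BallPower.
Context {R : realType} {N : nat}.
Implicit Types (x z a p theta : 'rV[R]_N).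

(** Positive exactly in the ball of radius [enorm a] around [z + a], whose boundary contains [z]. *)
Definition ballq z a p : R := 2 * dot (p - z) a - enorm (p - z) ^+ 2.

Lemma ballq_line z a x theta (t : R) : usphere theta ->
  ballq z a (x + t *: theta) = ballq z a x + 2 * dot (a - (x - z)) theta * t - t ^+ 2.
Proof.
move=> sth; rewrite /ballq (addrAC x) (enormD_sqr (x - z)) enormZ sth mulr1 real_normK ?num_real//.
by rewrite !(dotDl, dotZl, dotZr, dotNl, dotNr) (dotC theta a); ring.
Qed.

Lemma ballq_le z a p : ballq z a p <= enorm a ^+ 2.
Proof.
have := sqr_ge0 (enorm (p - z - a)); rewrite enormB_sqr /ballq; lra.
Qed.

(** Along a line the defining function of a ball is a quadratic polynomial with leading coefficient
    -1; its roots are the ends of the chord. *)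
Lemma ballq_chord z a x theta : usphere theta -> 0 < ballq z a x ->
  exists r1 r2 : R, [/\ 0 < r1, 0 < r2 &
    forall t, ballq z a (x + t *: theta) = (r1 + t) * (r2 - t)].
Proof.
move=> sth q0; pose b := dot (a - (x - z)) theta.
pose rt := Num.sqrt (b ^+ 2 + ballq z a x).
have rt2 : rt ^+ 2 = b ^+ 2 + ballq z a x by rewrite sqr_sqrtr// addr_ge0 ?sqr_ge0// ltW.
have rt0 : 0 <= rt := sqrtr_ge0 _.
have [rb1 rb2] : b < rt /\ - b < rt.
  by split; rewrite ltNge; apply/negP => H; nra.
exists (rt - b), (rt + b); split; [lra|lra|move=> t].
rewrite ballq_line// -/b.
have -> : ballq z a x = rt ^+ 2 - b ^+ 2 by lra.
by ring.
Qed.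

Lemma smaller_factor_le (r1 r2 e : R) : 0 < r1 -> r1 <= r2 -> 0 <= e -> r1 * r2 <= e ^+ 2 -> r1 <= e.
Proof. by move=> r10 r12 e0 H; rewrite leNgt; apply/negP => h; nra. Qed.

Definition ball_power (s : R) z a p : R := Num.max 0 (ballq z a p) `^ (s / 8).

Definition ball_margin (s : R) a : R := (6 * (2 * enorm a) `^ (2 * s - 2 * (s / 8)))^-1.

(** Every line meets the ball in a chord, on which [profile_supersolution] applies; the shorter of the
    two parts of the chord is at most the radius of the ball. *)
Lemma ball_power_supersolution (s rho : R) z a x theta : 0 < s < 1 -> 0 < rho <= 1 ->
  usphere theta -> (forall p, enorm (p - x) < rho -> 0 < ballq z a p) ->
  stepI s rho (ball_power s z a) x theta <= - ball_margin s a.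
Proof.
move=> s01 rho01 sth pos; have /andP[rho0 rho1] := rho01.
have qx : 0 < ballq z a x by apply: pos; rewrite subrr enorm0.
have [r1 [r2 [r10 r20 chord]]] := ballq_chord sth qx.
have near (t : R) : `|t| < rho -> 0 < (r1 + t) * (r2 - t).
  by move=> tr; rewrite -chord; apply: pos; rewrite addrAC subrr add0r enormZ sth mulr1.
have rr1 : rho <= r1.
  rewrite leNgt; apply/negP => lt; have := near (- r1).
  by rewrite normrN gtr0_norm// addrN mul0r ltxx => /(_ lt).
have rr2 : rho <= r2.
  rewrite leNgt; apply/negP => lt; have := near r2.
  by rewrite gtr0_norm// subrr mulr0 ltxx => /(_ lt).
have prod : r1 * r2 <= enorm a ^+ 2.
  by have := ballq_le z a x; have := chord 0; rewrite scale0r !addr0 subr0 => ->.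
have W0 : ball_power s z a x = profile (s / 8) r1 r2 0.
  by rewrite /ball_power /profile -chord scale0r addr0.
have Wp (t : R) : ball_power s z a (x + t *: theta) = profile (s / 8) r1 r2 t.
  by rewrite /ball_power /profile -chord.
have -> : stepI s rho (ball_power s z a) x theta = levyI s (fun t => profile (s / 8) r1 r2 (step rho t) +
    profile (s / 8) r1 r2 (- step rho t) - 2 * profile (s / 8) r1 r2 0).
  by apply: levyI_eq => t _; rewrite /sd -scaleNr !Wp W0.
have [r12|/ltW r21] := leP r1 r2.
  by apply: profile_supersolution => //; exact: smaller_factor_le r10 r12 (enorm_ge0 _) prod.
rewrite (@levyI_eq R s _ (fun t => profile (s / 8) r2 r1 (step rho t) +
    profile (s / 8) r2 r1 (- step rho t) - 2 * profile (s / 8) r2 r1 0)); last first.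
  by move=> t _; rewrite -[0 in LHS]oppr0 !profile_opp -(profile_opp _ r2 r1); ring.
apply: profile_supersolution => //.
by apply: smaller_factor_le r20 r21 (enorm_ge0 _) _; rewrite mulrC.
Qed.

Lemma ball_power_ge0 (s : R) z a p : 0 <= ball_power s z a p.
Proof. exact: powR_ge0. Qed.

Lemma ball_power_le (s : R) z a p : 0 < s -> ball_power s z a p <= (enorm a ^+ 2) `^ (s / 8).
Proof.
move=> s0; apply: ge0_ler_powR; rewrite ?nnegrE ?sqr_ge0 ?le_max ?lexx//; first lra.
by rewrite ge_max sqr_ge0 ballq_le.
Qed.

Lemma ball_power_small (s e : R) z a : 0 < s -> 0 < e -> exists2 r : R, 0 < r &
  forall p, `|p - z| < r -> ball_power s z a p <= e.
Proof.
move=> s0 e0; pose eta := e `^ (s / 8)^-1.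
have s8 : 0 < s / 8 by lra.
have eta0 : 0 < eta by exact: powR_gt0.
have etab : eta `^ (s / 8) = e by rewrite -powRrM mulVf ?gt_eqF// powRr1// ltW.
have a0 := enorm_ge0 a.
have m0 : 0 < 2 * N.+1%:R * (enorm a + 1) by rewrite !mulr_gt0//; lra.
exists (eta / (2 * N.+1%:R * (enorm a + 1))); first by rewrite divr_gt0.
move=> p pz; rewrite -etab; apply: ge0_ler_powR; rewrite ?nnegrE ?(ltW eta0) ?le_max ?lexx ?(ltW s8)//.
rewrite ge_max (ltW eta0) /= /ballq.
have := dot_le (p - z) a; have := enorm_le_norm (p - z); have := sqr_ge0 (enorm (p - z)).
move: pz; rewrite ltr_pdivlMr// => pz H1 H2 H3.
have H4 : enorm (p - z) * enorm a <= N.+1%:R * `|p - z| * enorm a by rewrite ler_wpM2r.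
have H5 : 0 <= 2 * N.+1%:R * `|p - z| by rewrite !mulr_ge0.
clear -H1 H3 H4 H5 pz; lra.
Qed.

End BallPower.

(** * Barriers for the scheme *)

(** This carries an estimate for [f] over to a truncation [psi]: only the jumps that reach [r] see the
    difference, and each of their second differences gains at most [4 * M]. *)
Lemma stepI_truncated {R : realType} {N : nat} (s rho M r : R) (psi f : 'rV[R]_N -> R) (x theta : 'rV[R]_N) :
  0 < s < 1 -> 0 < rho -> 0 < r -> usphere theta -> (forall y, `|psi y| <= M) ->
  (forall y, - M <= f y) -> (exists B : R, forall y, `|f y| <= B) ->
  psi x = f x ->
  (forall v, enorm v < r -> psi (x + v) <= f (x + v)) ->
  stepI s rho psi x theta <= stepI s rho f x theta + 4 * M * tailmass s r.
Proof.
move=> s01 rho0 r0 sth psiM fM [B fB] psix near.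
have lt1 : levy (splice r (fun=> 0) (fun=> 1) : R -> R) by exact: levy_ge.
rewrite /tailmass -levyI_Z// -levyI_D//; [|exact: (levy_step _ _ _ fB)|exact: levyZ].
apply: levyI_le => //; first exact: (levy_step _ _ _ psiM).
  by apply: levyD; [exact: (levy_step _ _ _ fB)|exact: levyZ].
move=> t t0; rewrite /splice.
have vt : enorm (step rho t *: theta) <= t by apply: enorm_step => //; exact: ltW.
set v := step rho t *: theta in vt *; rewrite /sd psix.
have [tr|rt] := ltP t r.
  have := near v (le_lt_trans vt tr); have := near (- v); rewrite enormN => /(_ (le_lt_trans vt tr)).
  by clear; lra.
have := psiM (x + v); have := psiM (x - v); have := fM (x + v); have := fM (x - v).
by rewrite !ler_norml; clear; lra.
Qed.

Lemma stepI_at_max {R : realType} {N : nat} (s rho M : R) (psi : 'rV[R]_N -> R) (x theta : 'rV[R]_N) :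
  0 < s < 1 -> 0 < rho -> (forall y, `|psi y| <= M) -> psi x = M -> stepI s rho psi x theta <= 0.
Proof.
move=> s01 rho0 psiM psix; rewrite -[leRHS](@levyI0 R s).
apply: levyI_le => //; first exact: (levy_step _ _ _ psiM).
  by split; [exact: measurable_cst|exists 0 => t t0; rewrite normr0 mul0r].
move=> t _; rewrite /sd psix; set v := step rho t *: theta.
by have := psiM (x + v); have := psiM (x - v); rewrite !ler_norml; clear; lra.
Qed.

(** A large multiple of [ball_power] plus the boundary value at [z], cut off at the level [M] and away
    from [z]. Where the cut is not active, [x] is close to [z] and the strict supersolution
    property pays for the jumps that leave the neighbourhood of [z]. *)
Lemma boundary_barrier {R : realType} {N : nat} (s M e : R) (Omega : set 'rV[R]_N) (u0 : 'rV[R]_N -> R) z a :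
  0 < s < 1 -> continuous u0 -> (forall x, `|u0 x| <= M) -> ~ Omega z -> 0 < e ->
  (forall p, Omega p -> enorm (p - z) ^+ 2 <= dot (p - z) a) ->
  exists psi : 'rV[R]_N -> R, [/\ forall x, `|psi x| <= M, forall x, u0 x <= psi x,
    exists2 r : R, 0 < r & forall y, `|y - z| < r -> psi y <= u0 z + e
  & forall rho x theta, 0 < rho <= 1 -> eball x rho `<=` Omega -> usphere theta ->
      stepI s rho psi x theta <= 0].
Proof.
move=> s01 cu u0M nOz e0 Oa; have /andP[s0 s1] := s01.
have M0 : 0 <= M := le_trans (normr_ge0 _) (u0M z).
have e2 : 0 < e / 2 by lra.
have [r r0 Hr] := continuous_modulus z cu e2.
have qpos p : Omega p -> enorm (p - z) ^+ 2 <= ballq z a p.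
  by move=> /Oa; rewrite /ballq; lra.
have qpos0 p : Omega p -> 0 < ballq z a p.
  move=> Op; apply: lt_le_trans (qpos p Op); rewrite exprn_gt0// lt_neqAle enorm_ge0 andbT eq_sym.
  apply/eqP => /enorm_eq0/eqP; rewrite subr_eq0 => /eqP pz; by rewrite pz in Op.
pose c := ball_margin s a.
have [Oempty|/set0P[p0 Op0]] := eqVneq Omega set0.
  exists (fun x => Num.min M (u0 x)); split.
  - by move=> x; rewrite min_r//; have := u0M x; rewrite ler_norml => /andP[].
  - by move=> x; rewrite min_r//; have := u0M x; rewrite ler_norml => /andP[].
  - exists r => // y yr; rewrite ge_min; apply/orP; right.
    by have := Hr y; rewrite distrC yr => /(_ isT); rewrite ltr_norml; clear; lra.
  - move=> rho x theta /andP[rho0 _] xO _; have := xO x.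
    by rewrite /eball /= subrr enorm0 Oempty => /(_ rho0).
have a0 : 0 < enorm a.
  rewrite lt_neqAle enorm_ge0 andbT eq_sym; apply/eqP => a0.
  have := ballq_le z a p0; rewrite a0 expr0n /=; have := qpos0 p0 Op0; lra.
have c0 : 0 < c by rewrite invr_gt0 mulr_gt0// powR_gt0// mulr_gt0.
have r2 : 0 < r / 2 by lra.
have rb0 : 0 < ((r / 2) ^+ 2) `^ (s / 8) by apply: powR_gt0; rewrite exprn_gt0.
pose K := 2 * M / ((r / 2) ^+ 2) `^ (s / 8) + 4 * M * tailmass s (r / 2) / c.
have K1 : 0 <= 2 * M / ((r / 2) ^+ 2) `^ (s / 8) by rewrite divr_ge0 ?(ltW rb0)// mulr_ge0.
have K2 : 0 <= 4 * M * tailmass s (r / 2) / c.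
  by rewrite divr_ge0 ?(ltW c0)// mulr_ge0 ?tailmass_ge0// mulr_ge0.
have K0 : 0 <= K by exact: addr_ge0.
pose W := ball_power s z a.
pose f p := K * W p + (u0 z + e / 2).
pose psi p := if enorm (p - z) < r then Num.min M (f p) else M.
have W0 p : 0 <= W p := ball_power_ge0 s z a p.
have f_ge p : - M <= f p.
  by have := u0M z; rewrite ler_norml /f; have := mulr_ge0 K0 (W0 p); clear -e2; lra.
have psiM p : `|psi p| <= M.
  rewrite /psi ler_norml; case: ifP => _; last by rewrite lexx andbT; clear -M0; lra.
  rewrite le_min ge_min lexx f_ge /= andbT andbT; clear -M0; lra.
have psi_le p : psi p <= M by have := psiM p; rewrite ler_norml => /andP[].
exists psi; split => //.
- move=> x; have uxM : u0 x <= M by have := u0M x; rewrite ler_norml => /andP[].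
  rewrite /psi; case: ifP => // xr; rewrite le_min uxM /=.
  have := Hr x; rewrite distrC => /(_ (le_lt_trans (norm_le_enorm _) xr)).
  by rewrite ltr_norml /f; have := mulr_ge0 K0 (W0 x); clear; lra.
- have K10 : 0 < K + 1 by clear -K0; lra.
  have [r' r'0 Hr'] := @ball_power_small R N s (e / 2 / (K + 1)) z a s0 (divr_gt0 e2 K10).
  have N1 : 0 < N.+1%:R :> R by rewrite ltr0n.
  exists (Num.min r' (r / N.+1%:R)); first by rewrite lt_min r'0 divr_gt0.
  move=> y; rewrite lt_min ltr_pdivlMr// => /andP[yr' yr].
  have yr1 : enorm (y - z) < r by apply: le_lt_trans (enorm_le_norm _) _; rewrite mulrC.
  rewrite /psi yr1 ge_min; apply/orP; right; rewrite /f.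
  have : K * W y <= (K + 1) * W y by rewrite ler_wpM2r//; clear; lra.
  have := Hr' y yr'; rewrite -/(W y) ler_pdivlMr//; clear; lra.
- move=> rho x theta rho01 xO sth; have /andP[rho0 rho1] := rho01.
  have [/eqP psix|psix] := eqVneq (psi x) M; first by apply: (stepI_at_max _ s01 rho0 psiM); exact/eqP.
  have Ox : Omega x by apply: xO; rewrite /eball /= subrr enorm0.
  have xr : enorm (x - z) < r.
    by apply: contraNT psix => /negbTE xr; rewrite /psi xr.
  have fxM : f x < M.
    rewrite ltNge; apply/negP => Mf; move/negP: psix; apply; apply/eqP.
    by rewrite /psi xr min_l.
  have psif : psi x = f x by rewrite /psi xr min_r// ltW.
  (* far from z the barrier has already reached M *)
  have xr2 : enorm (x - z) < r / 2.
    rewrite ltNge; apply/negP => rx; move: fxM; apply/negP; rewrite -leNgt.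
    have Wx : ((r / 2) ^+ 2) `^ (s / 8) <= W x.
      apply: ge0_ler_powR; rewrite ?nnegrE ?sqr_ge0 ?le_max ?lexx//; first by clear -s0; lra.
      apply/orP; right; apply: le_trans (qpos x Ox).
      by rewrite lerXn2r ?nnegrE ?enorm_ge0// ltW.
    have : 2 * M <= K * W x.
      apply: (@le_trans _ _ (2 * M / ((r / 2) ^+ 2) `^ (s / 8) * W x)).
        by rewrite -mulrA ler_peMr ?mulr_ge0// mulrC ler_pdivlMr// mul1r.
      by rewrite ler_wpM2r// /K lerDl.
    by have := u0M z; rewrite ler_norml /f; clear -e2; lra.
  have fB : exists B : R, forall y, `|f y| <= B.
    exists (K * (enorm a ^+ 2) `^ (s / 8) + (M + e / 2)) => y.
    have := ler_wpM2l K0 (@ball_power_le R N s z a y s0); have := mulr_ge0 K0 (W0 y).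
    by have := u0M z; rewrite /f -/(W y) !ler_norml; clear -e2; lra.
  have near v : enorm v < r / 2 -> psi (x + v) <= f (x + v).
    move=> vr; have xvr : enorm (x + v - z) < r.
      by rewrite addrAC; apply: le_lt_trans (enormD _ _) _; clear -vr xr2; lra.
    by rewrite /psi xvr ge_min lexx orbT.
  have Htr := stepI_truncated s01 rho0 r2 sth psiM f_ge fB psif near.
  apply: (le_trans Htr).
  have pos p : enorm (p - x) < rho -> 0 < ballq z a p by move=> px; apply: qpos0; exact: xO.
  have HW := ball_power_supersolution s01 rho01 sth pos.
  have Ef : stepI s rho f x theta = K * stepI s rho W x theta.
    rewrite /f stepI_addcst /stepI -levyI_Z//; last first.
      apply: (@levy_step R N rho W x theta ((enorm a ^+ 2) `^ (s / 8)) rho0) => y.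
      by rewrite ger0_norm ?W0//; exact: ball_power_le.
    have aux (A p1 p2 p3 : R) : A * p1 + A * p2 - 2 * (A * p3) = A * (p1 + p2 - 2 * p3) by ring.
    by apply: levyI_eq => t _; exact: aux.
  rewrite Ef; have : K * stepI s rho W x theta <= K * - c by rewrite ler_wpM2l.
  have : 4 * M * tailmass s (r / 2) / c * c <= K * c by rewrite ler_pM2r// /K lerDr.
  by rewrite divfK ?gt_eqF//; clear; lra.
Qed.

(** A truncated paraboloid above the initial value; its image under the sampled operators is bounded
    uniformly in [rho]. *)
Lemma initial_barrier {R : realType} {N : nat} (s M e : R) (u0 : 'rV[R]_N -> R) z :
  0 < s < 1 -> continuous u0 -> (forall x, `|u0 x| <= M) -> 0 < e ->
  exists (psi : 'rV[R]_N -> R) (C : R), [/\ 0 <= C /\ (forall x, `|psi x| <= M), forall x, u0 x <= psi x,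
    exists2 r : R, 0 < r & forall y, `|y - z| < r -> psi y <= u0 z + e
  & forall rho x theta, 0 < rho <= 1 -> usphere theta -> stepI s rho psi x theta <= C].
Proof.
move=> s01 cu u0M e0.
have M0 : 0 <= M := le_trans (normr_ge0 _) (u0M z).
have e2 : 0 < e / 2 by lra.
have [r r0 Hr] := continuous_modulus z cu e2.
have r20 : 0 < r ^+ 2 by rewrite exprn_gt0.
pose K := 2 * M / r ^+ 2.
have K0 : 0 <= K by rewrite divr_ge0 ?(ltW r20)// mulr_ge0.
pose f p := u0 z + e / 2 + K * enorm (p - z) ^+ 2.
pose psi p := Num.min M (f p).
have f_ge p : - M <= f p.
  by have := u0M z; rewrite ler_norml /f; have := mulr_ge0 K0 (sqr_ge0 (enorm (p - z))); clear -e2; lra.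
have psiM p : `|psi p| <= M.
  rewrite /psi ler_norml le_min ge_min lexx f_ge /= andbT andbT; clear -M0; lra.
pose G : R -> R := splice 1 (fun t => 2 * K * t ^+ 2) (fun=> 4 * M).
have lG : levy G.
  apply: (levy_splice_near (M := 4 * M) (C := 2 * K)) => //.
  - by apply: measurable_funTS; apply: measurable_funM => //; exact: measurable_funX.
  - by move=> t _; rewrite ger0_norm// mulr_ge0 ?sqr_ge0// mulr_ge0.
  - by move=> t _; rewrite ger0_norm// mulr_ge0.
exists psi, (levyI s G); split.
- split=> //; apply: levyI_ge0 => // t t0; rewrite /G /splice; case: ifP => _; last by rewrite mulr_ge0.
  by rewrite mulr_ge0 ?sqr_ge0// mulr_ge0.
- move=> x; rewrite /psi le_min; apply/andP; split; first by have := u0M x; rewrite ler_norml => /andP[].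
  have [xr|rx] := ltP (enorm (x - z)) r.
    have := Hr x; rewrite distrC => /(_ (le_lt_trans (norm_le_enorm _) xr)).
    by rewrite ltr_norml /f; have := mulr_ge0 K0 (sqr_ge0 (enorm (x - z))); clear; lra.
  have : 2 * M <= K * enorm (x - z) ^+ 2.
    have -> : 2 * M = K * r ^+ 2 by rewrite /K divfK// gt_eqF.
    by rewrite ler_wpM2l// lerXn2r ?nnegrE ?enorm_ge0// ltW.
  by have := u0M z; have := u0M x; rewrite /f !ler_norml; clear -e2; lra.
- have K10 : 0 < K + 1 by clear -K0; lra.
  pose r' := Num.min 1 (e / 2 / (K + 1)).
  have N1 : 0 < N.+1%:R :> R by rewrite ltr0n.
  have r'0 : 0 < r' by rewrite lt_min ltr01 divr_gt0.
  exists (r' / N.+1%:R); first by rewrite divr_gt0.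
  move=> y; rewrite ltr_pdivlMr// => yr.
  have yr1 : enorm (y - z) < r' by apply: le_lt_trans (enorm_le_norm _) _; rewrite mulrC.
  rewrite /psi ge_min; apply/orP; right; rewrite /f.
  move: yr1; rewrite lt_min ltr_pdivlMr// => /andP[y1 ye].
  have y2 : enorm (y - z) ^+ 2 <= enorm (y - z).
    by rewrite expr2 ler_piMr ?enorm_ge0// ltW.
  have H1 : K * enorm (y - z) ^+ 2 <= K * enorm (y - z) by rewrite ler_wpM2l.
  have := enorm_ge0 (y - z); clear -H1 ye; lra.
- move=> rho x theta /andP[rho0 rho1] sth.
  apply: levyI_le => //; first exact: (levy_step _ _ _ psiM).
  move=> t t0; have vt : enorm (step rho t *: theta) <= t by apply: enorm_step => //; exact: ltW.
  set v := step rho t *: theta in vt *; rewrite /G /splice; case: ifP => t1; last first.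
    by apply: le_trans (ler_norm _) _; exact: sd_le4.
  have psi_le p : psi p <= M /\ psi p <= f p by rewrite /psi !ge_min !lexx orbT.
  have := psi_le (x + v); have := psi_le (x - v).
  have v2 : K * enorm v ^+ 2 <= K * t ^+ 2.
    by rewrite ler_wpM2l// lerXn2r ?nnegrE ?enorm_ge0 ?(ltW t0).
  have Kt : 0 <= K * t ^+ 2 by rewrite mulr_ge0// sqr_ge0.
  have [Mf|/ltW fM] := leP M (f x).
    have -> : sd psi x v = psi (x + v) + psi (x - v) - 2 * M by rewrite /sd {3}/psi min_l.
    by clear -Kt; lra.
  have -> : sd psi x v = psi (x + v) + psi (x - v) - 2 * f x by rewrite /sd {3}/psi min_r.
  have E1 : enorm (x + v - z) ^+ 2 = enorm (x - z) ^+ 2 + 2 * dot (x - z) v + enorm v ^+ 2.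
    by rewrite (addrAC x) (enormD_sqr (x - z) v).
  have E2 : enorm (x - v - z) ^+ 2 = enorm (x - z) ^+ 2 - 2 * dot (x - z) v + enorm v ^+ 2.
    by rewrite (addrAC x) (enormB_sqr (x - z) v).
  by rewrite /f E1 E2; clear -v2; lra.
Qed.

(** * Strict convexity near a boundary point *)

Lemma enorm_dist {R : realType} {N : nat} (x y : 'rV[R]_N) : `|enorm x - enorm y| <= enorm (x - y).
Proof.
have := enormD (x - y) y; have := enormD (y - x) x; rewrite !subrK.
by rewrite -(enormN (y - x)) opprB ler_norml; lra.
Qed.

Lemma continuous_enorm {R : realType} {N : nat} : continuous (@enorm R N).
Proof.
apply: (@continuous_of_modulus R 'rV[R]_N) => x e e0.
have N1 : 0 < N.+1%:R :> R by rewrite ltr0n.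
exists (e / N.+1%:R); first by rewrite divr_gt0.
move=> y; rewrite ltr_pdivlMr// mulrC => xy.
by apply: le_lt_trans (enorm_dist _ _) _; apply: le_lt_trans (enorm_le_norm _) _.
Qed.

Lemma compact_usphere {R : realType} {N : nat} : compact (@usphere R N).
Proof.
apply: (subclosed_compact _ (@compact_norm_ball R N 0 1)); last first.
  by move=> x /usphere_norm; rewrite /= subr0.
have -> : usphere = enorm @^-1` [set (1 : R)] by [].
by apply: closed_comp; [move=> x _; exact: continuous_enorm|exact: closed_eq].
Qed.

Lemma dot_mulmx {R : realType} {m n : nat} (H : 'M[R]_(m, n)) v w : dot (v *m H) w = dot v (w *m H^T).
Proof.
have E k (a b : 'rV[R]_k) : dot a b = (a *m b^T) 0 0.
  by rewrite mxE; apply: eq_bigr => i _; rewrite mxE.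
by rewrite !E trmx_mul trmxK mulmxA.
Qed.

Lemma continuous_quadratic {R : realType} {n : nat} (H : 'M[R]_n) :
  continuous (fun y : 'rV[R]_n => dot (y *m H) y).
Proof.
have cc i : Ck 0 (fun y : 'rV[R]_n => y 0 i) by exact: coord_continuous.
apply: (@Ck_sum _ _ 0) => i; apply: (@CkM _ _ 0) => //.
have -> : (fun y : 'rV[R]_n => (y *m H) 0 i) = (fun y => \sum_j y 0 j * H j i).
  by apply/funext => y; rewrite mxE.
apply: (@Ck_sum _ _ 0) => j; apply: (@CkM _ _ 0) => //; exact: (@Ck_cst _ _ 0).
Qed.

(** The minimum of the quadratic form over the sphere is an eigenvalue: at a minimum point [y0] the
    form minus [m] times the squared norm is nonnegative and vanishes, so its linear part at
    [y0] vanishes in every direction. *)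
Lemma posdef_of_eigenvalues {R : realType} {n : nat} (H : 'M[R]_n) : H^T = H ->
  (forall k, eigenvalue H k -> 0 < k) ->
  exists2 c : R, 0 < c & forall y, c * enorm y ^+ 2 <= dot (y *m H) y.
Proof.
move=> symH posH.
have [S0|S0] := pselect (exists y : 'rV[R]_n, usphere y); last first.
  exists 1 => // y; have [y0|y0] := eqVneq (enorm y) 0.
    rewrite (enorm_eq0 y0) enorm0 expr0n mulr0 /= /dot big1// => i _.
    by rewrite mul0mx mxE mul0r.
  have yp : 0 < enorm y by rewrite lt_neqAle eq_sym y0 enorm_ge0.
  exfalso; apply: S0; exists ((enorm y)^-1 *: y).
  by rewrite /usphere /= enormZ ger0_norm ?invr_ge0 ?enorm_ge0// mulVf.
pose Q y := dot (y *m H) y.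
have cQ : continuous Q by exact: continuous_quadratic.
have [y0 sy0 miny0] : exists2 y, usphere y & forall y', usphere y' -> - Q y' <= - Q y.
  have cS := @compact_usphere R n.
  apply: usc_attains_max => //.
    have [C [_ HC]] : bounded_set (Q @` usphere).
      apply: compact_bounded; apply: continuous_compact => //.
      by apply: continuous_subspaceT.
    exists (`|C| + 1) => x sx; have := HC (`|C| + 1) (ltac:(rewrite (le_lt_trans (ler_norm _))// ltrDl//)) (Q x).
    by move=> /(_ (ltac:(by exists x))) /=; rewrite ler_norml; lra.
  move=> x c _ xc; have xc' : 0 < c + Q x by lra.
  have /cvgrPdist_lt/(_ _ xc') := cQ x; apply: filterS => y + _.
  by rewrite ltr_norml; lra.
set m := Q y0.
have Qm y : m * enorm y ^+ 2 <= Q y.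
  have [y_0|y_0] := eqVneq (enorm y) 0.
    rewrite (enorm_eq0 y_0) /Q mul0mx enorm0 expr0n mulr0 /= /dot big1// => i _.
    by rewrite mxE mul0r.
  have yp : 0 < enorm y by rewrite lt_neqAle eq_sym y_0 enorm_ge0.
  have := miny0 ((enorm y)^-1 *: y).
  rewrite /usphere /= enormZ ger0_norm ?invr_ge0 ?enorm_ge0// mulVf// => /(_ erefl).
  rewrite lerN2 -/m /Q -scalemxAl dotZl dotZr -/(Q y) mulrA -expr2 exprVn mulrC.
  by rewrite ler_pdivlMr ?exprn_gt0.
exists m => //; apply: posH; apply/eigenvalueP; exists y0; last first.
  apply/eqP => y00; move: sy0; rewrite /usphere /= y00 enorm0 => /eqP.
  by rewrite eq_sym oner_eq0.
apply/eqP; rewrite -subr_eq0; apply/eqP; apply: enorm_eq0; apply/eqP.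
rewrite -[_ == 0](expf_eq0 _ 2) -dotvv.
set v := y0 *m H - m *: y0.
have sB : dot (v *m H) y0 = dot (y0 *m H) v by rewrite dot_mulmx symH dotC.
have Ev : dot v v = dot (y0 *m H) v - m * dot y0 v.
  by rewrite {1}/v dotDl -scaleNr dotZl; ring.
clearbody v.
have poly (t : R) : 0 <= 2 * t * dot v v + t ^+ 2 * (Q v - m * enorm v ^+ 2).
  have := Qm (y0 + t *: v); rewrite /Q mulmxDl -scalemxAl !(dotDl, dotDr, dotZl, dotZr) sB.
  rewrite enormD_sqr sy0 dotZr enormZ exprMn real_normK ?num_real// -/(Q y0) -/m -/(Q v) Ev.
  lra.
rewrite eq_le; apply/andP; split; last by rewrite dotvv sqr_ge0.
rewrite leNgt; apply/negP => v0.
have D0 : 0 <= Q v - m * enorm v ^+ 2 by rewrite subr_ge0.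
set D := Q v - _ in poly D0.
have := poly (- (dot v v / (D + 1))).
have D1 : 0 < D + 1 by lra.
have -> : 2 * - (dot v v / (D + 1)) * dot v v + (- (dot v v / (D + 1))) ^+ 2 * D =
    - (dot v v / (D + 1)) * (dot v v * ((D + 2) / (D + 1))).
  by field; rewrite gt_eqF.
rewrite mulNr oppr_ge0 leNgt => /negP; apply.
by rewrite mulr_gt0 ?divr_gt0// mulr_gt0 ?divr_gt0//; lra.
Qed.

Lemma double_sum_cst {R : realType} (n : nat) (x : R) :
  \sum_(i < n) \sum_(j < n) x = x * (n * n)%:R.
Proof. by rewrite !sumr_const !card_ord -mulrnA mulr_natr. Qed.

(** The second derivative along [y] is at least [c / 2 * enorm y ^+ 2] near the origin, hence the first one
    at [t y] at least [t] times this. As the mean value on the whole segment may lie close to 0,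
    it is taken on the second half of the segment. *)
Lemma paraboloid_below {R : realType} {n : nat} (gamma : 'rV[R]_n -> R) : Ck 2 gamma ->
  gamma 0 = 0 -> (forall v, 'D_v gamma 0 = 0) ->
  (forall k, eigenvalue (hessian gamma 0) k -> 0 < k) ->
  exists c d : R, [/\ 0 < c, 0 < d & forall y, enorm y < d -> c * enorm y ^+ 2 <= gamma y].
Proof.
move=> C2 g0 flat pos.
pose H := hessian gamma 0.
have symH : H^T = H by apply/matrixP => i j; rewrite !mxE; exact: derive_swap.
have [c c0 Hc] := posdef_of_eigenvalues symH pos.
have [_ _ C1] := C2.
pose eps := c / (2 * (n.+1%:R ^+ 2)).
have n0 : 0 < n.+1%:R ^+ 2 :> R by rewrite exprn_gt0.
have eps0 : 0 < eps by rewrite divr_gt0// mulr_gt0.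
pose e i : 'rV[R]_n := delta_mx 0 i.
have near : \forall w \near (0 : 'rV[R]_n), forall i j,
    `|'D_(e i) ('D_(e j) gamma) 0 - 'D_(e i) ('D_(e j) gamma) w| < eps.
  have Hij i j : \forall w \near (0 : 'rV[R]_n),
      `|'D_(e i) ('D_(e j) gamma) 0 - 'D_(e i) ('D_(e j) gamma) w| < eps.
    have [_ _ C0] := C1 (e j); have cij := C0 (e i).
    by have /cvgrPdist_lt/(_ _ eps0) := cij 0.
  exact: (@filter_forall _ 'I_n _ _ (nbhs_filter _)
    (fun i => @filter_forall _ 'I_n _ _ (nbhs_filter _) (Hij i))).
have /nbhs_normP[d /= d0 Hd] : nbhs (0 : 'rV[R]_n : normedModType R) _ := near.
have second y w : `|w| < d -> c / 2 * enorm y ^+ 2 <= 'D_y ('D_y gamma) w.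
  move=> wd; have {}Hd := Hd w; rewrite /ball_ /= sub0r normrN in Hd; have {}Hd := Hd wd.
  have D2 := @derive2_lincomb R 'rV[R]_n gamma w n (fun i => y 0 i) e C2.
  rewrite /= -(row_sum_delta y) in D2; rewrite D2.
  have {}Hc := Hc y.
  have E : dot (y *m H) y = \sum_i \sum_j y 0 i * y 0 j * 'D_(e i) ('D_(e j) gamma) 0.
    rewrite /dot exchange_big /=; apply: eq_bigr => j _; rewrite mxE mulr_suml.
    by apply: eq_bigr => i _; rewrite mxE /=; ring.
  rewrite E in Hc.
  have aux (p q Y : R) : c * Y <= p -> p - q <= c / 2 * Y -> c / 2 * Y <= q by clear; lra.
  apply: (aux _ _ _ Hc).
  rewrite -sumrB; under eq_bigr do rewrite -sumrB.
  apply: (@le_trans _ _ (\sum_(i < n) \sum_(j < n) eps * enorm y ^+ 2)).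
    apply: ler_sum => i _; apply: ler_sum => j _; rewrite -mulrBr.
    apply: le_trans (ler_norm _) _; rewrite normrM mulrC; apply: ler_pM => //.
      exact/ltW/Hd.
    by rewrite normrM expr2; apply: ler_pM => //; exact: coord_le_enorm.
  rewrite double_sum_cst.
  have aux2 (m : R) : m != 0 -> c / 2 = c / (2 * m) * m by move=> m0; field.
  have epsn : eps * (n * n)%:R <= c / 2.
    have -> : c / 2 = eps * n.+1%:R ^+ 2 by apply: aux2; rewrite gt_eqF.
    by rewrite ler_pM2l// expr2 -natrM ler_nat leq_mul.
  by rewrite mulrAC ler_wpM2r ?sqr_ge0.
exists (c / 8), d; split => //; first by rewrite divr_gt0.
move=> y yd.
have yd' : `|y| < d by apply: le_lt_trans (norm_le_enorm y) yd.
have C1g : Ck 1 gamma := CkW C2.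
have slope (t : R) : 0 < t -> t < 1 -> t * (c / 2 * enorm y ^+ 2) <= 'D_y gamma (t *: y).
  move=> t0 t1; have [q /andP[q0 qt]] := MVT_line 0 y (C1 y) t0.
  rewrite !add0r flat subr0 => ->; rewrite ler_pM2l//; apply: second.
  rewrite normrZ gtr0_norm//; apply: le_lt_trans yd'; rewrite ler_piMl//.
  by rewrite ltW// (lt_trans qt t1).
have y2 : 0 <= enorm y ^+ 2 := sqr_ge0 _.
have h0 : (0 : R) < 2^-1 by rewrite invr_gt0.
have [q1 /andP[q10 q1h]] := MVT_line 0 y C1g h0.
have [q2 /andP[q20 q2h]] := MVT_line (2^-1 *: y) y C1g h0.
rewrite !add0r g0 subr0 -!scalerDl => E2 E1.
have Eh : (2^-1 : R) + 2^-1 = 1 by field.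
move: E2; rewrite Eh scale1r => E2.
have q12 : 0 < 2^-1 + q2 < 1 by apply/andP; split; clear -q20 q2h; lra.
have /andP[p0 p1] := q12.
have := slope _ p0 p1; have := slope q1 q10 (ltac:(clear -q1h; lra)).
have := mulr_ge0 (ltW q10) (mulr_ge0 (ltW (divr_gt0 c0 (ltr0n R 2))) y2).
have : 2^-1 * (c / 2 * enorm y ^+ 2) <= (2^-1 + q2) * (c / 2 * enorm y ^+ 2).
  apply: ler_wpM2r; last by clear -q20; lra.
  by rewrite mulr_ge0// divr_ge0// ltW.
move: E1 E2; set a1 := 'D_y gamma _; set a2 := 'D_y gamma _.
by clear; move: a1 a2 => p q; lra.
Qed.

(** The square matrix with rows [nu] and those of [E] is orthogonal, so its columns are orthonormal as
    well as its rows. *)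
Lemma orthonormal_chart {R : realType} {n : nat} (E : 'M[R]_(n, n.+1)) (nu : 'rV[R]_n.+1) :
  E *m E^T = 1%:M -> E *m nu^T = 0 -> nu *m nu^T = 1%:M ->
  (forall v, v = (v *m E^T) *m E + dot v nu *: nu) /\
  (forall y h, enorm (y *m E + h *: nu) ^+ 2 = enorm y ^+ 2 + h ^+ 2).
Proof.
move=> EE En nn.
have dotE k (a b : 'rV[R]_k) : a *m b^T = (dot a b)%:M.
  rewrite [LHS]mx11_scalar; congr (_%:M); rewrite mxE; apply: eq_bigr => i _; by rewrite mxE.
have nE : nu *m E^T = 0 by rewrite -[LHS]trmxK trmx_mul trmxK En trmx0.
split=> [v|y h]; last first.
  rewrite -!dotvv !(dotDl, dotDr, dotZl, dotZr).
  have -> : dot (y *m E) (y *m E) = dot y y by rewrite dot_mulmx -mulmxA EE mulmx1.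
  have -> : dot (y *m E) nu = 0.
    by rewrite dot_mulmx nE /dot big1// => i _; rewrite mxE mulr0.
  have -> : dot nu (y *m E) = 0.
    by rewrite dotC dot_mulmx nE /dot big1// => i _; rewrite mxE mulr0.
  have -> : dot nu nu = 1.
    have := congr1 (fun A : 'M[R]_1 => A 0 0) nn; rewrite dotE !mxE eqxx /= mulr1n; exact.
  by ring.
pose P : 'M[R]_(1 + n, n.+1) := col_mx nu E.
have PP : P *m P^T = 1%:M.
  rewrite tr_col_mx mul_col_row nn En nE EE.
  by rewrite -scalar_mx_block.
have PtP : P^T *m P = 1%:M by exact: mulmx1C.
rewrite -[LHS](mulmx1 v) -PtP tr_col_mx mulmxA mul_mx_row mul_row_col addrC; congr (_ + _).
by rewrite dotE mul_scalar_mx.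
Qed.

Lemma boundaryP {R : realType} {N : nat} (Omega : set 'rV[R]_N) z : open Omega ->
  boundary Omega z <-> closure Omega z /\ ~ Omega z.
Proof.
move=> oO; rewrite /boundary; suff -> : Omega° = Omega by [].
by apply/seteqP; split; [exact: interior_subset|rewrite -open_subsetE].
Qed.

Lemma closure_enorm {R : realType} {N : nat} (A : set 'rV[R]_N) z :
  closure A z <-> forall e : R, 0 < e -> exists2 p, A p & enorm (p - z) < e.
Proof.
have N1 : 0 < N.+1%:R :> R by rewrite ltr0n.
split=> [cz e e0|H B].
  have nz := @near_norm_lt R 'rV[R]_N z _ (divr_gt0 e0 N1).
  have [p [Ap /=]] := cz _ nz.
  rewrite ltr_pdivlMr// mulrC => pz; exists p => //.
  exact: le_lt_trans (enorm_le_norm _) pz.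
move=> /(nbhs_normP (V := 'rV[R]_N))[e /= e0 He]; have [p Ap pz] := H e e0.
exists p; split => //; apply: He; rewrite /ball_ /= distrC.
exact: le_lt_trans (norm_le_enorm _) pz.
Qed.

(** Near [z] the set lies inside a ball which is tangent to the hyperplane orthogonal to [nu] at [z]. *)
Definition tangent_ball {R : realType} {N : nat} (Omega : set 'rV[R]_N) z (nu : 'rV[R]_N) (A r : R) : Prop :=
  [/\ 0 < A, 0 < r &
    forall p, Omega p -> enorm (p - z) < r -> enorm (p - z) ^+ 2 <= A * dot (p - z) nu].

(** In the chart the domain is above the graph of a function that dominates a paraboloid, since its
    Hessian has positive eigenvalues. *)
Lemma local_tangent_ball {R : realType} {n : nat} (Omega : set 'rV[R]_n.+1) z : open Omega ->
  C2_boundary Omega ->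
  (forall z kappa, boundary Omega z -> principal_curvature Omega z kappa -> 0 < kappa) ->
  boundary Omega z ->
  exists nu (A r : R), tangent_ball Omega z nu A r.
Proof.
move=> oO C2 curv bz; have [E [nu [gamma [r chart]]]] := C2 z bz.
have [/= [EE En nn] r0 C2g flat graph] := chart.
have cg : continuous gamma by case: C2g.
have [decomp norms] := orthonormal_chart EE En nn.
have /(boundaryP _ oO)[cz nOz] := bz.
have graphp p : enorm (p - z) < r -> Omega p <-> gamma ((p - z) *m E^T) < dot (p - z) nu.
  move=> pr; have := graph ((p - z) *m E^T) (dot (p - z) nu).
  by rewrite -decomp [z + _]addrC subrK => H; apply: H.
have coordy p : enorm ((p - z) *m E^T) <= enorm (p - z).
  rewrite -(@ler_pXn2r _ 2)// ?nnegrE ?enorm_ge0// [in leRHS](decomp (p - z)) norms lerDl.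
  exact: sqr_ge0.
have coordh p : `|dot (p - z) nu| <= enorm (p - z).
  rewrite -(@ler_pXn2r _ 2)// ?nnegrE ?enorm_ge0// [in leRHS](decomp (p - z)) norms.
  by rewrite real_normK ?num_real// lerDr sqr_ge0.
have g0 : gamma 0 = 0.
  apply/eqP; rewrite eq_le; apply/andP; split.
    apply/ler_addgt0Pr => e e0; rewrite add0r; have e2 : 0 < e / 2 by lra.
    have [d d0 Hd] := continuous_modulus 0 cg e2.
    have m0 : 0 < Num.min (Num.min d r) (e / 2) by rewrite !lt_min d0 r0.
    have [p Op] := (closure_enorm _ _).1 cz _ m0.
    rewrite !lt_min => /andP[/andP[pd pr] pe].
    have := (graphp p pr).1 Op; have := coordh p; rewrite ler_norml.
    have := Hd ((p - z) *m E^T); rewrite sub0r normrN.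
    move=> /(_ (le_lt_trans (norm_le_enorm _) (le_lt_trans (coordy p) pd))).
    by rewrite ltr_norml; clear -pe; lra.
  rewrite leNgt; apply/negP => lt; apply: nOz; apply: (graphp z _).2; rewrite subrr ?enorm0//.
  by rewrite mul0mx /dot big1// => i _; rewrite mxE mul0r.
have [c [d [c0 d0 Hc]]] := paraboloid_below C2g g0 flat
  (fun k ek => curv z k bz (ex_intro _ E (ex_intro _ nu (ex_intro _ gamma (ex_intro _ r (conj chart ek)))))).
exists nu, (c^-1 + r), (Num.min d r); split.
- by rewrite addr_gt0 ?invr_gt0.
- by rewrite lt_min d0.
move=> p Op; rewrite lt_min => /andP[pd pr].
have ph := (graphp p pr).1 Op.
have yc := Hc _ (le_lt_trans (coordy p) pd).
have y0 := sqr_ge0 (enorm ((p - z) *m E^T)).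
have hr : dot (p - z) nu <= r by apply: le_trans (ler_norm _) _; apply: le_trans (coordh p) (ltW pr).
rewrite {1}(decomp (p - z)) norms mulrDl.
set Y := enorm _ ^+ 2 in yc y0 *; set h := dot (p - z) nu in ph hr *.
have cY : 0 <= c * Y by rewrite mulr_ge0// ltW.
apply: lerD; first by rewrite mulrC ler_pdivlMr// mulrC; clear -yc ph; lra.
by rewrite expr2 ler_wpM2r//; clear -yc ph cY; lra.
Qed.

(** * From local to global convexity *)

Lemma tangent_ball_closure {R : realType} {N : nat} (Omega : set 'rV[R]_N) z nu (A r : R) :
  tangent_ball Omega z nu A r -> tangent_ball (closure Omega) z nu A r.
Proof.
move=> [A0 r0 H]; split => // p cp pr.
pose f (q : 'rV[R]_N) : R := \sum_i (A * ((q 0 i - z 0 i) * nu 0 i) + -1 * ((q 0 i - z 0 i) * (q 0 i - z 0 i))).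
have fE q : f q = A * dot (q - z) nu - enorm (q - z) ^+ 2.
  rewrite sqr_enorm /dot mulr_sumr -sumrB; apply: eq_bigr => i _.
  by rewrite !mxE; ring.
have cf : continuous f.
  have cc i : Ck 0 (fun y : 'rV[R]_N => y 0 i - z 0 i).
    by apply: (@CkD _ _ 0); [exact: coord_continuous|exact: (@Ck_cst _ _ 0)].
  apply: (@Ck_sum _ _ 0) => i; apply: (@CkD _ _ 0); apply: (@CkM _ _ 0).
  - exact: (@Ck_cst _ _ 0).
  - by apply: (@CkM _ _ 0) => //; exact: (@Ck_cst _ _ 0).
  - exact: (@Ck_cst _ _ 0).
  - exact: (@CkM _ _ 0).
rewrite -subr_ge0 -fE leNgt; apply/negP => f0.
have f0' : 0 < - f p by rewrite oppr_gt0.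
have [d d0 Hd] := continuous_modulus p cf f0'.
have m0 : 0 < Num.min d (r - enorm (p - z)) by rewrite lt_min d0 subr_gt0.
have [q Oq] := (closure_enorm _ _).1 cp _ m0.
rewrite lt_min => /andP[qd qr].
have qz : enorm (q - z) < r.
  by rewrite -(subrKA p); apply: le_lt_trans (enormD _ _) _; clear -qr; lra.
have := H q Oq qz; rewrite -subr_ge0 -fE.
have := Hd q; rewrite distrC => /(_ (le_lt_trans (norm_le_enorm _) qd)).
by rewrite ltr_norml; clear; lra.
Qed.

(** The points of the domain which are seen from [p] along a segment form an open set. It is closed in
    the domain: a limit of such segments lies in the closure and, at a boundary point in its
    relative interior, would contain points on both sides of the tangent hyperplane. *)
Lemma convex_of_tangent_balls {R : realType} {N : nat} (Omega : set 'rV[R]_N) :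
  open Omega -> connected Omega ->
  (forall z, boundary Omega z -> exists nu (A r : R), tangent_ball Omega z nu A r) ->
  forall p q (t : R), Omega p -> Omega q -> 0 <= t <= 1 -> Omega (p + t *: (q - p)).
Proof.
move=> oO conn tb p0 q0 t0 Op Oq t01.
pose S := [set q | Omega q /\ forall t : R, 0 <= t <= 1 -> Omega (p0 + t *: (q - p0))].
suff SE : S = Omega by have : S q0; [rewrite SE|move=> [_]; exact].
apply: conn.
- by exists p0; split => // t _; rewrite subrr scaler0 addr0.
- exists S; last by apply/seteqP; split => [q [Oq' ?]|q [] //]; split.
  rewrite openE => q [Oq' Sq]; rewrite /interior.
  suff : exists2 e : R, 0 < e & forall q', `|q' - q| < e ->
      forall t : R, 0 <= t <= 1 -> Omega (p0 + t *: (q' - p0)).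
    move=> [e e0 He]; apply: filterS (near_norm_lt q e0) => q' q'q.
    split; last exact: He.
    by have := He q' q'q 1; rewrite ler01 lexx scale1r addrC subrK; exact.
  apply: contrapT => no.
  pose D (e : R) (t : R) := exists2 q', `|q' - q| < e & ~ Omega (p0 + t *: (q' - p0)).
  have Dmono e e' t : e <= e' -> D e t -> D e' t.
    by move=> ee [q' q'q nO]; exists q' => //; exact: lt_le_trans ee.
  have Dex e : 0 < e -> exists2 t, `[0, 1]%classic t & D e t.
    move=> e0; apply: contrapT => H; apply: no; exists e => // q' q'q t tt.
    apply: contrapT => nO; apply: H; exists t; first by rewrite /= in_itv.
    by exists q'.
  have [ts] := compact_selection (@segment_compact R 0 1) Dmono Dex.
  rewrite /= in_itv /= => tss Hts.
  have /(nbhs_normP (V := 'rV[R]_N))[e /= e0 He] : nbhs (p0 + ts *: (q - p0)) Omega.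
    by apply: open_nbhs_nbhs; split => //; exact: Sq.
  have qp : 0 < `|q - p0| + 1 by rewrite ltr_wpDl.
  have e1 : 0 < Num.min 1 (e / 4 / (`|q - p0| + 1)) by rewrite lt_min ltr01 !divr_gt0.
  have e4 : 0 < e / 4 by rewrite divr_gt0.
  have [t tts [q' q'q]] := Hts _ (near_norm_lt (V := R) ts e1) _ e4; apply.
  apply: He; rewrite /ball_ /=.
  have -> : p0 + ts *: (q - p0) - (p0 + t *: (q' - p0)) =
      (ts - t) *: (q - p0) + t *: (q - q') by apply/rowP => i; rewrite !mxE; ring.
  move: tts => /=; rewrite lt_min => /andP[t1 te].
  have T2 : `|t| <= 2 by move: t1 tss; rewrite ltr_norml ler_norml; clear; lra.
  have B1 : `|(ts - t) *: (q - p0)| <= e / 4.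
    rewrite normrZ distrC; apply: (@le_trans _ _ (`|t - ts| * (`|q - p0| + 1))).
      by rewrite ler_wpM2l// lerDl.
    by rewrite -ler_pdivlMr// ltW.
  have B2 : `|t *: (q - q')| <= 2 * (e / 4).
    by rewrite normrZ distrC; apply: ler_pM => //; exact: ltW.
  by apply: le_lt_trans (ler_normD _ _) _; clear -B1 B2 e0; lra.
- exists (closure S); first exact: closed_closure.
  apply/seteqP; split => [q Sq|q [Oq' cS]]; first by split; [case: Sq|exact: subset_closure].
  split => //.
  have clO (t : R) : 0 <= t <= 1 -> closure Omega (p0 + t *: (q - p0)).
    move=> tt; apply/closure_enorm => e e0.
    have [q' [Oq'' Sq'] q'q] := (closure_enorm _ _).1 cS _ e0.
    exists (p0 + t *: (q' - p0)); first exact: Sq'.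
    have -> : p0 + t *: (q' - p0) - (p0 + t *: (q - p0)) = t *: (q' - q).
      by apply/rowP => i; rewrite !mxE; ring.
    have /andP[t_0 t_1] := tt.
    rewrite enormZ ger0_norm//; apply: le_lt_trans q'q.
    by rewrite ler_piMl// enorm_ge0.
  move=> t tt; apply: contrapT => nO.
  pose z := p0 + t *: (q - p0); pose d := q - p0.
  have [nu [A [r /tangent_ball_closure[A0 r0 H]]]] := tb z ((boundaryP _ oO).2 (conj (clO t tt) nO)).
  have d0 : 0 < enorm d.
    rewrite lt_neqAle enorm_ge0 andbT eq_sym; apply/eqP => /enorm_eq0 d0.
    by apply: nO; rewrite -/d d0 scaler0 addr0.
  have tn0 : t != 0 by apply/eqP => t00; apply: nO; rewrite t00 scale0r addr0.
  have tn1 : t != 1 by apply/eqP => t00; apply: nO; rewrite t00 scale1r addrC subrK.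
  have /andP[t_0 t_1] := tt.
  have tp : 0 < t by rewrite lt_neqAle eq_sym tn0.
  have tl : t < 1 by rewrite lt_neqAle tn1.
  pose h := Num.min (Num.min t (1 - t)) (r / 2 / enorm d).
  have h0 : 0 < h by rewrite /h !lt_min tp subr_gt0 tl !divr_gt0.
  have [ht [ht1 hr]] : h <= t /\ h <= 1 - t /\ h <= r / 2 / enorm d.
    by rewrite /h !ge_min !lexx ?orbT.
  have hd : h * enorm d < r by move: hr; rewrite ler_pdivlMr//; clear -r0; lra.
  have touch (sg : R) : `|sg| = 1 -> (h * enorm d) ^+ 2 <= A * (sg * h * dot d nu).
    move=> sg1; have := H (p0 + (t + sg * h) *: d).
    have -> : p0 + (t + sg * h) *: d - z = (sg * h) *: d.
      by rewrite /z /d; apply/rowP => i; rewrite !mxE; ring.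
    rewrite enormZ dotZl normrM sg1 mul1r gtr0_norm//; apply => //; apply: clO.
    have : sg * h <= h by apply: le_trans (ler_norm _) _; rewrite normrM sg1 mul1r gtr0_norm.
    have : - (sg * h) <= h by apply: le_trans (ler_norm _) _; rewrite normrN normrM sg1 mul1r gtr0_norm.
    by clear -ht ht1; lra.
  have := touch 1 (normr1 _); have := touch (-1) (normrN1 _).
  have : 0 < (h * enorm d) ^+ 2 by rewrite exprn_gt0// mulr_gt0.
  by clear; lra.
Qed.

(** A point [p] of the domain is moved towards [z] until it is close to [z], which by convexity keeps
    it in the closure; the local inequality there is homogeneous up to the factor of the
    contraction, which is bounded below as the domain is bounded. *)
Lemma global_tangent_ball {R : realType} {n : nat} (Omega : set 'rV[R]_n.+1) z :
  bounded_strictly_convex_domain Omega -> boundary Omega z ->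
  exists a, forall p, Omega p -> enorm (p - z) ^+ 2 <= dot (p - z) a.
Proof.
move=> [[oO conn _] bO C2 curv] bz.
have tb z' : boundary Omega z' -> exists nu (A r : R), tangent_ball Omega z' nu A r.
  by move=> bz'; exact: local_tangent_ball.
have conv := convex_of_tangent_balls oO conn tb.
have [nu [A [r /tangent_ball_closure[A0 r0 H]]]] := tb z bz.
have [B [_ HB]] := bO.
have [cz _] := (boundaryP _ oO).1 bz.
pose B' := n.+2%:R * (`|B| + 1 + `|z|).
have B'0 : 0 < B' by rewrite mulr_gt0// ltr_wpDr.
have OB p : Omega p -> enorm (p - z) <= B'.
  move=> Op; apply: le_trans (enorm_le_norm _) _; rewrite ler_wpM2l//.
  apply: le_trans (ler_normB _ _) _; rewrite lerD2r.
  by apply: (HB (`|B| + 1)) => //; rewrite (le_lt_trans (ler_norm B))// ltrDl.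
pose l := Num.min 1 (r / 2 / B').
have l0 : 0 < l by rewrite lt_min ltr01 !divr_gt0.
have [l1 lr] : l <= 1 /\ l <= r / 2 / B' by rewrite !ge_min !lexx orbT.
exists ((A / l) *: nu) => p Op.
have cp : closure Omega (z + l *: (p - z)).
  apply/closure_enorm => e e0; have [q Oq qz] := (closure_enorm _ _).1 cz _ e0.
  exists (q + l *: (p - q)); first by apply: conv => //; rewrite (ltW l0).
  have -> : q + l *: (p - q) - (z + l *: (p - z)) = (1 - l) *: (q - z).
    by apply/rowP => i; rewrite !mxE; ring.
  rewrite enormZ ger0_norm ?subr_ge0//; apply: le_lt_trans qz.
  by rewrite ler_piMl ?enorm_ge0// gerBl ltW.
have := H _ cp; rewrite addrAC subrr add0r enormZ gtr0_norm// dotZl dotZr => H'.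
have lpr : l * enorm (p - z) < r.
  apply: (@le_lt_trans _ _ (r / 2)); last by clear -r0; lra.
  apply: (@le_trans _ _ (l * B')); first by rewrite ler_pM2l// OB.
  by rewrite -ler_pdivlMr.
have {}H' := H' lpr.
have l20 : 0 < l ^+ 2 by rewrite exprn_gt0.
rewrite -(ler_pM2l l20) -exprMn; apply: (le_trans H').
rewrite expr2; have -> : l * l * (A / l * dot (p - z) nu) = A * (l * dot (p - z) nu).
  by field; rewrite gt_eqF.
exact: lexx.
Qed.

(** * Boundedness of the datum *)

Local Notation mu := lebesgue_measure.

Definition ocons {R : realType} {n : nat} (t : R) (y : 'I_n -> R) (i : 'I_n.+1) : R :=
  if unlift ord0 i is Some j then y j else t.

(** A countable cover of a box by boxes has at least the volume of the box. By induction on the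
    dimension: the slice at [t] is covered by the slices of the boxes that meet it, selected by
    [J], and the resulting inequality is integrated over the first coordinate. The selection is
    part of the statement because a 0-dimensional box has volume 1 and cannot be discarded as
    degenerate. *)
Lemma box_cover_volume {R : realType} (n : nat) (a b : 'I_n -> R) (c d : nat -> 'I_n -> R) (J : nat -> bool) :
  (forall i, a i <= b i) -> (forall k i, c k i <= d k i) ->
  (forall x : 'I_n -> R, (forall i, a i <= x i <= b i) ->
     exists2 k, J k & forall i, c k i <= x i <= d k i) ->
  ((\prod_i (b i - a i))%:E <=
   \sum_(0 <= k <oo) (if J k then \prod_i (d k i - c k i) else 0)%:E)%E.
Proof.
have pos m (c' d' : nat -> 'I_m -> R) (J' : nat -> bool) : (forall k i, c' k i <= d' k i) ->
    forall k, (0 <= (if J' k then \prod_i (d' k i - c' k i) else 0)%:E)%E.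
  by move=> cd k; rewrite lee_fin; case: ifP => // _; apply: prodr_ge0 => i _; rewrite subr_ge0.
elim: n a b c d J => [|n IH] a b c d J ab cd cover.
  have [k Jk _] := cover (fun=> 0) (ltac:(by case)).
  rewrite big_ord0; apply: le_trans (nneseries_lim_ge k.+1 _); last by move=> i _ _; exact: pos.
  rewrite big_nat_recr//= Jk big_ord0; apply: leeDr.
  by apply: sume_ge0 => i _; exact: pos.
pose V := \prod_i (b (lift ord0 i) - a (lift ord0 i)).
pose W k := \prod_i (d k (lift ord0 i) - c k (lift ord0 i)).
pose D : set R := `[a ord0, b ord0]%classic.
pose f k (t : R) : \bar R := ((if J k then W k else 0) * \1_(`[c k ord0, d k ord0]%classic : set R) t)%:E.
have slice t : D t -> (V%:E <= \sum_(0 <= k <oo) f k t)%E.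
  rewrite /D /= in_itv/= => Dt.
  have := IH (fun i => a (lift ord0 i)) (fun i => b (lift ord0 i)) (fun k i => c k (lift ord0 i))
    (fun k i => d k (lift ord0 i)) (fun k => J k && (c k ord0 <= t <= d k ord0)).
  move=> /(_ (fun i => ab _) (fun k i => cd k _)) H.
  apply: (le_trans (H _)).
    move=> y yab; have [|k Jk Hk] := cover (ocons t y).
      move=> i; rewrite /ocons; case: unliftP => [j ->|->] //.
    exists k; first by rewrite Jk /=; have := Hk ord0; rewrite /ocons unlift_none.
    by move=> i; have := Hk (lift ord0 i); rewrite /ocons liftK.
  apply: lee_nneseries => k.
    by move=> _ _; rewrite lee_fin; case: ifP => // _; apply: prodr_ge0 => i _; rewrite subr_ge0.
  move=> _; rewrite /f lee_fin indicE mem_setE in_itv /=.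
  by case: (J k); case: (_ <= t <= _); rewrite /= ?mulr1 ?mulr0.
have W0 k : 0 <= W k by apply: prodr_ge0 => i _; rewrite subr_ge0.
have f0 k t : (0 <= f k t)%E.
  by rewrite lee_fin mulr_ge0//; case: ifP.
have mf k : measurable_fun setT (f k).
  by apply/measurable_EFinP; apply: measurable_funM => //; exact: measurable_indic.
have mD : measurable D by exact: measurable_itv.
have mfD k : measurable_fun D (f k) by apply: measurable_funTS; exact: mf.
have mI k : measurable_fun setT (fun t : R => (\1_(`[c k ord0, d k ord0]%classic : set R) t)%:E).
  by apply/measurable_EFinP; exact: measurable_indic.
have mS : measurable_fun D (fun t : R => \sum_(0 <= k <oo) f k t)%E.
  by apply: (ge0_emeasurable_sum (P := xpredT)) => [k x _ _|k _]; [exact: f0|apply: measurable_funTS; exact: mf].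
rewrite big_ord_recl -/V mulrC.
have muI (x y : R) : x <= y -> mu (`[x, y]%classic : set R) = (y - x)%:E.
  move=> xy; rewrite lebesgue_measure_itv/= lte_fin; case: ltP => // yx.
  have -> : x = y by apply/eqP; rewrite eq_le xy.
  by rewrite subrr.
have -> : (V * (b ord0 - a ord0))%:E = (\int[mu]_(t in D) V%:E)%E.
  rewrite integral_cst// EFinM; congr (_ * _)%E.
  by apply: esym; apply: muI.
apply: (@le_trans _ _ (\int[mu]_(t in D) \sum_(0 <= k <oo) f k t)%E).
  apply: ge0_le_integral => //.
  - by move=> t _; rewrite lee_fin; apply: prodr_ge0 => i _; rewrite subr_ge0.
rewrite integral_nneseries//.
apply: lee_nneseries => k; first by move=> _ _; exact: integral_ge0.
move=> _; apply: (@le_trans _ _ (\int[mu]_t f k t)%E).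
  by apply: ge0_subset_integral => //; exact: mf.
rewrite /f; under eq_integral do rewrite EFinM.
rewrite ge0_integralZl//; last 2 first.
- exact: (mI R).
- by rewrite lee_fin; case: ifP.
rewrite integral_indic// setIT.
refine (eq_ind_r (fun z => ((if J k then W k else 0)%:E * z <= _)%E) _ (muI _ _ (cd k ord0))).
rewrite -EFinM lee_fin big_ord_recl -/(W k) mulrC.
by case: (J k); rewrite ?mulr0.
Qed.

Lemma lebesgue_outer_box {R : realType} {N : nat} (A : set 'rV[R]_N) (a b : 'rV[R]_N) :
  (forall i, a 0 i < b 0 i) -> box a b `<=` A -> (0 < lebesgue_outer A)%E.
Proof.
move=> ab bA.
have V0 : 0 < \prod_i (b 0 i - a 0 i) by apply: prodr_gt0 => i _; rewrite subr_gt0.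
apply: (@lt_le_trans _ _ (\prod_i (b 0 i - a 0 i))%:E); first by rewrite lte_fin.
apply: le_ereal_inf_tmp => _ [c [d [cd cover ->]]].
apply: (@box_cover_volume _ _ (fun i => a 0 i) (fun i => b 0 i) (fun k i => c k 0 i) (fun k i => d k 0 i)
  (fun=> true)).
- by move=> i; exact/ltW.
- exact: cd.
- move=> x xab; have [|k _ Hk] := cover (\row_i x i).
    by apply: bA => i; rewrite mxE.
  by exists k => // i; have := Hk i; rewrite mxE.
Qed.

(** A continuous function exceeding an almost everywhere bound does so on a box, and boxes are not
    negligible. *)
Lemma ae_bound_open {R : realType} {N : nat} (A : set 'rV[R]_N) (u g : 'rV[R]_N -> R) (M : R) x :
  continuous u -> (forall y, A y -> u y = g y) ->
  ae_on A (fun x => (`|(g x)%:E| <= M%:E)%E) -> A° x -> `|u x| <= M.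
Proof.
move=> cu ug ae /(nbhs_normP (V := 'rV[R]_N))[d /= d0 Hd].
rewrite leNgt; apply/negP => Mu.
have e0 : 0 < `|u x| - M by rewrite subr_gt0.
have [d' d'0 Hd'] := continuous_modulus x cu e0.
pose r := Num.min d d' / 2.
have r0 : 0 < r by rewrite divr_gt0// lt_min d0.
have rd : r < Num.min d d' by rewrite /r ltr_pdivrMr// ltr_pMr// ?ltr1n// lt_min d0.
move: rd; rewrite lt_min => /andP[rd rd'].
suff : (0 < lebesgue_outer (A `&` [set x | ~ (`|(g x)%:E| <= M%:E)%E]))%E by rewrite ae ltxx.
apply: (@lebesgue_outer_box _ _ _ (\row_i (x 0 i - r)) (\row_i (x 0 i + r))).
  by move=> i; rewrite !mxE; lra.
move=> y yr; have xy : `|x - y| <= r.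
  apply: norm_le_coord => [|i]; first exact: ltW.
  by have := yr i; rewrite !mxE ler_norml; lra.
have Ay : A y by apply: Hd; exact: le_lt_trans rd.
split => //=; rewrite lee_fin -ug//; apply/negP; rewrite -ltNge.
have := Hd' y (le_lt_trans xy rd'); have := ler_normD (u x - u y) (u y).
by rewrite subrK; lra.
Qed.

(** Outside a large ball the points are interior to the exterior of the domain, where the essential bound
    of [g] holds everywhere; the ball is compact. *)
Lemma datum_bounded {R : realType} {N : nat} (Omega : set 'rV[R]_N) (u0 g : 'rV[R]_N -> R) :
  bounded_set Omega -> continuous u0 -> (forall x, ~ Omega x -> u0 x = g x) ->
  Linfty (~` Omega) (fun x => (g x)%:E) ->
  exists M : R, forall x, `|u0 x| <= M.
Proof.
move=> [B [_ HB]] cu ug [_ [M ae]].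
pose B' := `|B| + 1.
have OB x : Omega x -> `|x| <= B'.
  by apply: HB; rewrite (le_lt_trans (ler_norm B))// ltrDl.
have ccu : continuous (fun z : 'rV[R]_N * R => u0 z.1).
  by move=> z; apply: (continuous_comp (f := fst)); [exact: cvg_fst|exact: cu].
have [C C0 HC] := compact_bound (@compact_cylinder R N 0 0 B' 0) ccu.
exists (Num.max M C) => x; rewrite le_max; have [xB|Bx] := leP `|x| B'.
  apply/orP; right; apply: (HC (x, 0)); split => /=; first by rewrite subr0.
  by rewrite subrr normr0.
apply/orP; left; apply: (ae_bound_open cu ug ae).
have e0 : 0 < `|x| - B' by rewrite subr_gt0.
rewrite /interior; apply: filterS (near_norm_lt (V := 'rV[R]_N) x e0) => y yx Oy.
move: yx; rewrite /= distrC; have := OB y Oy; have := ler_normD (x - y) y; rewrite subrK; lra.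
Qed.

(** * Initial and exterior values of the semilimits *)

Lemma truncn_shift {R : realType} (h t : R) : 0 < h -> h <= t ->
  Num.truncn (t / h) = (Num.truncn ((t - h) / h)).+1.
Proof.
move=> h0 ht; have : 0 <= (t - h) / h by rewrite divr_ge0 ?subr_ge0// ltW.
move=> /truncn_itv; rewrite mulrBl divff ?gt_eqF// => /andP[H1 H2]; apply: truncn_def.
by rewrite -natr1 -[X in _ < X]natr1 -lerBrDr H1 -ltrBlDr.
Qed.

Lemma truncn_time {R : realType} (h t : R) : 0 < h -> h * (Num.truncn (t / h))%:R <= Num.max 0 t.
Proof.
move=> h0; have [t0|t0] := leP 0 t.
  exact: step_le.
by rewrite -/(step h t) step_small//; exact: lt_trans h0.
Qed.

Section Semilimit.
Context {R : realType} {n : nat} (s M : R) (Omega : set 'rV[R]_n.+1) (v0 : 'rV[R]_n.+1 -> R).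
Variable U_ : nat -> nat -> 'rV[R]_n.+1 -> R.
Hypotheses (s01 : 0 < s < 1) (domOmega : bounded_strictly_convex_domain Omega).
Hypotheses (cv0 : continuous v0) (v0M : forall x, `|v0 x| <= M).
Hypotheses (U_M : forall k j x, `|U_ k j x| <= M) (U_0 : forall k x, U_ k 0 x <= v0 x).
Hypothesis U_out : forall k j x, ~ (eball x k.+1%:R^-1 `<=` Omega) -> U_ k j x <= v0 x.

(** The grid functions extended to all times as step functions. *)
Definition interpolate k (z : 'rV[R]_n.+1 * R) : R :=
  U_ k (Num.truncn (z.2 / cfl s k.+1%:R^-1)) z.1.

Local Notation w := interpolate.

Let rho01 k : 0 < (k.+1%:R^-1 : R) <= 1.
Proof. by rewrite invr_gt0 ltr0n /= invf_le1 ?ler1n. Qed.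

Let wM k z : `|w k z| <= M. Proof. exact: U_M. Qed.

Lemma semilimit_test Theta : compact Theta -> Theta `<=` usphere ->
  (forall k, substep s Omega Theta k.+1%:R^-1 (U_ k)) ->
  forall phi, smooth phi -> forall x0 t0 delta, 0 < t0 -> 0 < delta ->
    cylinder x0 t0 delta `<=` Omega `*` `]0, +oo[ ->
    (forall z, cylinder x0 t0 delta z ->
       upper_limit w z - phi z <= upper_limit w (x0, t0) - phi (x0, t0)) ->
  exists2 theta, Theta theta & 'D_((0, 1) : 'rV[R]_n.+1 * R) phi (x0, t0) <=
    testJ s delta (slice phi t0) (slice (upper_limit w) t0) x0 theta.
Proof.
move=> cT sT sub; apply: (upper_limit_test s01 wM cT sT) => k x t ht xO.
have /andP[r0 _] := rho01 k.
have [theta Th le] := sub k (Num.truncn ((t - cfl s k.+1%:R^-1) / cfl s k.+1%:R^-1)) x xO _ r0.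
exists theta => //; rewrite {1}/w /= truncn_shift//; exact: cfl_gt0.
Qed.

Hypothesis sub : forall k, substep s Omega usphere k.+1%:R^-1 (U_ k).

Lemma interpolate_barrier (psi : 'rV[R]_n.+1 -> R) (C : R) : 0 <= C ->
  (forall x, `|psi x| <= M) -> (forall x, v0 x <= psi x) ->
  (forall rho x theta, 0 < rho <= 1 -> eball x rho `<=` Omega -> usphere theta ->
     stepI s rho psi x theta <= C) ->
  forall k z, w k z <= psi z.1 + C * Num.max 0 z.2.
Proof.
move=> C0 psiM vpsi psiC k z; have /andP[r0 _] := rho01 k.
have H := substep_barrier s01 (rho01 k) (@sub k) C0 (U_M k) psiM
  (fun x => le_trans (U_0 k x) (vpsi x)) (fun j x xO => le_trans (U_out j xO) (vpsi x))
  (fun x theta xO sth => psiC _ x theta (rho01 k) xO sth).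
apply: (le_trans (H (Num.truncn (z.2 / cfl s k.+1%:R^-1)) z.1)).
by rewrite lerD2l ler_wpM2l//; apply: truncn_time; exact: cfl_gt0.
Qed.

(** The barrier bounds the scheme at all steps, so the bound passes to the relaxed limit. *)
Lemma semilimit_initial x : upper_limit w (x, 0) <= v0 x.
Proof.
apply/ler_addgt0Pr => e e0; have e2 : 0 < e / 2 by rewrite divr_gt0.
have [psi [C [[C0 psiM] vpsi [r r0 Hr] psiC]]] := initial_barrier x s01 cv0 v0M e2.
have W := interpolate_barrier C0 psiM vpsi (fun rho y theta r1 _ => psiC rho y theta r1).
have C1 : 0 < C + 1 by rewrite ltr_wpDl.
apply: (upper_limit_le wM); exists (Num.min r (e / 2 / (C + 1))).
  by rewrite lt_min r0 divr_gt0.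
move=> k y _; rewrite !lt_min subr0 => /andP[y1 _] /andP[_ y2]; rewrite ltr_pdivlMr// in y2.
apply: le_trans (W k y) _; have := Hr y.1 y1.
have y2' : Num.max 0 y.2 <= `|y.2| by rewrite ge_max normr_ge0 ler_norm.
have := ler_wpM2l C0 y2'; have := normr_ge0 y.2; move: y2; lra.
Qed.

(** At boundary points by [boundary_barrier]; at the other exterior points the scheme is equal to the
    datum nearby. *)
Lemma semilimit_exterior x t : ~ Omega x -> upper_limit w (x, t) <= v0 x.
Proof.
move=> nOx; have [[oO _ _] _ _ _] := domOmega.
apply/ler_addgt0Pr => e e0; apply: (upper_limit_le wM).
have [cx|ncx] := pselect (closure Omega x).
  have [a Ha] := global_tangent_ball domOmega ((boundaryP _ oO).2 (conj cx nOx)).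
  have [psi [psiM vpsi [r r0 Hr] psi0]] := boundary_barrier s01 cv0 v0M nOx e0 Ha.
  have W := interpolate_barrier (lexx 0) psiM vpsi psi0.
  exists r => // k y _ y1 _; apply: le_trans (W k y) _.
  by rewrite mul0r addr0; exact: Hr.
have [d d0 Hd] : exists2 d : R, 0 < d & forall y, `|y - x| < d -> ~ Omega y.
  have : nbhs x (~` closure Omega) by apply: open_nbhs_nbhs; split => //; apply: closed_openC; exact: closed_closure.
  move=> /(nbhs_normP (V := 'rV[R]_n.+1))[d /= d0 Hd]; exists d => // y yx Oy.
  by apply: (Hd y); [rewrite /ball_ /= distrC|exact: subset_closure].
have [d' d'0 Hd'] := continuous_modulus x cv0 e0.
exists (Num.min d d'); first by rewrite lt_min d0.
move=> k y _; rewrite lt_min => /andP[yd yd'] _.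
apply: (@le_trans _ _ (v0 y.1)).
  apply: U_out => H; apply: (Hd y.1 yd); apply: H; rewrite /eball /= subrr enorm0.
  by have /andP[] := rho01 k.
by have := Hd' y.1; rewrite distrC yd' => /(_ isT); rewrite ltr_norml; lra.
Qed.

End Semilimit.

(** The relaxed lower limit is minus the relaxed upper limit of the opposite functions; taking points
    near [z] for one large index compares the two. *)
Lemma upper_limit_opp {R : realType} {N : nat} (w : nat -> 'rV[R]_N * R -> R) (M : R) z :
  (forall k z, `|w k z| <= M) -> 0 <= upper_limit w z + upper_limit (fun k z => - w k z) z.
Proof.
move=> wM; have wM' k y : `|- w k y| <= M by rewrite normrN.
apply/ler_addgt0Pr => e e0; have e2 : 0 < e / 2 by rewrite divr_gt0.
have [d d0 Hd] := upper_limit_ge wM z e2.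
have [d' d0' Hd'] := upper_limit_ge wM' z e2.
have m0 : 0 < Num.min d d' by rewrite lt_min d0.
have [k _ /(_ k (leqnn k))] := near_infty_natSinv_lt (PosNum m0).
rewrite /= lt_min => /andP[kd kd'].
have := Hd k z kd; rewrite !subrr !normr0 => /(_ d0 d0).
have := Hd' k z kd'; rewrite !subrr !normr0 => /(_ d0' d0').
by clear; lra.
Qed.

Lemma eq_usc_on {R : realType} {N : nat} (A : set ('rV[R]_N * R)) (u v : 'rV[R]_N * R -> R) :
  (forall z, A z -> u z = v z) -> usc_on A v -> usc_on A u.
Proof.
move=> uv /usc_onP H; apply/usc_onP => z c Az; rewrite (uv z Az) => zc.
have HA : nbhs z (fun y => A y -> v y < c) by exact: H z c Az zc.
have HB : nbhs z (fun y => A y -> u y < c) by apply: filterS HA => y Hy Ay; rewrite (uv y Ay); exact: Hy.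
exact: HB.
Qed.

Lemma bounded_halfspaceP {R : realType} {N : nat} (A : set ('rV[R]_N * R)) (u : 'rV[R]_N * R -> R) :
  [bounded u z | z in A] <-> exists M : R, forall z, A z -> `|u z| <= M.
Proof.
split=> [[M [_ HM]]|[M HM]].
  exists (`|M| + 1) => z Az; apply: (HM (`|M| + 1)) => //.
  by rewrite (le_lt_trans (ler_norm M))// ltrDl.
exists M; split; first exact: num_real.
by move=> y My z Az; apply: le_trans (HM z Az) _; exact: ltW.
Qed.

(** * Existence, uniqueness and comparison *)

(** Solutions are defined through finite horizons; this lets a test cylinder in positive times be used
    with one of them. *)
Lemma cylinder_horizon {R : realType} {N : nat} (Omega : set 'rV[R]_N) x (t d : R) : 0 < t -> 0 < d ->
  cylinder x t d `<=` Omega `*` `]0, +oo[ ->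
  0 < t < t + d /\ cylinder x t d `<=` Omega `*` `]0, (t + d)[.
Proof.
move=> t0 d0 sub; split; first by rewrite t0 ltrDl.
move=> [y q] yq; have [/= Oy] := sub _ yq; rewrite !in_itv/= andbT => q0; split => //=.
by case: yq => _ /=; rewrite !in_itv/= q0 => /andP[].
Qed.

Lemma subsolution_test {R : realType} {N : nat} (s : R) (Omega : set 'rV[R]_N) g u0 u : 0 < s < 1 ->
  viscosity_subsolution s Omega g u0 u ->
  forall phi, smooth phi -> forall x t d, Omega x -> 0 < t -> 0 < d ->
    cylinder x t d `<=` Omega `*` `]0, +oo[ ->
    (forall z, cylinder x t d z -> u z - phi z <= u (x, t) - phi (x, t)) ->
    forall theta, usphere theta ->
    'D_((0, 1) : 'rV[R]_N * R) phi (x, t) <= testJ s d (slice phi t) (slice u t) x theta.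
Proof.
move=> s01 [bu uscu sol] phi sphi x t d Ox t0 d0 cyl touch.
have [M uM] := (bounded_halfspaceP _ _).1 bu.
have [tT cylT] := cylinder_horizon t0 d0 cyl.
have [_ _ _ test] := sol (t + d) (addr_gt0 t0 d0).
apply/(residual_le0P s01 sphi d0); last exact: test.
move=> theta; exists M; apply: (@usc_on_line_bounded R N halfspace) => //.
by move=> y; exact: ltW.
Qed.

Lemma supersolution_test {R : realType} {N : nat} (s : R) (Omega : set 'rV[R]_N) g u0 u : 0 < s < 1 ->
  viscosity_supersolution s Omega g u0 u ->
  forall phi, smooth phi -> forall x t d, Omega x -> 0 < t -> 0 < d ->
    cylinder x t d `<=` Omega `*` `]0, +oo[ ->
    (forall z, cylinder x t d z -> u (x, t) - phi (x, t) <= u z - phi z) ->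
    forall e : R, 0 < e -> exists2 theta, usphere theta &
    testJ s d (slice phi t) (slice u t) x theta <= 'D_((0, 1) : 'rV[R]_N * R) phi (x, t) + e.
Proof.
move=> s01 [bu lscu sol] phi sphi x t d Ox t0 d0 cyl touch.
have [M uM] := (bounded_halfspaceP _ _).1 bu.
have [tT cylT] := cylinder_horizon t0 d0 cyl.
have [_ _ _ test] := sol (t + d) (addr_gt0 t0 d0).
apply/(residual_ge0P s01 sphi d0); last exact: test.
move=> theta; exists M; apply: (@lsc_on_line_bounded R N halfspace) => //.
by move=> y; exact: ltW.
Qed.

Lemma viscosity_comparison {R : realType} {N : nat} (s : R) (Omega : set 'rV[R]_N) g u0 ubar uund :
  0 < s < 1 -> open Omega -> bounded_set Omega ->
  viscosity_supersolution s Omega g u0 ubar -> viscosity_subsolution s Omega g u0 uund ->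
  forall x t, 0 <= t -> uund (x, t) <= ubar (x, t).
Proof.
move=> s01 oO bO sup sub.
have [bsup lsc_sup solsup] := sup; have [bsub usc_sub solsub] := sub.
have [M1 HM1] := (bounded_halfspaceP _ _).1 bsup.
have [M2 HM2] := (bounded_halfspaceP _ _).1 bsub.
have out x t : ~ Omega x -> 0 <= t -> uund (x, t) <= ubar (x, t).
  move=> nOx t0; have t1 : 0 < t + 1 by rewrite ltr_wpDl.
  have [_ sup_out _ _] := solsup _ t1; have [_ sub_out _ _] := solsub _ t1.
  have tt : 0 <= t < t + 1 by rewrite t0 ltrDl ltr01.
  exact: le_trans (sub_out x t nOx tt) (sup_out x t nOx tt).
move=> x t t0; have [Ox|/out] := pselect (Omega x); last exact.
apply: (comparison_principle (M := Num.max M1 M2) s01 oO bO) => //.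
- by move=> z hz; rewrite le_max HM2// orbT.
- by move=> z hz; rewrite le_max HM1.
- move=> [y q] hz /= H; have [Oy|/out] := pselect (Omega y); last exact.
  have q0 : q = 0 by case: H.
  have [_ _ sup0 _] := solsup 1 ltr01; have [_ _ sub0 _] := solsub 1 ltr01.
  by rewrite q0; exact: le_trans (sub0 y Oy) (sup0 y Oy).
- exact: subsolution_test sub.
- exact: supersolution_test sup.
Qed.

Lemma continuous_of_semicontinuous {R : realType} {N : nat} (A : set ('rV[R]_N * R)) u :
  usc_on A u -> lsc_on A u -> {within A, continuous u}.
Proof.
move=> /usc_onP usc /lsc_on_opp/usc_onP lsc; apply/subspace_continuousP => z Az.
apply/cvgrPdist_lt => e e0.
have H1 : nbhs z (fun y => A y -> u y < u z + e) by apply: (usc z (u z + e) Az); rewrite ltrDl.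
have H2 : nbhs z (fun y => A y -> - u y < - u z + e) by apply: (lsc z (- u z + e) Az); rewrite ltrDl.
have H : nbhs z (fun y => A y -> `|u z - u y| < e).
  apply: filterS2 H1 H2 => y Hy1 Hy2 Ay.
  by have := Hy1 Ay; have := Hy2 Ay; rewrite ltr_norml; lra.
exact: H.
Qed.

Lemma smoothN {R : realType} {N : nat} (phi : 'rV[R]_N * R -> R) : smooth phi -> smooth (fun z => - phi z).
Proof.
move=> sphi k; have -> : (fun z => - phi z) = (fun z => -1 * phi z) by apply/funext => z; rewrite mulN1r.
by apply: CkM; [exact: Ck_cst|exact: sphi].
Qed.

Lemma testJ_opp {R : realType} {N : nat} (s d M : R) phi (u : 'rV[R]_N * R -> R) x (t : R) theta :
  0 < s < 1 -> smooth phi -> 0 < d -> usphere theta -> line_bounded (slice u t) x theta M ->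
  testJ s d (slice (fun z => - phi z) t) (slice (fun z => - u z) t) x theta =
  - testJ s d (slice phi t) (slice u t) x theta.
Proof.
move=> s01 sphi d0 sth lb.
have [C C0 HC] := sd_quadratic_bound x t d 0 sphi.
have lJ : levy (splice d (fun r => sd (slice phi t) x (r *: theta)) (fun r => sd (slice u t) x (r *: theta))).
  apply: (levy_splice_near (M := 4 * M) (C := C) d0).
  - apply: measurable_funTS; apply: measurable_sd; apply: continuous_measurable_fun.
    by apply: continuous_line; apply: continuous_slice; exact: Ck_cont (sphi 0%N).
  - by apply: measurable_funTS; apply: measurable_sd; case: lb.
  - move=> r /andP[r0 rd]; have := HC x t (r *: theta).
    rewrite !subrr !normr0 lexx (ltW d0) normrZ enormZ sth mulr1 gtr0_norm//; apply => //.
    apply: le_trans (ltW rd); rewrite -[leRHS]mulr1.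
    by apply: ler_wpM2l; [exact: ltW|exact: usphere_norm].
  - by move=> r _; exact: sd_bounded.
rewrite /testJ -levyI_N//; apply: levyI_eq => r r0; rewrite /splice.
have aux (a b c : R) : - a + - b - 2 * - c = - (a + b - 2 * c) by ring.
by case: ifP => _; exact: aux.
Qed.

(** The relaxed upper limit [U] of the scheme is a subsolution and the relaxed lower limit [V] a
    supersolution, with [U <= u0 <= V] on the parabolic boundary. Comparison gives [U <= V], and
    [V <= U] by construction: they agree and are continuous. *)
Lemma viscosity_existence {R : realType} {n : nat} (s M : R) (Omega : set 'rV[R]_n.+1)
    (u0 g : 'rV[R]_n.+1 -> R) : 0 < s < 1 -> bounded_strictly_convex_domain Omega ->
  continuous u0 -> (forall x, `|u0 x| <= M) -> (forall x, ~ Omega x -> u0 x = g x) ->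
  exists u, viscosity_solution s Omega g u0 u.
Proof.
move=> s01 domO cu0 u0M u0g; have [[oO _ _] bO _ _] := domO.
have cu0' : continuous (fun x => - u0 x).
  apply: (@continuous_of_modulus R 'rV[R]_n.+1) => x e e0.
  have [d d0 H] := continuous_modulus x cu0 e0; exists d => // y /H.
  by rewrite -opprD normrN.
have u0M' x : `|- u0 x| <= M by rewrite normrN.
have rho01 k : 0 < (k.+1%:R^-1 : R) <= 1 by rewrite invr_gt0 ltr0n /= invf_le1 ?ler1n.
pose S k := scheme s Omega u0 k.+1%:R^-1.
pose S' k j x := - S k j x.
have SM k j x : `|S k j x| <= M := scheme_bounded Omega s01 u0M j x (rho01 k).
have SM' k j x : `|S' k j x| <= M by rewrite normrN.
have Sout k j x : ~ (eball x k.+1%:R^-1 `<=` Omega) -> S k j x = u0 x.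
  by move=> xO; rewrite /S; case: j => // j /=; case: asboolP.
pose w := interpolate s S; pose w' := interpolate s S'.
have wM k z : `|w k z| <= M by exact: SM.
have wM' k z : `|w' k z| <= M by exact: SM'.
pose U := upper_limit w; pose U' := upper_limit w'.
have subS theta : usphere theta -> forall k, substep s Omega [set theta] k.+1%:R^-1 (S k).
  by move=> sth k; exact (@substep_scheme R n s Omega u0 M _ theta s01 u0M (rho01 k) sth).
have subSs k : substep s Omega usphere k.+1%:R^-1 (S k).
  move=> j x xO e e0; have [th sth] := @usphere_nonempty R n.
  by have [_ -> le] := subS th sth k j x xO e e0; exists th.
have subS' k : substep s Omega usphere k.+1%:R^-1 (S' k) :=
  @substep_schemeN R n s Omega u0 M _ s01 u0M (rho01 k).
have U_out x t : ~ Omega x -> U (x, t) <= u0 x.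
  apply: (semilimit_exterior (v0 := u0) s01 domO cu0 u0M SM (fun k y => lexx _) _ subSs).
  by move=> k j y yO; rewrite Sout.
have U'_out x t : ~ Omega x -> U' (x, t) <= - u0 x.
  apply: (semilimit_exterior (v0 := fun x => - u0 x) s01 domO cu0' u0M' SM' (fun k y => lexx _) _ subS').
  by move=> k j y yO; rewrite /S' Sout.
have U_0 x : U (x, 0) <= u0 x.
  apply: (semilimit_initial (v0 := u0) s01 cu0 u0M SM (fun k y => lexx _) _ subSs).
  by move=> k j y yO; rewrite Sout.
have U'_0 x : U' (x, 0) <= - u0 x.
  apply: (semilimit_initial (v0 := fun x => - u0 x) s01 cu0' u0M' SM' (fun k y => lexx _) _ subS').
  by move=> k j y yO; rewrite /S' Sout.
have UU' z : - U' z <= U z.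
  by have := upper_limit_opp z wM; rewrite -/U -[upper_limit (fun k z => _)]/U'; lra.
have UM z : `|U z| <= M by exact: upper_limit_bounded.
have U'M z : `|U' z| <= M by exact: upper_limit_bounded.
have uscU A : usc_on A U.
  by apply/usc_onP => z c _ zc; apply: filterS (upper_limit_usc wM zc) => y.
have uscU' A : usc_on A U'.
  by apply/usc_onP => z c _ zc; apply: filterS (upper_limit_usc wM' zc) => y.
pose V z := - U' z.
have lscV A : lsc_on A V.
  apply/lsc_on_opp; apply: (eq_usc_on (v := U')); last exact: uscU'.
  by move=> z _; rewrite /V opprK.
have VM z : `|V z| <= M by rewrite normrN.
have testU phi : smooth phi -> forall x t d, Omega x -> 0 < t -> 0 < d ->
    cylinder x t d `<=` Omega `*` `]0, +oo[ ->
    (forall z, cylinder x t d z -> U z - phi z <= U (x, t) - phi (x, t)) ->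
    forall theta, usphere theta ->
    'D_((0, 1) : 'rV[R]_n.+1 * R) phi (x, t) <= testJ s d (slice phi t) (slice U t) x theta.
  move=> sphi x t d _ t0 d0 cyl touch theta sth.
  have cth : compact [set theta] by exact: compact_set1.
  have thS : [set theta] `<=` usphere by move=> _ ->.
  have [_ -> ] := semilimit_test s01 SM cth thS (subS theta sth) sphi t0 d0 cyl touch.
  exact.
have testV phi : smooth phi -> forall x t d, Omega x -> 0 < t -> 0 < d ->
    cylinder x t d `<=` Omega `*` `]0, +oo[ ->
    (forall z, cylinder x t d z -> V (x, t) - phi (x, t) <= V z - phi z) ->
    exists2 theta, usphere theta &
    testJ s d (slice phi t) (slice V t) x theta <= 'D_((0, 1) : 'rV[R]_n.+1 * R) phi (x, t).
  move=> sphi x t d _ t0 d0 cyl touch.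
  have [|theta sth le] := semilimit_test s01 SM' compact_usphere (@subset_refl _ _) subS' (smoothN sphi)
    t0 d0 cyl.
    move=> z /touch; rewrite /V.
    have aux (a b c e : R) : - a - b <= - c - e -> c - - e <= a - - b by lra.
    exact: aux.
  exists theta => //.
  have lbV : line_bounded (slice V t) x theta M.
    by apply: (@lsc_on_line_bounded R n.+1 setT) => //.
  have EU : U' = (fun z => - V z) by apply/funext => z; rewrite /V opprK.
  move: le; rewrite -[upper_limit _]/U' EU (testJ_opp s01 sphi d0 sth lbV).
  have -> : 'D_((0, 1) : 'rV[R]_n.+1 * R) (fun z => - phi z) (x, t) =
      - 'D_((0, 1) : 'rV[R]_n.+1 * R) phi (x, t).
    by rewrite deriveN//; have [_ + _] := sphi 1%N; exact.
  by rewrite lerN2.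
have UV x t : 0 <= t -> U (x, t) <= V (x, t).
  have out y q : ~ Omega y \/ q = 0 -> U (y, q) <= V (y, q).
    have aux (a b c : R) : a <= c -> b <= - c -> a <= - b by lra.
    case=> [nOy|->]; first exact: aux (U_out y q nOy) (U'_out y q nOy).
    exact: aux (U_0 y) (U'_0 y).
  move=> t0; have [Ox|nOx] := pselect (Omega x); last by apply: out; left.
  apply: (comparison_principle (M := M) s01 oO bO) => //.
    by move=> [y q] _; exact: out.
  move=> phi sphi y q d Oy q0 d0 cyl touch e e0.
  have [theta sth le] := testV phi sphi y q d Oy q0 d0 cyl touch.
  by exists theta => //; apply: le_trans le _; rewrite lerDl ltW.
have UE z : halfspace z -> U z = V z.
  by case: z => x t hz; apply/eqP; rewrite eq_le UV// UU'.
have lscU A : A `<=` halfspace -> lsc_on A U.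
  move=> Ah; apply/lsc_on_opp; apply: (eq_usc_on (v := U')); last exact: uscU'.
  by move=> z Az; rewrite UE; [rewrite /V opprK|exact: Ah].
have stripS T : strip T `<=` (halfspace : set ('rV[R]_n.+1 * R)) by move=> z /andP[].
have bU A : [bounded U z | z in A] by apply/bounded_halfspaceP; exists M => z _.
have Uout x t : ~ Omega x -> 0 <= t -> U (x, t) = g x.
  move=> nOx t0; rewrite -u0g//; apply/eqP; rewrite eq_le U_out//= UE//.
  by have := U'_out x t nOx; rewrite /V; lra.
have U0 x : U (x, 0) = u0 x.
  apply/eqP; rewrite eq_le U_0//= UE; last exact: (lexx 0).
  by have := U'_0 x; rewrite /V; lra.
have lbU x t : 0 < t -> forall theta, exists M : R, line_bounded (slice U t) x theta M.
  by move=> t0 theta; exists M; apply: (@usc_on_line_bounded R n.+1 setT).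
have cylE T x t d : cylinder x t d `<=` Omega `*` `]0, T[ -> cylinder x t d `<=` Omega `*` `]0, +oo[.
  move=> sub [y q] /sub[/= Oy]; rewrite in_itv/= => /andP[q0 _]; split => //=.
  by rewrite in_itv/= q0.
exists U; split.
- by apply: continuous_of_semicontinuous => //; exact: lscU.
- split => // T T0; split => //.
    by move=> x t nOx /andP[t0 _]; rewrite Uout.
  move=> phi sphi x t d Ox /andP[t0 tT] d0 cyl touch.
  by apply/(residual_le0P s01 sphi d0 (lbU x t t0)); apply: testU => //; exact: cylE cyl.
- split => [//||T T0]; first exact: lscU.
  split.
  + by split => //; apply: lscU; exact: stripS.
  + by move=> x t nOx /andP[t0 _]; rewrite Uout.
  + by move=> x _; rewrite U0.
  move=> phi sphi x t d Ox /andP[t0 tT] d0 cyl touch.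
  apply/(residual_ge0P s01 sphi d0 (lbU x t t0)) => e e0.
  have hcyl z : cylinder x t d z -> halfspace z.
    by move=> /cyl; case: z => y q [_ /=]; rewrite in_itv/= => /andP[/ltW].
  have hx : halfspace (x, t) by exact: ltW.
  have [|theta sth le] := testV phi sphi x t d Ox t0 d0 (cylE _ _ _ _ cyl).
    by move=> z zc; rewrite -!UE//; [exact: touch|exact: hcyl].
  exists theta => //.
  have -> : slice U t = slice V t by apply/funext => y; exact: (UE (y, t) (ltW t0)).
  by apply: le_trans le _; rewrite lerDl ltW.
Qed.

Theorem theorem1p1 (R : realType) (N : nat) (s : R) (Omega : set 'rV[R]_N)
    (u0 g : 'rV[R]_N -> R)
    (hN : (2 < N)%N) (hs : 0 < s < 1)
    (hOmega : bounded_strictly_convex_domain Omega)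
    (hu0 : continuous u0)
    (hu0_def : ae_on Omega (Lambda1_defined s u0))
    (hu0_bnd : Linfty Omega (Lambda1 s u0))
    (hg : {within ~` Omega, continuous g})
    (hg_bnd : Linfty (~` Omega) (fun x => (g x)%:E))
    (hu0g : forall x, ~ Omega x -> u0 x = g x) :
  (exists u : 'rV[R]_N * R -> R,
     viscosity_solution s Omega g u0 u /\
     forall v : 'rV[R]_N * R -> R, viscosity_solution s Omega g u0 v ->
       forall x t, 0 <= t -> v (x, t) = u (x, t)) /\
  (forall ubar uund : 'rV[R]_N * R -> R,
     viscosity_supersolution s Omega g u0 ubar ->
     viscosity_subsolution s Omega g u0 uund ->
     forall x t, Omega x -> 0 < t -> uund (x, t) <= ubar (x, t)).
Proof.
have [[oO _ _] bO _ _] := hOmega.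
have comparison := viscosity_comparison hs oO bO.
split; last by move=> ubar uund sup sub x t _ /ltW; exact: (comparison g u0).
have [M u0M] := datum_bounded bO hu0 hu0g hg_bnd.
have [u solu] : exists u, viscosity_solution s Omega g u0 u.
  case: N => [|n] in Omega u0 g hN hOmega hu0 hu0_def hu0_bnd hg hg_bnd hu0g oO bO comparison u0M *.
    by [].
  exact: viscosity_existence u0M hu0g.
exists u; split => // v [_ subv supv] x t t0; have [_ subu supu] := solu.
by apply/eqP; rewrite eq_le (comparison _ _ _ _ supu subv)// (comparison _ _ _ _ supv subu).
Qed.
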